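(* Let $s\in\mathbb{R}$, $s\neq0$, and let $g\in L^2(\mathbb{R})$ be such that the wavelet transform $$W_g(f)(x)=\frac{1}{\sqrt{|s|\pi}}\int_{\mathbb{R}} f(t)\,g(s^{-1}(t-x))\,dt,\qquad f\in L^2(\mathbb{R}),$$ is a bounded linear operator on $L^2(\mathbb{R})$. Let $B:L^2(\mathbb{R})\to F^2$ be the Bargmann transform. Then the operator $T=BW_gB^{-1}:F^2\to F^2$ is given by $$Tf(z)=\sqrt{\frac{|s|}{\pi}}\int_{\mathbb{C}} f(w)\,e^{z\overline{w}}\left(\int_{\mathbb{R}} g(t)\,e^{-\frac{s^2}{2}t^2-st(z-\overline{w})}\,dt\right)d\lambda(w),\qquad z\in\mathbb{C},$$ for all $f\in F^2$.
   Context: The Fock space $F^2$ is the Hilbert space of all entire functions $f$ on $\mathbb{C}$ with $\|f\|^2=\int_{\mathbb{C}}|f(z)|^2\,d\lambda(z)<\infty$, where $d\lambda(z)=\frac1\pi e^{-|z|^2}\,dA(z)$ and $dA$ is area (Lebesgue) measure; its inner product is that of $L^2(\mathbb{C},d\lambda)$. $L^2(\mathbb{R})=L^2(\mathbb{R},dx)$ consists of complex-valued functions. The Bargmann transform $B:L^2(\mathbb{R})\to F^2$ is $$Bf(z)=c\int_{\mathbb{R}} f(x)e^{2xz-x^2-(z^2/2)}\,dx,\qquad c=(2/\pi)^{1/4};$$ it is a well-known fact that $B$ is a unitary operator from $L^2(\mathbb{R})$ onto $F^2$. *)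

(* Defs.v *)
From HB Require Import structures.
From mathcomp Require Import all_boot all_order all_algebra.
From mathcomp Require Import complex.
From mathcomp Require Import all_classical all_reals all_analysis.

Set Implicit Arguments.
Unset Strict Implicit.
Unset Printing Implicit Defensive.

Import Order.TTheory GRing.Theory Num.Theory.
Import numFieldNormedType.Exports.

Local Open Scope classical_set_scope.
Local Open Scope ring_scope.
Local Open Scope complex_scope.

Section ComplexIntegral.
Context (d : measure_display) (T : measurableType d) (R : realType).
Variable mu : {measure set T -> \bar R}.

Definition cmeasurable (f : T -> R[i]) : Prop :=
  measurable_fun setT (fun t => complex.Re (f t)) /\
  measurable_fun setT (fun t => complex.Im (f t)).

Definition cintegrable (f : T -> R[i]) : Prop :=
  mu.-integrable setT (fun t => (complex.Re (f t))%:E) /\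
  mu.-integrable setT (fun t => (complex.Im (f t))%:E).

Definition cintegral (f : T -> R[i]) : R[i] :=
  Rintegral mu setT (fun t => complex.Re (f t)) +i*
  Rintegral mu setT (fun t => complex.Im (f t)).

End ComplexIntegral.

Section Fock.
Context (R : realType).
Local Notation C := R[i].
Local Notation leb := (@lebesgue_measure R).
Local Notation area := (leb \x leb)%E.

Definition cexp (z : C) : C :=
  (expR (complex.Re z))%:C *
  (cos (complex.Im z) +i* sin (complex.Im z)).

(* Elements of L^2(R) are represented by Borel functions; equality in L^2(R)
   is equality almost everywhere, which is why linearity in
   [bounded_linear_L2] is only required almost everywhere. *)

Definition sqnorm_L2 (f : R -> C) : \bar R :=
  (\int[leb]_x (ComplexField.Normc.normc (f x) ^+ 2)%:E)%E.

Definition L2 (f : R -> C) : Prop :=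
  cmeasurable f /\ (sqnorm_L2 f < +oo)%E.

Definition norm_L2 (f : R -> C) : R := Num.sqrt (fine (sqnorm_L2 f)).

Definition bounded_linear_L2 (W : (R -> C) -> R -> C) : Prop :=
  [/\ forall f, L2 f -> L2 (W f),
      forall (a : C) f h, L2 f -> L2 h ->
        {ae leb, forall x, W (fun t => a * f t + h t) x = a * W f x + W h x}
    & exists M : R, forall f, L2 f -> norm_L2 (W f) <= M * norm_L2 f].

Definition plane (p : R * R) : C := p.1 +i* p.2.

Definition fock_weight (z : C) : R :=
  pi^-1 * expR (- ComplexField.Normc.normc z ^+ 2).

(* Integration against the Gaussian measure
   d lambda(z) = fock_weight z dA(z), A the area measure. *)
Definition lambda_integrable (f : C -> C) : Prop :=
  cintegrable area (fun p => f (plane p) * (fock_weight (plane p))%:C).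

Definition lambda_integral (f : C -> C) : C :=
  cintegral area (fun p => f (plane p) * (fock_weight (plane p))%:C).

(* [derivable f z 1] over the scalar field [C] is complex differentiability
   at [z]. *)
Definition entire (f : C -> C) : Prop :=
  forall z : C, derivable (f : C^o -> C^o) z 1.

Definition F2 (f : C -> C) : Prop :=
  entire f /\
  (\int[area]_p (ComplexField.Normc.normc (f (plane p)) ^+ 2
                 * fock_weight (plane p))%:E < +oo)%E.

Definition bargmann (f : R -> C) (z : C) : C :=
  ((2 / pi) `^ (1 / 4))%:C *
  cintegral leb (fun x =>
    f x * cexp (2%:R * x%:C * z - (x ^+ 2)%:C - z ^+ 2 / 2%:R)).

(* The preimage of [f] in L^2(R) is unique up to equality almost everywhere;
   the default value 0 is only used when [f] is not in the range of the
   Bargmann transform, hence never when [f] is in F^2. *)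
Definition bargmann_inv (f : C -> C) : R -> C :=
  xget (fun=> 0) [set phi : R -> C | L2 phi /\ bargmann phi = f].

Definition wavelet (s : R) (g f : R -> C) (x : R) : C :=
  ((Num.sqrt (`|s| * pi))^-1)%:C *
  cintegral leb (fun t => f t * g (s^-1 * (t - x))).

Definition fock_operator (s : R) (g : R -> C) (f : C -> C) : C -> C :=
  bargmann (wavelet s g (bargmann_inv f)).

End Fock.

(* Main.v *)
(* The reproducing formula: integrating [f w * cexp (z * conj w)] against lambda gives
   [f z].  After a translation this is the mean value property of an entire [h]
   against the Gaussian: away from the origin, [(h z - h 0) * cexp (- |z|^2)] is the
   derivative of [- (h z - h 0) / z * cexp (- |z|^2)] with respect to the conjugate of
   [z], so its integral vanishes by Green's formula, which bisection gives for functions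
   that are merely differentiable.

   Multiplied by the square root of the Gaussian weight, the Bargmann kernel composed
   with its adjoint is the weighted reproducing kernel [Theta], whose absolute value is
   a Gaussian convolution kernel.  Schur's test then bounds the Bargmann transform, and
   the adjoint applied to truncations of [f] in [F2] converges to a preimage of [f].

   For the formula itself, Fubini and the substitution [x = t - s u] give
   [T f z = sqrt (|s| / pi) * int g u * cexp (- s^2 u^2 / 2 - s u z) * f (z + s u) du];
   it remains to expand [f (z + s u)] by the reproducing formula and to exchange the
   integrals once more. *)

Require Import Defs.
From HB Require Import structures.
From mathcomp Require Import all_boot all_order all_algebra.
From mathcomp Require Import complex ring lra.
From mathcomp Require Import all_classical all_reals all_analysis.
From mathcomp Require Import measurable_realfun.

Import Order.TTheory GRing.Theory Num.Theory.
Import numFieldNormedType.Exports.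

Set Implicit Arguments.
Unset Strict Implicit.
Unset Printing Implicit Defensive.

Local Open Scope classical_set_scope.
Local Open Scope ring_scope.
Local Open Scope complex_scope.

(** [bargmann_inv] selects an arbitrary preimage, so every [f] in [F2] must be shown to have one;
    the resulting formula involves the selected [phi] only through [bargmann phi = f]. [entire]
    means complex differentiable at each point, with no continuity of the derivative. Hence
    Goursat's subdivision argument, which asks of a vector field only differentiability at each
    point and, at the origin, where the quotient [(h z - h 0) / z] is singular, only boundedness
    nearby. The kernel [cexp (z * conj w)] is far from bounded. With the square root of the weight
    attached to each variable, its growth is absorbed into a Gaussian in [z - w], and Lebesgue
    measure replaces the Gaussian measure. Schur's test then serves both for operator bounds and for
    the absolute convergence behind the exchanges of integrals. The mean value property is used a
    second time to evaluate Gaussian integrals with imaginary frequency. Completeness of the space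
    of square integrable functions enters through a rapidly converging subsequence, which comes with
    an integrable majorant and so lets the limit pass under the integral. *)

Local Notation normc := ComplexField.Normc.normc.

(** * Complex numbers and complex-valued integrals *)

Section ComplexNumbers.
Context (R : realType).
Implicit Types z w : R[i].

Lemma normc_ge0 z : 0 <= normc z.
Proof. by case: z => a b /=; rewrite sqrtr_ge0. Qed.

Lemma sqr_normcE z : normc z ^+ 2 = complex.Re z ^+ 2 + complex.Im z ^+ 2.
Proof. by case: z => a b /=; rewrite sqr_sqrtr// addr_ge0// sqr_ge0. Qed.

Lemma normr_normc z : `|z| = (normc z)%:C.
Proof. by []. Qed.

Lemma ReM z w : complex.Re (z * w) =
  complex.Re z * complex.Re w - complex.Im z * complex.Im w.
Proof. by case: z => a b; case: w => c d. Qed.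

Lemma ImM z w : complex.Im (z * w) =
  complex.Re z * complex.Im w + complex.Im z * complex.Re w.
Proof. by case: z => a b; case: w => c d. Qed.

Lemma ReD z w : complex.Re (z + w) = complex.Re z + complex.Re w.
Proof. by case: z => a b; case: w => c d. Qed.

Lemma ImD z w : complex.Im (z + w) = complex.Im z + complex.Im w.
Proof. by case: z => a b; case: w => c d. Qed.

Lemma ReN z : complex.Re (- z) = - complex.Re z.
Proof. by case: z. Qed.

Lemma ImN z : complex.Im (- z) = - complex.Im z.
Proof. by case: z. Qed.

Lemma ReJ z : complex.Re z^* = complex.Re z.
Proof. by case: z. Qed.

Lemma ImJ z : complex.Im z^* = - complex.Im z.
Proof. by case: z. Qed.

Lemma Re_real (x : R) : complex.Re x%:C = x. Proof. by []. Qed.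

Lemma Im_real (x : R) : complex.Im x%:C = 0. Proof. by []. Qed.

Lemma complex_eq z w : complex.Re z = complex.Re w ->
  complex.Im z = complex.Im w -> z = w.
Proof. by case: z => a b; case: w => c d /= -> ->. Qed.

Lemma normc_real (x : R) : normc x%:C = `|x|.
Proof. by rewrite /= expr0n/= addr0 sqrtr_sqr. Qed.

Lemma normc_conj z : normc z^* = normc z.
Proof. by case: z => a b /=; rewrite sqrrN. Qed.

Lemma normcX z n : normc (z ^+ n) = normc z ^+ n.
Proof.
by elim: n => [|n IH]; rewrite ?expr0 ?ComplexField.Normc.normc1// !exprS
  ComplexField.Normc.normcM IH.
Qed.

Lemma normc_eq0 z : (normc z == 0) = (z == 0).
Proof.
apply/idP/idP => [/eqP/ComplexField.Normc.eq0_normc ->//|/eqP ->].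
by rewrite ComplexField.Normc.normc0.
Qed.

Lemma Re_le_normc z : `|complex.Re z| <= normc z.
Proof. by rewrite -sqrtr_sqr; case: z => a b /=; rewrite ler_wsqrtr// lerDl sqr_ge0. Qed.

Lemma Im_le_normc z : `|complex.Im z| <= normc z.
Proof. by rewrite -sqrtr_sqr; case: z => a b /=; rewrite ler_wsqrtr// lerDr sqr_ge0. Qed.

Lemma normc_le_ReIm z : normc z <= `|complex.Re z| + `|complex.Im z|.
Proof.
rewrite -(@ler_pXn2r _ 2)// ?nnegrE ?normc_ge0 ?addr_ge0//.
rewrite sqr_normcE sqrrD !real_normK ?num_real// lerD2r lerDl.
by rewrite mulrn_wge0// mulr_ge0.
Qed.

Lemma mulcJ_normc z : z * z^* = (normc z ^+ 2)%:C.
Proof.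
by apply: complex_eq; rewrite ?ReM ?ImM ReJ ImJ ?Re_real ?Im_real ?sqr_normcE; ring.
Qed.

Lemma cexpD z w : cexp (z + w) = cexp z * cexp w.
Proof.
apply: complex_eq; rewrite /cexp !(ReM, ImM) ?Re_real ?Im_real /= !(ReD, ImD)
  expRD (cosD, sinD); ring.
Qed.

Lemma cexp0 : cexp 0 = 1 :> R[i].
Proof. by rewrite /cexp /= expR0 cos0 sin0 mul1r. Qed.

Lemma cexp_real (x : R) : cexp x%:C = (expR x)%:C.
Proof. by rewrite /cexp /= cos0 sin0 mulr1. Qed.

Lemma Re_cexp z : complex.Re (cexp z) = expR (complex.Re z) * cos (complex.Im z).
Proof. by rewrite /cexp ReM /= mul0r subr0. Qed.

Lemma Im_cexp z : complex.Im (cexp z) = expR (complex.Re z) * sin (complex.Im z).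
Proof. by rewrite /cexp ImM /= mul0r addr0. Qed.

Lemma normc_cexp z : normc (cexp z) = expR (complex.Re z).
Proof.
rewrite /cexp ComplexField.Normc.normcM normc_real /= cos2Dsin2 sqrtr1 mulr1.
by rewrite ger0_norm// expR_ge0.
Qed.

Lemma conj_cexp z : (cexp z)^* = cexp z^*.
Proof.
by apply: complex_eq; rewrite ?ReJ ?ImJ ?Re_cexp ?Im_cexp ?ReJ ?ImJ ?cosN// sinN mulrN.
Qed.

End ComplexNumbers.

Arguments ComplexField.Normc.normc : simpl never.

Section ComplexMeasurable.
Context (d : measure_display) (T : measurableType d) (R : realType).
Implicit Types f g : T -> R[i].

Lemma cmeasurable_cst (c : R[i]) : cmeasurable (fun _ : T => c).
Proof. by split; exact: measurable_cst. Qed.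

Lemma cmeasurable_real (f : T -> R) :
  measurable_fun setT f -> cmeasurable (fun t => (f t)%:C).
Proof. by move=> mf; split => //; exact: measurable_cst. Qed.

Lemma cmeasurableD f g :
  cmeasurable f -> cmeasurable g -> cmeasurable (fun t => f t + g t).
Proof.
move=> [rf If] [rg Ig]; split.
- rewrite (_ : (fun t => _) = (fun t => complex.Re (f t)) \+ (fun t => complex.Re (g t))).
    exact: measurable_funD.
  by apply/funext => t /=; rewrite ReD.
- rewrite (_ : (fun t => _) = (fun t => complex.Im (f t)) \+ (fun t => complex.Im (g t))).
    exact: measurable_funD.
  by apply/funext => t /=; rewrite ImD.
Qed.

Lemma cmeasurableM f g :
  cmeasurable f -> cmeasurable g -> cmeasurable (fun t => f t * g t).
Proof.
move=> [rf If] [rg Ig]; split.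
- under eq_fun do rewrite ReM.
  by apply: measurable_funB; apply: measurable_funM.
- under eq_fun do rewrite ImM.
  by apply: measurable_funD; apply: measurable_funM.
Qed.

Lemma cmeasurableN f : cmeasurable f -> cmeasurable (fun t => - f t).
Proof.
move=> [rf If]; split.
- by under eq_fun do rewrite ReN; apply: measurableT_comp.
- by under eq_fun do rewrite ImN; apply: measurableT_comp.
Qed.

Lemma cmeasurableB f g :
  cmeasurable f -> cmeasurable g -> cmeasurable (fun t => f t - g t).
Proof. by move=> mf mg; apply: cmeasurableD => //; exact: cmeasurableN. Qed.

Lemma cmeasurableJ f : cmeasurable f -> cmeasurable (fun t => (f t)^*).
Proof.
move=> [rf If]; split.
- by under eq_fun do rewrite ReJ.
- by under eq_fun do rewrite ImJ; apply: measurableT_comp.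
Qed.

Lemma cmeasurable_cexp f : cmeasurable f -> cmeasurable (fun t => cexp (f t)).
Proof.
move=> [rf If]; split.
- under eq_fun do rewrite Re_cexp.
  apply: measurable_funM; apply: measurableT_comp => //.
  by apply: continuous_measurable_fun => x; exact: continuous_cos.
- under eq_fun do rewrite Im_cexp.
  apply: measurable_funM; apply: measurableT_comp => //.
  by apply: continuous_measurable_fun => x; exact: continuous_sin.
Qed.

Lemma measurable_sqr_normc f :
  cmeasurable f -> measurable_fun setT (fun t => normc (f t) ^+ 2).
Proof.
move=> [rf If]; under eq_fun do rewrite sqr_normcE.
by apply: measurable_funD; apply: measurable_funX.
Qed.

Lemma measurable_normc f :
  cmeasurable f -> measurable_fun setT (fun t => normc (f t)).
Proof.
move=> mf; rewrite (_ : (fun t => _) = (fun x : R => x `^ (2^-1)) \o (fun t => normc (f t) ^+ 2)).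
  by apply: measurableT_comp (measurable_sqr_normc mf) => //; exact: measurable_powR.
apply/funext => t /=; rewrite -powR_mulrn ?normc_ge0// -powRrM divff//.
by rewrite powRr1// normc_ge0.
Qed.

Lemma cmeasurable_comp (d' : measure_display) (T' : measurableType d')
    (f : T' -> R[i]) (h : T -> T') :
  cmeasurable f -> measurable_fun setT h -> cmeasurable (fun t => f (h t)).
Proof.
move=> [rf If] mh; split.
- exact: (measurableT_comp rf).
- exact: (measurableT_comp If).
Qed.

End ComplexMeasurable.

Section ComplexIntegrals.
Context (d : measure_display) (T : measurableType d) (R : realType).
Variable mu : {measure set T -> \bar R}.
Implicit Types f g : T -> R[i].

Lemma cintegrable_cmeasurable f : cintegrable mu f -> cmeasurable f.
Proof.
by move=> [/measurable_int/measurable_EFinP rf /measurable_int/measurable_EFinP If].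
Qed.

Lemma le_cintegrable f (g : T -> R) : cmeasurable f ->
  (forall x, normc (f x) <= g x) -> mu.-integrable setT (EFin \o g) ->
  cintegrable mu f.
Proof.
move=> [rf If] fg ig; split.
- apply: le_integrable ig => //; first exact/measurable_EFinP.
  move=> x _ /=; rewrite lee_fin (le_trans (Re_le_normc _))//.
  by rewrite (le_trans (fg x))// ler_norm.
- apply: le_integrable ig => //; first exact/measurable_EFinP.
  move=> x _ /=; rewrite lee_fin (le_trans (Im_le_normc _))//.
  by rewrite (le_trans (fg x))// ler_norm.
Qed.

Lemma cintegrable_normc f : cintegrable mu f ->
  mu.-integrable setT (fun x => (normc (f x))%:E).
Proof.
move=> intf; have mf := cintegrable_cmeasurable intf.
case: intf => rf If.
apply: (le_integrable _ _ _ (integrableD measurableT (integrable_norm rf) (integrable_norm If))) => //.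
  exact/measurable_EFinP/measurable_normc.
move=> x _ /=; rewrite lee_fin (ger0_norm (normc_ge0 _)) (le_trans (normc_le_ReIm _))//.
exact: ler_norm.
Qed.

Lemma ge0_integrable (g : T -> R) : measurable_fun setT g ->
  (forall x, 0 <= g x) -> (\int[mu]_x (g x)%:E < +oo)%E ->
  mu.-integrable setT (EFin \o g).
Proof.
move=> mg g0 ig; apply/integrableP; split; first exact/measurable_EFinP.
by under eq_integral do rewrite /= ger0_norm//.
Qed.

Lemma ge0_le_integrable (f g : T -> R) : measurable_fun setT f ->
  (forall x, 0 <= f x) -> (forall x, f x <= g x) -> mu.-integrable setT (EFin \o g) ->
  mu.-integrable setT (EFin \o f).
Proof.
move=> mf f0 fg; apply: le_integrable => //; first exact/measurable_EFinP.
by move=> x _ /=; rewrite lee_fin ger0_norm// (le_trans (fg x))// ler_norm.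
Qed.

Lemma normc_cintegrable f : cmeasurable f ->
  (\int[mu]_x (normc (f x))%:E < +oo)%E -> cintegrable mu f.
Proof.
move=> mf ?; apply: (le_cintegrable mf (fun=> lexx _)).
apply: ge0_integrable => //; first exact: measurable_normc.
by move=> x; exact: normc_ge0.
Qed.

Lemma cintegrableD f g : cintegrable mu f -> cintegrable mu g ->
  cintegrable mu (fun x => f x + g x).
Proof.
move=> /[dup]/cintegrable_cmeasurable mf /cintegrable_normc nf.
move=> /[dup]/cintegrable_cmeasurable mg /cintegrable_normc ng.
apply: (le_cintegrable (cmeasurableD mf mg) (fun x => le_normcD _ _)).
exact: (integrableD measurableT nf ng).
Qed.

Lemma cintegrableZl (c : R[i]) f : cintegrable mu f ->
  cintegrable mu (fun x => c * f x).
Proof.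
move=> /[dup]/cintegrable_cmeasurable mf /cintegrable_normc nf.
apply: (@le_cintegrable _ (fun x => normc c * normc (f x))).
- by apply: cmeasurableM => //; exact: cmeasurable_cst.
- by move=> x; rewrite ComplexField.Normc.normcM.
- exact: (integrableZl measurableT (normc c) nf).
Qed.

Lemma cintegrableN f : cintegrable mu f -> cintegrable mu (fun x => - f x).
Proof.
move=> /(cintegrableZl (-1)); congr (cintegrable mu _).
by apply/funext => x; rewrite mulN1r.
Qed.

Lemma cintegrableB f g : cintegrable mu f -> cintegrable mu g ->
  cintegrable mu (fun x => f x - g x).
Proof. by move=> intf /cintegrableN; exact: cintegrableD. Qed.

Lemma eq_cintegral f g : f =1 g -> cintegral mu f = cintegral mu g.
Proof. by move=> /funext ->. Qed.

Lemma eq_cintegrable f g : f =1 g -> cintegrable mu f -> cintegrable mu g.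
Proof. by move=> /funext ->. Qed.

Lemma cintegralD f g : cintegrable mu f -> cintegrable mu g ->
  cintegral mu (fun x => f x + g x) = cintegral mu f + cintegral mu g.
Proof.
move=> [rf If] [rg Ig]; rewrite /cintegral.
under eq_Rintegral do rewrite ReD.
rewrite RintegralD//.
under [in X in _ +i* X]eq_Rintegral do rewrite ImD.
by rewrite RintegralD.
Qed.

Lemma cintegralZl (c : R[i]) f : cintegrable mu f ->
  cintegral mu (fun x => c * f x) = c * cintegral mu f.
Proof.
move=> [rf If]; rewrite /cintegral; apply: complex_eq; rewrite ?ReM ?ImM /=.
- under eq_Rintegral do rewrite ReM.
  rewrite RintegralB ?RintegralZl//.
  - exact: (integrableZl measurableT _ rf).
  - exact: (integrableZl measurableT _ If).
- under eq_Rintegral do rewrite ImM.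
  rewrite RintegralD ?RintegralZl//.
  - exact: (integrableZl measurableT _ If).
  - exact: (integrableZl measurableT _ rf).
Qed.

Lemma cintegralN f : cintegrable mu f ->
  cintegral mu (fun x => - f x) = - cintegral mu f.
Proof.
move=> intf; rewrite -[RHS]mulN1r -cintegralZl//.
by apply: eq_cintegral => x; rewrite mulN1r.
Qed.

Lemma cintegralB f g : cintegrable mu f -> cintegrable mu g ->
  cintegral mu (fun x => f x - g x) = cintegral mu f - cintegral mu g.
Proof.
by move=> intf intg; rewrite -cintegralN// -cintegralD//; exact: cintegrableN.
Qed.

Lemma cintegrableJ f : cintegrable mu f -> cintegrable mu (fun x => (f x)^*).
Proof.
move=> /[dup]/cintegrable_cmeasurable mf /cintegrable_normc nf.
apply: (@le_cintegrable _ (fun x => normc (f x))) => //.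
- exact: cmeasurableJ.
- by move=> x; rewrite normc_conj.
Qed.

Lemma cintegralJ f : cintegrable mu f ->
  cintegral mu (fun x => (f x)^*) = (cintegral mu f)^*.
Proof.
move=> [_ If]; rewrite /cintegral; apply: complex_eq; rewrite ?ReJ ?ImJ /=.
- by under eq_Rintegral do rewrite ReJ.
- under eq_Rintegral do rewrite ImJ -mulN1r.
  by rewrite RintegralZl// mulN1r.
Qed.

Lemma cintegral_real (g : T -> R) :
  cintegral mu (fun x => (g x)%:C) = (Rintegral mu setT g)%:C.
Proof.
rewrite /cintegral; apply: complex_eq; rewrite ?Re_real ?Im_real//=.
by rewrite /Rintegral integral0.
Qed.

(** Multiplying by the conjugate of the integral [I] turns [|I|^2] into the integral of a real part,
    which is at most [|I|] times the integral of [|f|]. *)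
Lemma le_normc_cintegral f : cintegrable mu f ->
  normc (cintegral mu f) <= Rintegral mu setT (fun x => normc (f x)).
Proof.
move=> intf; have nf := cintegrable_normc intf.
have J0 : 0 <= Rintegral mu setT (fun x => normc (f x)).
  by apply: Rintegral_ge0 => x _; exact: normc_ge0.
set I := cintegral mu f.
have [->//|I0] := eqVneq I 0; first by rewrite ComplexField.Normc.normc0.
have nI : 0 < normc I by rewrite lt0r normc_eq0 I0 normc_ge0.
rewrite -(ler_pM2l nI) -expr2.
have -> : normc I ^+ 2 = Rintegral mu setT (fun x => complex.Re (I^* * f x)).
  rewrite -[LHS]Re_real -mulcJ_normc mulrC -[I in LHS]/(cintegral mu f).
  by rewrite -cintegralZl.
rewrite -RintegralZl//; apply: le_Rintegral => //.
- exact: (cintegrableZl I^* intf).1.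
- exact: (integrableZl measurableT (normc I) nf).
- move=> x _; rewrite (le_trans (ler_norm _))// (le_trans (Re_le_normc _))//.
  by rewrite ComplexField.Normc.normcM normc_conj.
Qed.

Lemma normc_cintegral_le f (g : T -> R) : cmeasurable f ->
  (forall x, normc (f x) <= g x) -> mu.-integrable setT (EFin \o g) ->
  normc (cintegral mu f) <= Rintegral mu setT g.
Proof.
move=> mf fg ig; have intf := le_cintegrable mf fg ig.
rewrite (le_trans (le_normc_cintegral intf))//; apply: le_Rintegral => //.
exact: cintegrable_normc.
Qed.

Lemma cvg_cintegral (f_ : (T -> R[i])^nat) f (G : T -> R) :
  (forall n, cmeasurable (f_ n)) -> cmeasurable f ->
  (forall x, normc (f_ n x - f x) @[n --> \oo] --> (0 : R)) ->
  mu.-integrable setT (EFin \o G) ->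
  (forall n x, normc (f_ n x) <= G x) -> (forall x, normc (f x) <= G x) ->
  normc (cintegral mu (f_ n) - cintegral mu f) @[n --> \oo] --> (0 : R).
Proof.
move=> mf_ mf cvf iG fG fG'.
have if_ n := le_cintegrable (mf_ n) (fG n) iG.
have if' := le_cintegrable mf fG' iG.
pose D n x := normc (f_ n x - f x).
have mD n : measurable_fun setT (D n) by apply/measurable_normc/cmeasurableB.
have cvD : {ae mu, forall x, setT x ->
    (fun n => (D n x)%:E) @ \oo --> (0%E : \bar R)}.
  by apply: aeW => x _; apply: cvg_EFin; [exact: nearW|exact: cvf].
have domD : {ae mu, forall x n, setT x -> (`|(D n x)%:E| <= (2 * G x)%:E)%E}.
  apply: aeW => x n _; rewrite /D /= ger0_norm ?normc_ge0// lee_fin.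
  rewrite (le_trans (le_normcD _ _))// normcN mulrDl mul1r.
  by rewrite lerD// ?fG ?fG'.
have [_ _] := dominated_convergence measurableT
  (fun n => (measurable_EFinP _ _).2 (mD n)) (measurable_cst _) cvD
  (integrableZl measurableT 2 iG) domD.
rewrite integral0 => /fine_cvgP[_ DI].
apply: (@squeeze_cvgr _ _ _ _ (fun=> 0) (fun n => Rintegral mu setT (D n))).
- apply: nearW => n; rewrite normc_ge0/=. rewrite -(cintegralB (if_ n) if').
  by apply: le_normc_cintegral; exact: cintegrableB.
- exact: cvg_cst.
- exact: DI.
Qed.

End ComplexIntegrals.

Section ComplexFubini.
Context (d1 d2 : measure_display) (T1 : measurableType d1)
  (T2 : measurableType d2) (R : realType).
Variables (m1 : {sigma_finite_measure set T1 -> \bar R})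
  (m2 : {sigma_finite_measure set T2 -> \bar R}).

(** [fine] can change the inner integral only at those [x] whose section fails to be integrable.
    These form a null set, so the outer integrands agree almost everywhere. *)
Lemma Rintegral_prod1 (f : T1 * T2 -> R) :
  (m1 \x m2)%E.-integrable setT (EFin \o f) ->
  Rintegral m1 setT (fun x => Rintegral m2 setT (fun y => f (x, y))) =
  Rintegral (m1 \x m2)%E setT f.
Proof.
move=> intf; rewrite [RHS]/Rintegral -(integral12_prod_meas1 intf).
congr fine; apply: ae_eq_integral => //.
- apply/measurable_EFinP/measurable_funTS.
  apply: measurableT_comp => //; exact: (measurable_fubini_F intf).
- exact: (measurable_fubini_F intf).
have := ae_integrable1 intf; apply: filterS => x ix _.
by rewrite /fubini_F /Rintegral fineK//; exact: integrable_fin_num.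
Qed.

Lemma Rintegral_prod2 (f : T1 * T2 -> R) :
  (m1 \x m2)%E.-integrable setT (EFin \o f) ->
  Rintegral m2 setT (fun y => Rintegral m1 setT (fun x => f (x, y))) =
  Rintegral (m1 \x m2)%E setT f.
Proof.
move=> intf; rewrite [RHS]/Rintegral -(integral21_prod_meas1 intf).
congr fine; apply: ae_eq_integral => //.
- apply/measurable_EFinP/measurable_funTS.
  apply: measurableT_comp => //; exact: (measurable_fubini_G intf).
- exact: (measurable_fubini_G intf).
have := ae_integrable2 intf; apply: filterS => x ix _.
by rewrite /fubini_G /Rintegral fineK//; exact: integrable_fin_num.
Qed.

Lemma cintegral_prod1 (f : T1 * T2 -> R[i]) : cintegrable (m1 \x m2)%E f ->
  cintegral m1 (fun x => cintegral m2 (fun y => f (x, y))) =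
  cintegral (m1 \x m2)%E f.
Proof.
by move=> [rf If]; rewrite /cintegral/= (Rintegral_prod1 rf) (Rintegral_prod1 If).
Qed.

Lemma cintegral_prod2 (f : T1 * T2 -> R[i]) : cintegrable (m1 \x m2)%E f ->
  cintegral m2 (fun y => cintegral m1 (fun x => f (x, y))) =
  cintegral (m1 \x m2)%E f.
Proof.
by move=> [rf If]; rewrite /cintegral/= (Rintegral_prod2 rf) (Rintegral_prod2 If).
Qed.

Lemma cintegral_swap (f : T1 * T2 -> R[i]) : cintegrable (m1 \x m2)%E f ->
  cintegral m1 (fun x => cintegral m2 (fun y => f (x, y))) =
  cintegral m2 (fun y => cintegral m1 (fun x => f (x, y))).
Proof. by move=> intf; rewrite cintegral_prod1// cintegral_prod2. Qed.

Lemma cintegrable_fubini1 (f : T1 * T2 -> R[i]) :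
  cintegrable (m1 \x m2)%E f -> (forall x, cintegrable m2 (fun y => f (x, y))) ->
  cintegrable m1 (fun x => cintegral m2 (fun y => f (x, y))).
Proof.
move=> [rf If] ix; split.
- apply: eq_integrable (integrable_fubini_F rf) => // x _.
  by rewrite /fubini_F /= /Rintegral fineK//; apply: integrable_fin_num (ix x).1.
- apply: eq_integrable (integrable_fubini_F If) => // x _.
  by rewrite /fubini_F /= /Rintegral fineK//; apply: integrable_fin_num (ix x).2.
Qed.

Lemma cmeasurable_fubini2 (f : T1 * T2 -> R[i]) :
  cintegrable (m1 \x m2)%E f ->
  cmeasurable (fun y => cintegral m1 (fun x => f (x, y))).
Proof.
move=> [rf If]; split.
- by apply: measurableT_comp => //; exact: (measurable_fubini_G rf).
- by apply: measurableT_comp => //; exact: (measurable_fubini_G If).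
Qed.

Lemma cmeasurable_fubini1 (f : T1 * T2 -> R[i]) :
  cintegrable (m1 \x m2)%E f ->
  cmeasurable (fun x => cintegral m2 (fun y => f (x, y))).
Proof.
move=> [rf If]; split.
- by apply: measurableT_comp => //; exact: (measurable_fubini_F rf).
- by apply: measurableT_comp => //; exact: (measurable_fubini_F If).
Qed.

End ComplexFubini.

(** * Affine changes of variable on the line *)

Section AffineChange.
Context (R : realType).
Local Notation leb := (@lebesgue_measure R).
Variables (a b : R) (a_neq0 : a != 0).

Let phi (x : R) : R := a * x + b.

Let measurable_phi : measurable_fun setT (phi : measurableTypeR R -> measurableTypeR R).
Proof. by apply: measurable_funD => //; apply: measurable_funM. Qed.

Let pm : {measure set (measurableTypeR R) -> \bar R}.
Proof.
refine (pushforward leb (phi : measurableTypeR R -> measurableTypeR R)).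
exact: measurable_phi.
Defined.

(** As functions of [A] both sides are measures, the right one a scaled pushforward, so uniqueness
    of Lebesgue measure reduces the claim to intervals []u, v]]. For [a < 0] the preimage of such an
    interval is closed on the left and open on the right. *)
Lemma lebesgue_measure_affine (A : set R) : measurable A ->
  leb A = (`|a|%:E * leb (phi @^-1` A))%E.
Proof.
move=> mA; have a0 : 0 <= `|a| by [].
rewrite -[RHS]/(mscale (NngNum a0) pm A).
apply: lebesgue_measure_unique => // _ [[u v] _ <-] /=.
rewrite /mscale /= -[pushforward _ _ _]/(leb (phi @^-1` `]u, v]%classic)).
have [ap|an|/eqP] := ltgtP 0 a; last by rewrite eq_sym (negbTE a_neq0).
- rewrite (_ : phi @^-1` _ = `](u - b) / a, (v - b) / a]%classic); last first.
    apply/seteqP; split => x /=; rewrite !in_itv/= /phi.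
      move=> /andP[h1 h2]; rewrite ltr_pdivrMr// ler_pdivlMr//.
      by rewrite ltrBlDr lerBrDr mulrC h1.
    move=> /andP[]; rewrite ltr_pdivrMr// ler_pdivlMr//.
    by rewrite ltrBlDr lerBrDr mulrC => -> ->.
  rewrite !lebesgue_measure_itv/= !lte_fin ltr_pM2r ?invr_gt0// ltrD2r.
  case: ifP => _; last by rewrite mule0.
  rewrite -!EFinB -EFinM gtr0_norm//; congr (_%:E); field.
  by rewrite gt_eqF.
- rewrite (_ : phi @^-1` _ = `[(v - b) / a, (u - b) / a[%classic); last first.
    apply/seteqP; split => x /=; rewrite !in_itv/= /phi.
      move=> /andP[h1 h2]; rewrite ltr_ndivlMr// ler_ndivrMr//.
      by rewrite ltrBlDr lerBrDr mulrC h2 h1.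
    move=> /andP[]; rewrite ltr_ndivlMr// ler_ndivrMr//.
    by rewrite ltrBlDr lerBrDr mulrC => -> ->.
  rewrite !lebesgue_measure_itv/= !lte_fin ltr_nM2r ?invr_lt0// ltrD2r.
  case: ifP => _; last by rewrite mule0.
  rewrite -!EFinB -EFinM ltr0_norm//; congr (_%:E); field.
  by rewrite lt_eqF.
Qed.

Lemma ge0_integral_affine (f : R -> \bar R) : measurable_fun setT f ->
  (forall x, (0 <= f x)%E) ->
  (\int[leb]_x f x = `|a|%:E * \int[leb]_x f (a * x + b)%R)%E.
Proof.
move=> mf f0; have a0 : 0 <= `|a| by [].
rewrite (@eq_measure_integral _ _ _ _ (mscale (NngNum a0) pm)); last first.
  by move=> A mA _; exact: lebesgue_measure_affine.
rewrite ge0_integral_mscale//; congr (_ * _)%E.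
exact: (ge0_integral_pushforward measurable_phi).
Qed.

Lemma measurable_affine (f : R -> R) : measurable_fun setT f ->
  measurable_fun setT (fun x => f (a * x + b)).
Proof. by move=> mf; exact: (measurableT_comp mf measurable_phi). Qed.

Lemma cmeasurable_affine (f : R -> R[i]) : cmeasurable f ->
  cmeasurable (fun x => f (a * x + b)).
Proof. by move=> mf; exact: (cmeasurable_comp mf measurable_phi). Qed.

Lemma ge0_integral_affineV (f : R -> \bar R) : measurable_fun setT f ->
  (forall x, (0 <= f x)%E) ->
  (\int[leb]_x f (a * x + b)%R = `|a|^-1%:E * \int[leb]_x f x)%E.
Proof.
move=> mf f0; rewrite [in RHS]ge0_integral_affine// muleA -EFinM mulVf ?mul1e//.
by rewrite normr_eq0.
Qed.

Lemma integral_affine_lty (f : R -> \bar R) : measurable_fun setT f ->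
  (forall x, (0 <= f x)%E) -> (\int[leb]_x f x < +oo)%E ->
  (\int[leb]_x f (a * x + b)%R < +oo)%E.
Proof.
by move=> mf f0 foo; rewrite ge0_integral_affineV// lte_mul_pinfty// lee_fin invr_ge0.
Qed.

Lemma integrable_affine (f : R -> R) : leb.-integrable setT (EFin \o f) ->
  leb.-integrable setT (EFin \o (fun x => f (a * x + b))).
Proof.
move=> /integrableP[/measurable_EFinP mf foo].
apply/integrableP; split.
  apply/measurable_EFinP.  exact: measurable_affine.
apply: (integral_affine_lty (f := fun x => `|(f x)%:E|%E)) foo => //.
exact/measurable_EFinP/measurableT_comp.
Qed.

Lemma Rintegral_affine (f : R -> R) : leb.-integrable setT (EFin \o f) ->
  Rintegral leb setT f = `|a| * Rintegral leb setT (fun x => f (a * x + b)).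
Proof.
move=> intf; have mf := measurable_int _ intf.
rewrite /Rintegral -[fun x => (f (a * x + b))%:E]/((EFin \o f) \o phi).
rewrite [in LHS]integralE [in RHS]integralE.
rewrite (funepos_comp (EFin \o f) phi) (funeneg_comp (EFin \o f) phi).
rewrite (ge0_integral_affine (measurable_funepos mf))//.
rewrite (ge0_integral_affine (measurable_funeneg mf))//.
have intg := integrable_affine intf.
have pfin := integrable_pos_fin_num measurableT intg.
have nfin := integrable_neg_fin_num measurableT intg.
have key (c : R) (P N : \bar R) : P \is a fin_num -> N \is a fin_num ->
    fine (c%:E * P - c%:E * N)%E = c * fine (P - N)%E.
  by move: P N => [p| |] [n| |]//= _ _; rewrite mulrBr.
move: pfin nfin; rewrite -[EFin \o _]/((EFin \o f) \o phi).
rewrite (funepos_comp (EFin \o f) phi) (funeneg_comp (EFin \o f) phi).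
exact: key.
Qed.

Lemma cintegrable_affine (f : R -> R[i]) : cintegrable leb f ->
  cintegrable leb (fun x => f (a * x + b)).
Proof.
move=> [rf If]; split.
- exact: (integrable_affine (f := fun x => complex.Re (f x)) rf).
- exact: (integrable_affine (f := fun x => complex.Im (f x)) If).
Qed.

Lemma cintegral_affine (f : R -> R[i]) : cintegrable leb f ->
  cintegral leb f = `|a|%:C * cintegral leb (fun x => f (a * x + b)).
Proof.
move=> [rf If]; rewrite /cintegral (Rintegral_affine rf) (Rintegral_affine If).
by apply: complex_eq; rewrite ?ReM ?ImM/= mul0r ?subr0 ?addr0.
Qed.

End AffineChange.

(** * Real Gaussian integrals *)

Section Gaussian.
Context (R : realType).
Local Notation leb := (@lebesgue_measure R).

Lemma measurable_gauss (a m : R) :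
  measurable_fun setT (fun x : R => expR (- (a * (x - m) ^+ 2))).
Proof.
apply: measurableT_comp => //; apply: measurableT_comp => //.
by apply: measurable_funM => //; apply: measurable_funX; apply: measurable_funB.
Qed.

Lemma integral_gauss (a m : R) : 0 < a ->
  (\int[leb]_x (expR (- (a * (x - m) ^+ 2)))%:E = (Num.sqrt (pi / a))%:E)%E.
Proof.
move=> a0; have sa0 : 0 < Num.sqrt a by rewrite sqrtr_gt0.
have := @integralT_gauss R.
rewrite (@ge0_integral_affine _ (Num.sqrt a) (- Num.sqrt a * m)); first last.
- by move=> x; rewrite lee_fin gauss_fun_ge0.
- by apply/measurable_EFinP; exact: measurable_gauss_fun.
- by rewrite gt_eqF.
have E x : gauss_fun (Num.sqrt a * x + - Num.sqrt a * m) =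
    expR (- (a * (x - m) ^+ 2)).
  have aE := sqr_sqrtr (ltW a0).
  by rewrite /gauss_fun -[in RHS]aE; congr expR; ring.
under eq_integral do rewrite E.
rewrite gtr0_norm// => H.
have -> : Num.sqrt (pi / a) = (Num.sqrt a)^-1 * Num.sqrt pi.
  by rewrite sqrtrM ?pi_ge0// sqrtrV ?ltW// mulrC.
rewrite EFinM -H muleA -EFinM mulVf ?mul1e//.
by rewrite gt_eqF.
Qed.

Lemma integrable_gauss (a m : R) : 0 < a ->
  leb.-integrable setT (EFin \o (fun x : R => expR (- (a * (x - m) ^+ 2)))).
Proof.
move=> a0; apply: ge0_integrable.
- exact: measurable_gauss.
- by move=> x; exact: expR_ge0.
- by rewrite integral_gauss// ltry.
Qed.

End Gaussian.

(** * Green's formula for differentiable functions *)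

Section Bisection.
Context (R : realType).
Implicit Types (nu : R -> R -> R -> R) (a b r p q : R).

Lemma exists_half_pow (x e : R) : 0 < e -> exists n, x / 2 ^+ n < e.
Proof.
move=> e0; exists (Num.bound `|x / e|).
rewrite ltr_pdivrMr ?exprn_gt0// mulrC -ltr_pdivrMr//.
have := archi_boundP (normr_ge0 (x / e)); move=> h; rewrite (le_lt_trans (ler_norm _))// (lt_trans h)//.
by rewrite -natrX ltr_nat ltn_expl.
Qed.

(** [nu a b r] is read as a charge carried by the square with lower left corner [(a, b)] and side
    [r]. *)
Definition square_additive nu := forall a b r, 0 < r ->
  nu a b r = nu a b (r / 2) + nu (a + r / 2) b (r / 2)
           + nu a (b + r / 2) (r / 2) + nu (a + r / 2) (b + r / 2) (r / 2).

(** The charge has density zero at [(p, q)]: it is [o(r^2)] on squares that contain the point, in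
    whatever position. *)
Definition negligible_at nu p q := forall e : R, 0 < e ->
  exists2 delta, 0 < delta & forall a b r, 0 < r -> r < delta ->
    a <= p <= a + r -> b <= q <= b + r -> `|nu a b r| <= e * r ^+ 2.

(** Goursat's argument: a square of nonzero charge has a quarter whose charge is at least as large
    relative to its area. Repeated quartering closes in on a point, where the density would not be
    zero. *)
Lemma bisection_null nu a0 b0 r0 : square_additive nu -> 0 < r0 ->
  (forall p q, a0 <= p <= a0 + r0 -> b0 <= q <= b0 + r0 -> negligible_at nu p q) ->
  nu a0 b0 r0 = 0.
Proof.
move=> addnu r00 locnu; apply/eqP; apply: contraT => nu0.
(* Half of the mean density of the initial square, so that [P] holds strictly at the start. *)
pose e := `|nu a0 b0 r0| / r0 ^+ 2 / 2.
have e0 : 0 < e by rewrite !divr_gt0 ?normr_gt0 ?exprn_gt0.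
pose P (s : R * R) r := `|nu s.1 s.2 r| > e * r ^+ 2.
pose step (s : R * R) r :=
  if P s (r / 2) then s else
  if P (s.1 + r / 2, s.2) (r / 2) then (s.1 + r / 2, s.2) else
  if P (s.1, s.2 + r / 2) (r / 2) then (s.1, s.2 + r / 2) else
  (s.1 + r / 2, s.2 + r / 2).
(* The fourth quarter is the default choice of [step]: if it failed [P] along with the other three,
   adding the four bounds would contradict [P s r]. *)
have stepP s r : 0 < r -> P s r -> P (step s r) (r / 2).
  move=> rp Ps; rewrite /step.
  case: ifPn => // n1; case: ifPn => // n2; case: ifPn => // n3.
  rewrite /P ltNge; apply/negP => n4; move: Ps n1 n2 n3.
  rewrite /P (addnu _ _ _ rp) /= -!leNgt => Ps n1 n2 n3.
  move: Ps; apply/negP; rewrite -leNgt.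
  have -> : e * r ^+ 2 = e * (r / 2) ^+ 2 + e * (r / 2) ^+ 2 + e * (r / 2) ^+ 2
    + e * (r / 2) ^+ 2 by field.
  by do 3 (apply: (le_trans (ler_normD _ _)); apply: lerD => //).
have step1 s r : 0 < r -> s.1 <= (step s r).1 /\ (step s r).1 + r / 2 <= s.1 + r.
  by move=> rp; rewrite /step; do ?[case: ifP => _]; split => /=; lra.
have step2 s r : 0 < r -> s.2 <= (step s r).2 /\ (step s r).2 + r / 2 <= s.2 + r.
  by move=> rp; rewrite /step; do ?[case: ifP => _]; split => /=; lra.
pose rr n := r0 / 2 ^+ n.
have rr0 n : 0 < rr n by rewrite divr_gt0// exprn_gt0.
have rrS n : rr n.+1 = rr n / 2 by rewrite /rr exprS invfM mulrA mulrAC.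
pose u := fix u n := if n is m.+1 then step (u m) (rr m) else (a0, b0).
have Pu n : P (u n) (rr n).
  elim: n => [|n IH]; last by rewrite rrS; apply: stepP.
  rewrite /P /rr expr0 divr1/= /e mulrAC divfK; last by rewrite expf_neq0// gt_eqF.
  by rewrite ltr_pdivrMr// ltr_pMr ?normr_gt0// ltr1n.
(* Nested intervals, stated for a coordinate [c] that is then taken to be [fst] and [snd]; the
   common point is the supremum of the left ends. *)
have nest (c : R * R -> R) : (forall s r, 0 < r ->
    c s <= c (step s r) /\ c (step s r) + r / 2 <= c s + r) ->
    exists p, forall n, c (u n) <= p <= c (u n) + rr n.
  move=> cstep.
  have mono n k : c (u n) <= c (u (n + k)%N) /\
      c (u (n + k)%N) + rr (n + k)%N <= c (u n) + rr n.
    elim: k => [|k [IH1 IH2]]; first by rewrite addn0.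
    rewrite addnS rrS /=; have [h1 h2] := cstep (u (n + k)%N) (rr (n + k)%N) (rr0 _).
    by split; [exact: le_trans h1|exact: le_trans IH2].
  have le_ub m n : c (u m) <= c (u n) + rr n.
    have [mn|nm] := leqP m n.
      have [h _] := mono m (n - m)%N; rewrite subnKC// in h.
      by rewrite (le_trans h)// lerDl ltW.
    have [_ h] := mono n (m - n)%N; rewrite subnKC 1?ltnW// in h.
    by rewrite (le_trans _ h)// lerDl ltW.
  pose A := [set c (u n) | n in [set: nat]].
  have ubA n : ubound A (c (u n) + rr n) by move=> _ [m _ <-].
  exists (sup A) => n; apply/andP; split.
    by apply: ub_le_sup; [exists (c (u 0%N) + rr 0%N)|exists n].
  by apply: ge_sup; [exists (c (u 0%N)); exists 0%N|].
have [p pP] := nest fst step1; have [q qP] := nest snd step2.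
have r0E : rr 0%N = r0 by rewrite /rr expr0 divr1.
have := pP 0%N; have := qP 0%N; rewrite r0E /= => q0 p0.
have [d d0 locd] := locnu p q p0 q0 e e0.
have [n nd] := exists_half_pow r0 d0.
have := locd _ _ _ (rr0 n) nd (pP n) (qP n).
by rewrite leNgt; move: (Pu n); rewrite /P => ->.
Qed.

(* Bisecting towards the origin, only the corner square can contribute. *)
Lemma bisection_corner nu (C r0 r1 s t : R) :
  square_additive nu -> 0 < r0 -> 0 < r1 ->
  (s == 0) || (s == 1) -> (t == 0) || (t == 1) ->
  (forall p q, (p, q) != (0, 0) -> negligible_at nu p q) ->
  (forall a b r, 0 < r -> r <= r1 -> a <= 0 <= a + r -> b <= 0 <= b + r ->
     `|nu a b r| <= C * r) ->
  nu (- s * r0) (- t * r0) r0 = 0.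
Proof.
move=> addnu r00 r10 s01 t01 locnu Cnu.
(* [s] and [t] tell which corner of the square is the origin. The three other quarters miss the
   origin, so [bisection_null] makes their charges vanish. *)
have half r : 0 < r -> nu (- s * r) (- t * r) r = nu (- s * (r / 2)) (- t * (r / 2)) (r / 2).
  move=> rp; rewrite addnu//.
  have z a b : 0 < a \/ a + r / 2 < 0 \/ 0 < b \/ b + r / 2 < 0 -> nu a b (r / 2) = 0.
    move=> H; apply: bisection_null => //; first by rewrite divr_gt0.
    move=> p q /andP[p1 p2] /andP[q1 q2]; apply: locnu; apply/eqP => -[p0 q0].
    by move: H; rewrite p0 in p1 p2; rewrite q0 in q1 q2; lra.
  case/orP: s01 => /eqP ->; case/orP: t01 => /eqP ->.
  - rewrite !(oppr0, mul0r, add0r) (z (r / 2) 0) ?(z 0 (r / 2)) ?(z (r / 2) (r / 2)); lra.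
  - rewrite !(oppr0, mul0r, add0r) !mulN1r.
    have -> : - r + r / 2 = - (r / 2) by field.
    rewrite (z 0 (- r)) ?(z (r / 2) (- r)) ?(z (r / 2)); lra.
  - rewrite !(oppr0, mul0r, add0r) !mulN1r.
    have -> : - r + r / 2 = - (r / 2) by field.
    rewrite (z (- r) 0) ?(z (- r)) ?(z _ (r / 2)); lra.
  - rewrite !mulN1r.
    have -> : - r + r / 2 = - (r / 2) by field.
    rewrite (z (- r) (- r)) ?(z (- r)) ?(z _ (- r)); lra.
apply/eqP; rewrite -normr_eq0 eq_le normr_ge0 andbT leNgt; apply/negP => nu0.
(* [C] carries no sign, so the nonnegative constant [|C| + 1] takes its place; being at least 1, it
   also makes the final square smaller than [r1]. *)
have C0 : 0 <= `|C| + 1 by rewrite addr_ge0.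
have m0 : 0 < Num.min `|nu (- s * r0) (- t * r0) r0| r1 by rewrite lt_min nu0.
have [n] := exists_half_pow ((`|C| + 1) * r0) m0.
rewrite lt_min => /andP[+ r1n]; apply/negP; rewrite -leNgt.
pose rr n := r0 / 2 ^+ n.
have rr0 k : 0 < rr k by rewrite divr_gt0// exprn_gt0.
have rrS k : rr k.+1 = rr k / 2 by rewrite /rr exprS invfM mulrA mulrAC.
have -> : nu (- s * r0) (- t * r0) r0 = nu (- s * rr n) (- t * rr n) (rr n).
  elim: n {r1n} => [|n ->]; first by rewrite /rr expr0 divr1.
  by rewrite half// rrS.
have rp := rr0 n.
apply: (le_trans (Cnu _ _ _ rp _ _ _)).
- rewrite (le_trans _ (ltW r1n))// -mulrA -/(rr n) ler_peMl ?(ltW rp)//.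
  by rewrite lerDr.
- by case/orP: s01 => /eqP ->; lra.
- by case/orP: t01 => /eqP ->; lra.
- rewrite -mulrA -/(rr n) ler_wpM2r ?(ltW rp)//.
  by rewrite (le_trans (ler_norm _))// lerDl.
Qed.

End Bisection.

Section Divergence.
Context (R : realType).
Local Notation leb := (@lebesgue_measure R).
Local Notation area := (leb \x leb)%E.

(** Half open, so that the two halves of a segment are disjoint and cover it exactly. *)
Definition seg (a r : R) : set R := `]a, a + r]%classic.

Lemma measurable_seg a r : measurable (seg a r : set (measurableTypeR R)).
Proof. exact: measurable_itv. Qed.

Lemma lebesgue_seg a r : 0 < r -> leb (seg a r) = r%:E.
Proof.
move=> r0; rewrite /seg lebesgue_measure_itv/= lte_fin ltrDl r0 -EFinB.
by rewrite addrC addKr.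
Qed.

Lemma area_seg a b r : 0 < r -> area (seg a r `*` seg b r) = (r ^+ 2)%:E.
Proof.
move=> r0; rewrite product_measure1E; try exact: measurable_seg.
transitivity (r%:E * r%:E)%E; last by rewrite -EFinM expr2.
by congr (_ * _)%E; exact: lebesgue_seg.
Qed.

Lemma seg_halves a r : 0 < r -> seg a r = seg a (r / 2) `|` seg (a + r / 2) (r / 2).
Proof.
move=> r0; apply/seteqP; split => x; rewrite /seg /= !in_itv/=.
  by move=> /andP[h1 h2]; have [h|h] := leP x (a + r / 2); [left|right]; lra.
by case=> /andP[h1 h2]; lra.
Qed.

Lemma setXUl (T1 T2 : Type) (A B : set T1) (C : set T2) :
  (A `|` B) `*` C = (A `*` C) `|` (B `*` C).
Proof. by apply/seteqP; split => -[x y] /=; rewrite /setX/=; tauto. Qed.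

Lemma setXUr (T1 T2 : Type) (A : set T1) (B C : set T2) :
  A `*` (B `|` C) = (A `*` B) `|` (A `*` C).
Proof. by apply/seteqP; split => -[x y] /=; rewrite /setX/=; tauto. Qed.

Lemma seg_disjoint a r : [disjoint seg a (r / 2) & seg (a + r / 2) (r / 2)].
Proof.
apply/disj_set2P/seteqP; split => // x []; rewrite /seg /= !in_itv/=.
by move=> /andP[h1 h2] /andP[h3 h4]; lra.
Qed.

Lemma Rintegral_cst_measure (d : measure_display) (T : measurableType d)
    (mu : {measure set T -> \bar R}) (A : set T) (c m : R) :
  measurable A -> mu A = m%:E ->
  mu.-integrable A (EFin \o (fun=> c)) /\ Rintegral mu A (fun=> c) = c * m.
Proof.
move=> mA muA; split; last by rewrite Rintegral_cst// muA.
apply/integrableP; split; first by apply/measurable_EFinP; exact: measurable_cst.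
by rewrite /= integral_cst//= muA -EFinM ltry.
Qed.

Lemma Rintegral_bound (d : measure_display) (T : measurableType d)
    (mu : {measure set T -> \bar R}) (A : set T) (f : T -> R) (c m : R) :
  measurable A -> mu A = m%:E -> mu.-integrable A (EFin \o f) ->
  (forall x, A x -> `|f x| <= c) -> `|Rintegral mu A f| <= c * m.
Proof.
move=> mA muA intf fc; rewrite (le_trans (le_normr_Rintegral mA intf))//.
have -> : m = fine (mu A) by rewrite muA.
rewrite -(Rintegral_cst mu mA); apply: le_Rintegral => //.
- exact: integrable_norm.
- exact: (Rintegral_cst_measure c mA muA).1.
Qed.

Variables (P Q : R -> R -> R) (D : R * R -> R).
Hypothesis iP : forall x b r, leb.-integrable (seg b r) (EFin \o P x).
Hypothesis iQ : forall y a r, leb.-integrable (seg a r) (EFin \o Q^~ y).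
Hypothesis iD : area.-integrable setT (EFin \o D).

(** Outward flux of the field [(P, Q)] through the boundary of a square, minus the integral of [D]
    over it. With [D] the divergence of the field, Green's formula says that this is zero. *)
Definition flux (a b r : R) : R :=
  (Rintegral leb (seg b r) (P (a + r)) - Rintegral leb (seg b r) (P a))
  + (Rintegral leb (seg a r) (Q^~ (b + r)) - Rintegral leb (seg a r) (Q^~ b))
  - Rintegral area (seg a r `*` seg b r) D.

Lemma Rintegral_halves (f : R -> R) a r : 0 < r ->
  (forall b r, leb.-integrable (seg b r) (EFin \o f)) ->
  Rintegral leb (seg a r) f =
  Rintegral leb (seg a (r / 2)) f + Rintegral leb (seg (a + r / 2) (r / 2)) f.
Proof.
move=> r0 intf; rewrite [in LHS]seg_halves// Rintegral_setU//.
- exact: measurable_seg.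
- exact: measurable_seg.
- by rewrite -seg_halves.
- exact: seg_disjoint.
Qed.

Let iDS (A : set (measurableTypeR R * measurableTypeR R)) : measurable A -> area.-integrable A (EFin \o D).
Proof. by move=> mA; apply: integrableS iD. Qed.

(** Each inner edge is shared by two quarters, whose outward fluxes through it cancel. *)
Lemma flux_additive : square_additive flux.
Proof.
move=> a b r r0; rewrite /flux.
set h := r / 2.
have hE c : c + h + h = c + r by rewrite /h; field.
have mX c c' : measurable (seg c h `*` seg c' h : set (measurableTypeR R * measurableTypeR R)).
  by apply: measurableX; exact: measurable_seg.
have mX2 c c' : measurable (seg c h `*` seg c' r : set (measurableTypeR R * measurableTypeR R)).
  by apply: measurableX; exact: measurable_seg.
have E1 : Rintegral area (seg a r `*` seg b r) D =
    Rintegral area (seg a h `*` seg b r) D +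
    Rintegral area (seg (a + h) h `*` seg b r) D.
  rewrite [in LHS](seg_halves a r0) setXUl; apply: Rintegral_setU => //.
  - by apply: iDS; apply: measurableU.
  - apply/disj_set2P/seteqP; split => // -[x y] [] [/= h1 _] [/= h2 _].
    have /disj_set2P/seteqP[+ _] := seg_disjoint a r.
    by move=> /(_ x); apply; split.
have E2 c : Rintegral area (seg c h `*` seg b r) D =
    Rintegral area (seg c h `*` seg b h) D +
    Rintegral area (seg c h `*` seg (b + h) h) D.
  rewrite [in LHS](seg_halves b r0) setXUr; apply: Rintegral_setU => //.
  - by apply: iDS; apply: measurableU.
  - apply/disj_set2P/seteqP; split => // -[x y] [] [/= _ h1] [/= _ h2].
    have /disj_set2P/seteqP[+ _] := seg_disjoint b r.
    by move=> /(_ y); apply; split.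
rewrite E1 !E2 !hE !(Rintegral_halves b r0 (iP _)) !(Rintegral_halves a r0 (iQ _)).
rewrite -/h; ring.
Qed.

Definition differentiable_at (f : R -> R -> R) (p q A B : R) :=
  forall e : R, 0 < e -> exists2 delta, 0 < delta & forall x y,
    `|x - p| < delta -> `|y - q| < delta ->
    `|f x y - f p q - A * (x - p) - B * (y - q)| <= e * (`|x - p| + `|y - q|).

(** The affine parts of [P] and [Q] at [(p, q)] have flux exactly [(A1 + B2) * r ^+ 2], which is
    what the constant [D (p, q)] integrates to; only the remainders of order [o(r)] on the edges and
    the oscillation of [D] are left. *)
Lemma flux_negligible p q A1 B1 A2 B2 :
  differentiable_at P p q A1 B1 -> differentiable_at Q p q A2 B2 ->
  D (p, q) = A1 + B2 ->
  (forall e : R, 0 < e -> exists2 delta, 0 < delta & forall x y,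
    `|x - p| < delta -> `|y - q| < delta -> `|D (x, y) - D (p, q)| < e) ->
  negligible_at flux p q.
Proof.
(* Nine shares: on a pair of opposite sides each remainder is at most [e / 9 * 2 r], which gives [4]
   shares for [P] and [4] for [Q]; the last one is for [D]. *)
move=> dP dQ DE cD e e0; have e9 : 0 < e / 9 by rewrite divr_gt0.
have [d1 d10 H1] := dP _ e9; have [d2 d20 H2] := dQ _ e9.
have [d3 d30 H3] := cD _ e9.
exists (Num.min d1 (Num.min d2 d3)); first by rewrite !lt_min d10 d20.
move=> a b r r0; rewrite !lt_min => /and3P[rd1 rd2 rd3] ap bq.
have near x : a <= x <= a + r -> `|x - p| <= r by rewrite ler_norml; lra.
have near' y : b <= y <= b + r -> `|y - q| <= r by rewrite ler_norml; lra.
have K1 : `|Rintegral leb (seg b r) (P (a + r)) - Rintegral leb (seg b r) (P a)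
    - A1 * r * r| <= 4 * (e / 9) * r * r.
  have [ic <-] := Rintegral_cst_measure (mu := leb) (A1 * r) (measurable_seg b r)
    (lebesgue_seg b r0).
  have iB := integrableB (measurable_seg _ _) (iP (a + r) b r) (iP a b r).
  rewrite -RintegralB//; try exact: measurable_seg.
  rewrite -RintegralB//; try exact: measurable_seg.
  apply: (Rintegral_bound (mu := leb)); [exact: measurable_seg|exact: lebesgue_seg| |].
    exact: (integrableB (measurable_seg _ _) iB ic).
  move=> y; rewrite /seg /= in_itv/= => /andP[y1 y2].
  have ny := near' y; have h1 := near (a + r); have h2 := near a.
  have hh1 : `|a + r - p| <= r by apply: h1; lra.
  have hh2 : `|a - p| <= r by apply: h2; lra.
  have hhy : `|y - q| <= r by apply: ny; lra.
  have := H1 (a + r) y (le_lt_trans hh1 rd1) (le_lt_trans hhy rd1).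
  have := H1 a y (le_lt_trans hh2 rd1) (le_lt_trans hhy rd1).
  set u := P (a + r) y; set v := P a y; set w := P p q => G2 G1.
  have -> : u - v - A1 * r = (u - w - A1 * (a + r - p) - B1 * (y - q)) -
      (v - w - A1 * (a - p) - B1 * (y - q)) by ring.
  rewrite (le_trans (ler_normB _ _))// (le_trans (lerD G1 G2))//.
  rewrite -mulrDr (_ : 4 * (e / 9) * r = (e / 9) * (4 * r)); last by ring.
  by rewrite ler_wpM2l ?(ltW e9)//; lra.
have K2 : `|Rintegral leb (seg a r) (Q^~ (b + r)) - Rintegral leb (seg a r) (Q^~ b)
    - B2 * r * r| <= 4 * (e / 9) * r * r.
  have [ic <-] := Rintegral_cst_measure (mu := leb) (B2 * r) (measurable_seg a r)
    (lebesgue_seg a r0).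
  have iB := integrableB (measurable_seg _ _) (iQ (b + r) a r) (iQ b a r).
  rewrite -RintegralB//; try exact: measurable_seg.
  rewrite -RintegralB//; try exact: measurable_seg.
  apply: (Rintegral_bound (mu := leb)); [exact: measurable_seg|exact: lebesgue_seg| |].
    exact: (integrableB (measurable_seg _ _) iB ic).
  move=> y; rewrite /seg /= in_itv/= => /andP[y1 y2].
  have hh1 : `|b + r - q| <= r by apply: near'; lra.
  have hh2 : `|b - q| <= r by apply: near'; lra.
  have hhy : `|y - p| <= r by apply: near; lra.
  have := H2 y (b + r) (le_lt_trans hhy rd2) (le_lt_trans hh1 rd2).
  have := H2 y b (le_lt_trans hhy rd2) (le_lt_trans hh2 rd2).
  set u := Q y (b + r); set v := Q y b; set w := Q p q => G2 G1.
  have -> : u - v - B2 * r = (u - w - A2 * (y - p) - B2 * (b + r - q)) -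
      (v - w - A2 * (y - p) - B2 * (b - q)) by ring.
  rewrite (le_trans (ler_normB _ _))// (le_trans (lerD G1 G2))//.
  rewrite -mulrDr (_ : 4 * (e / 9) * r = (e / 9) * (4 * r)); last by ring.
  by rewrite ler_wpM2l ?(ltW e9)//; lra.
have mX : measurable (seg a r `*` seg b r : set (measurableTypeR R * measurableTypeR R)) by apply: measurableX; exact: measurable_seg.
have K3 : `|Rintegral area (seg a r `*` seg b r) D - D (p, q) * r ^+ 2|
    <= e / 9 * r ^+ 2.
  have [ic <-] := Rintegral_cst_measure (mu := area) (D (p, q)) mX (area_seg a b r0).
  rewrite -RintegralB//; last exact: iDS.
  apply: (Rintegral_bound (mu := area)); [by []|exact: area_seg| |].
    exact: (integrableB mX (iDS mX) ic).
  move=> [x y]; rewrite /seg /= !in_itv/= => -[/andP[x1 x2] /andP[y1 y2]].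
  apply/ltW/H3; [apply: le_lt_trans rd3|apply: le_lt_trans rd3].
    by apply: near; lra.
  by apply: near'; lra.
rewrite /flux.
move: K1 K2 K3.
set u1 := Rintegral _ _ _; set u2 := Rintegral _ _ _; set u3 := Rintegral _ _ _.
set u4 := Rintegral _ _ _; set u5 := Rintegral _ _ _ => K1 K2 K3.
have -> : u1 - u2 + (u3 - u4) - u5 = (u1 - u2 - A1 * r * r) +
    (u3 - u4 - B2 * r * r) - (u5 - D (p, q) * r ^+ 2) by rewrite DE; ring.
apply: (le_trans (ler_normB _ _)).
have -> : e * r ^+ 2 = 4 * (e / 9) * r * r + 4 * (e / 9) * r * r + e / 9 * r ^+ 2.
  by field.
apply: lerD => //; apply: (le_trans (ler_normD _ _)); exact: lerD.
Qed.

End Divergence.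

(** * Wirtinger derivatives *)

Section ExponentialBounds.
Context (R : realType).

Lemma is_derive_bound (f df : R -> R) (K y : R) :
  (forall x : R, is_derive x 1 f (df x)) -> (forall x, `|x| <= `|y| -> `|df x| <= K) ->
  `|f y - f 0| <= K * `|y|.
Proof.
move=> fdf dfK.
have cf a b : {within `[a, b], continuous f}.
  apply: continuous_subspaceT => x; apply: differentiable_continuous.
  by apply/derivable1_diffP; have [] := fdf x.
have [y0|y0|<-] := ltgtP 0 y; last by rewrite subrr normr0 mulr0.
- have [c + ->] := MVT y0 (fun x _ => fdf x) (cf 0 y).
  rewrite in_itv/= => /andP[c0 cy]; rewrite subr0 normrM ler_wpM2r//.
  by apply: dfK; rewrite !gtr0_norm// ltW.
- have [c + e] := MVT y0 (fun x _ => fdf x) (cf y 0).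
  rewrite in_itv/= => /andP[cy c0]; rewrite distrC e sub0r normrM normrN ler_wpM2r//.
  by apply: dfK; rewrite !ltr0_norm// lerN2 ltW.
Qed.

Lemma sin_bound (y : R) : `|sin y| <= `|y|.
Proof.
have := @is_derive_bound sin cos 1 y (fun x => is_derive_sin x).
by rewrite sin0 subr0 mul1r; apply => x _; exact: cos_max.
Qed.

Lemma cos_bound (y : R) : `|cos y - 1| <= y ^+ 2.
Proof.
have := @is_derive_bound cos (fun x => - sin x) `|y| y (fun x => is_derive_cos x).
rewrite cos0 -normrM -expr2 ger0_norm ?sqr_ge0//; apply => x xy.
by rewrite normrN (le_trans (sin_bound x)).
Qed.

Lemma cos_bound1 (y : R) : `|cos y - 1| <= `|y|.
Proof.
have := @is_derive_bound cos (fun x => - sin x) 1 y (fun x => is_derive_cos x).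
by rewrite cos0 mul1r; apply => x _; rewrite normrN sin_max.
Qed.

Lemma sin_sub_bound (y : R) : `|sin y - y| <= y ^+ 2.
Proof.
have H (x : R) : is_derive x 1 (sin - id) (cos x - 1).
  exact: (is_deriveB (is_derive_sin x) (is_derive_id x 1)).
have := @is_derive_bound (sin - id) (fun x => cos x - 1) `|y| y H.
rewrite -[(_ - _) y]/(sin y - y) -[(_ - _) 0]/(sin 0 - 0) sin0 subrr subr0.
rewrite -normrM -expr2 ger0_norm ?sqr_ge0//; apply => x xy.
by rewrite (le_trans (cos_bound1 x)).
Qed.

Lemma expR_sub1_bound (x : R) : `|expR x - 1| <= `|x| * expR `|x|.
Proof.
have h1 := expR_ge1Dx x; have := expR_ge1Dx (- x); rewrite expRN => h2.
have e0 := expR_gt0 x.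
have h3 : (1 - x) * expR x <= 1 by rewrite -ler_pdivlMr// div1r.
have [x0|x0] := leP 0 x.
  rewrite (ger0_norm x0) ger0_norm; first lra.
  by rewrite subr_ge0 -expR0 ler_expR.
rewrite (ltr0_norm x0) ltr0_norm; last by rewrite subr_lt0 -expR0 ltr_expR.
have : 1 <= expR (- x) by rewrite -expR0 ler_expR; lra.
nra.
Qed.

Lemma expR_sub2_bound (x : R) : `|expR x - 1 - x| <= x ^+ 2 * expR `|x|.
Proof.
have h1 := expR_ge1Dx x; have := expR_ge1Dx (- x); rewrite expRN => h2.
have e0 := expR_gt0 x.
have h3 : (1 - x) * expR x <= 1 by rewrite -ler_pdivlMr// div1r.
rewrite ger0_norm; last by lra.
have [x0|x0] := leP 0 x; first by rewrite (ger0_norm x0); nra.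
have : 1 <= expR `|x| by rewrite -expR0 ler_expR.
nra.
Qed.

(** The real and imaginary parts of the remainder split into four terms, each at most
    [|h|^2 * expR |h|] by [K1] to [K4]. *)
Lemma normc_cexp_sub (h : R[i]) :
  normc (cexp h - 1 - h) <= 5 * normc h ^+ 2 * expR (normc h).
Proof.
have rh := Re_le_normc h; have ih := Im_le_normc h; have h0 := normc_ge0 h.
set x := complex.Re h in rh; set y := complex.Im h in ih; set n := normc h in rh ih h0 *.
have E0 : 1 <= expR n by rewrite -expR0 ler_expR.
have Ex : expR `|x| <= expR n by rewrite ler_expR.
have Ex' : expR x <= expR n by rewrite ler_expR (le_trans (ler_norm _)).
have x2 : x ^+ 2 <= n ^+ 2 by rewrite -(real_normK (num_real x)) lerXn2r ?nnegrE.
have y2 : y ^+ 2 <= n ^+ 2 by rewrite -(real_normK (num_real y)) lerXn2r ?nnegrE.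
have n20 := sqr_ge0 n; have ex0 := expR_ge0 x.
have K1 : `|expR x - 1 - x| <= n ^+ 2 * expR n.
  by rewrite (le_trans (expR_sub2_bound x))// ler_pM ?sqr_ge0 ?expR_ge0.
have K2 : expR x * `|cos y - 1| <= n ^+ 2 * expR n.
  by rewrite mulrC ler_pM// (le_trans (cos_bound y)).
have K3 : expR x * `|sin y - y| <= n ^+ 2 * expR n.
  by rewrite mulrC ler_pM// (le_trans (sin_sub_bound y)).
have K4 : `|y| * `|expR x - 1| <= n ^+ 2 * expR n.
  rewrite expr2 -mulrA ler_pM// (le_trans (expR_sub1_bound x))//.
  by rewrite ler_pM ?expR_ge0.
apply: (le_trans (normc_le_ReIm _)).
have -> : complex.Re (cexp h - 1 - h) = (expR x - 1 - x) + expR x * (cos y - 1).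
  by rewrite !(ReD, ReN) Re_cexp /= -/x -/y; ring.
have -> : complex.Im (cexp h - 1 - h) = expR x * (sin y - y) + y * (expR x - 1).
  by rewrite !(ImD, ImN) Im_cexp /= -/x -/y; ring.
have := ler_normD (expR x - 1 - x) (expR x * (cos y - 1)).
have := ler_normD (expR x * (sin y - y)) (y * (expR x - 1)).
rewrite !normrM (ger0_norm ex0) => J1 J2.
apply: (le_trans (lerD J2 J1)); have := mulr_ge0 n20 (ltW (expR_gt0 n)).
lra.
Qed.

End ExponentialBounds.

Section Wirtinger.
Context (R : realType).
Implicit Types (F G : R[i] -> R[i]) (p A B z v : R[i]).

(* [A] and [B] are the derivatives of [F] at [p] with respect to [z] and its
   conjugate. *)
Definition wdiff F p A B := forall e : R, 0 < e -> exists2 delta, 0 < delta &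
  forall v, normc v < delta ->
    normc (F (p + v) - F p - A * v - B * v^*) <= e * normc v.

Let ncM := @ComplexField.Normc.normcM R.

Lemma wdiff_lipschitz F p A B : wdiff F p A B ->
  exists2 K, 0 < K & exists2 delta, 0 < delta & forall v, normc v < delta ->
    normc (F (p + v) - F p) <= K * normc v.
Proof.
move=> /(_ 1 ltr01)[d d0 H]; exists (1 + normc A + normc B).
  by rewrite -addrA ltr_pwDl// addr_ge0// normc_ge0.
exists d => // v /H Hv.
have -> : F (p + v) - F p = (F (p + v) - F p - A * v - B * v^*) + (A * v + B * v^*).
  by ring.
apply: (le_trans (le_normcD _ _)); rewrite -[1 + _ + _]addrA mulrDl; apply: lerD => //.
by rewrite (le_trans (le_normcD _ _))// !ncM normc_conj mulrDl.
Qed.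

Lemma wdiff_continuous F p A B : wdiff F p A B -> forall e : R, 0 < e ->
  exists2 delta, 0 < delta & forall v, normc v < delta -> normc (F (p + v) - F p) < e.
Proof.
move=> /wdiff_lipschitz[K K0 [d d0 H]] e e0.
exists (Num.min d (e / K)); first by rewrite lt_min d0 divr_gt0.
move=> v; rewrite lt_min => /andP[vd ve]; apply: (le_lt_trans (H v vd)).
by rewrite mulrC -ltr_pdivlMr.
Qed.

Lemma wdiff_cst (c : R[i]) p : wdiff (fun=> c) p 0 0.
Proof.
move=> e e0; exists 1 => // v _.
by rewrite !mul0r !subr0 subrr ComplexField.Normc.normc0 mulr_ge0 ?normc_ge0 ?ltW.
Qed.

Lemma wdiff_id p : wdiff id p 1 0.
Proof.
move=> e e0; exists 1 => // v _; rewrite (_ : _ - _ = 0); last by ring.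
by rewrite ComplexField.Normc.normc0 mulr_ge0 ?normc_ge0 ?ltW.
Qed.

Lemma wdiff_conj p : wdiff (fun z => z^*) p 0 1.
Proof.
move=> e e0; exists 1 => // v _; rewrite rmorphD (_ : _ - _ = 0); last by ring.
by rewrite ComplexField.Normc.normc0 mulr_ge0 ?normc_ge0 ?ltW.
Qed.

Lemma wdiffB F G p A B A' B' : wdiff F p A B -> wdiff G p A' B' ->
  wdiff (fun z => F z - G z) p (A - A') (B - B').
Proof.
move=> dF dG e e0; have e20 : 0 < e / 2 by rewrite divr_gt0.
have [d1 d10 H1] := dF _ e20; have [d2 d20 H2] := dG _ e20.
exists (Num.min d1 d2); first by rewrite lt_min d10.
move=> v; rewrite lt_min => /andP[/H1 K1 /H2 K2].
rewrite (_ : _ - _ = (F (p + v) - F p - A * v - B * v^*) -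
  (G (p + v) - G p - A' * v - B' * v^*)); last by ring.
rewrite (le_trans (le_normcD _ _))// normcN (le_trans (lerD K1 K2))//.
by rewrite -mulrDl -splitr.
Qed.

Lemma wdiffM F G p A B A' B' : wdiff F p A B -> wdiff G p A' B' ->
  wdiff (fun z => F z * G z) p (A * G p + F p * A') (B * G p + F p * B').
Proof.
move=> dF dG e e0.
(* [C] adds up the factors of the three error terms below: [|G p| + 1] bounds [|G (p + v)|], [|F p|]
   multiplies the remainder of [G], and [|A| + |B|] comes from the product of the two increments. *)
pose C := normc (G p) + 1 + normc (F p) + (normc A + normc B).
have C0 : 0 < C.
  by rewrite /C; have := normc_ge0 (G p); have := normc_ge0 (F p);
    have := normc_ge0 A; have := normc_ge0 B; lra.
have eC : 0 < e / C by rewrite divr_gt0.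
have [d1 d10 H1] := dF _ eC; have [d2 d20 H2] := dG _ eC.
have [d3 d30 H3] := wdiff_continuous dG ltr01.
have [d4 d40 H4] := wdiff_continuous dG eC.
exists (Num.min (Num.min d1 d2) (Num.min d3 d4)); first by rewrite !lt_min d10 d20 d30.
move=> v; rewrite !lt_min => /andP[/andP[/H1 K1 /H2 K2] /andP[/H3 K3 /H4 K4]].
set E1 := F (p + v) - F p - _ - _ in K1; set E2 := G (p + v) - G p - _ - _ in K2.
rewrite (_ : _ - _ = E1 * G (p + v) + F p * E2 + (A * v + B * v^*) * (G (p + v) - G p));
  last by rewrite /E1 /E2; ring.
have n0 := normc_ge0 v.
have L1 : normc (E1 * G (p + v)) <= e / C * normc v * (normc (G p) + 1).
  rewrite ncM ler_pM ?normc_ge0//.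
  rewrite (_ : G (p + v) = G p + (G (p + v) - G p)); last by ring.
  by rewrite (le_trans (le_normcD _ _))// lerD// ltW.
have L2 : normc (F p * E2) <= e / C * normc v * normc (F p).
  by rewrite ncM mulrC ler_wpM2r ?normc_ge0.
have L3 : normc ((A * v + B * v^*) * (G (p + v) - G p)) <=
    e / C * normc v * (normc A + normc B).
  rewrite ncM mulrC -mulrA ler_pM ?normc_ge0 ?(ltW K4)//.
  by rewrite (le_trans (le_normcD _ _))// !ncM normc_conj -mulrDl mulrC.
apply: (le_trans (le_normcD _ _)).
apply: (le_trans (lerD (le_trans (le_normcD _ _) (lerD L1 L2)) L3)).
rewrite -!mulrDr -/C mulrAC divfK// gt_eqF//.
Qed.

(** The outer function is holomorphic at [F p], so its linear part is multiplication by [a] and acts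
    on both derivatives of [F] alike. *)
Lemma wdiff_comp (phi : R[i] -> R[i]) F p A B (a : R[i]) :
  wdiff phi (F p) a 0 -> wdiff F p A B ->
  wdiff (fun z => phi (F z)) p (a * A) (a * B).
Proof.
move=> dphi dF e e0; have [K K0 [d3 d30 H3]] := wdiff_lipschitz dF.
have eK : 0 < e / 2 / K by rewrite !divr_gt0.
(* [a] may be zero, hence the added 1 in the divisor. *)
have a1 : 0 < normc a + 1 by rewrite ltr_wpDl ?normc_ge0.
have ea : 0 < e / 2 / (normc a + 1) by rewrite !divr_gt0.
have [d1 d10 H1] := dphi _ eK; have [d2 d20 H2] := dF _ ea.
have [d4 d40 H4] := wdiff_continuous dF d10.
exists (Num.min (Num.min d2 d3) d4); first by rewrite !lt_min d20 d30.
move=> v; rewrite !lt_min => /andP[/andP[/H2 K2 /H3 K3] /H4 K4].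
have := H1 _ K4; rewrite mul0r subr0 [F p + _]addrC subrK => K1.
set E2 := F (p + v) - F p - _ - _ in K2.
set E1 := phi (F (p + v)) - _ - _ in K1.
rewrite (_ : _ - _ = E1 + a * E2); last by rewrite /E1 /E2; ring.
have n0 := normc_ge0 v.
apply: (le_trans (le_normcD _ _)); rewrite (splitr e) mulrDl lerD//.
  by rewrite (le_trans K1)// (le_trans (ler_wpM2l (ltW eK) K3))// mulrA divfK// gt_eqF.
rewrite ncM (le_trans (ler_wpM2l (normc_ge0 _) K2))// mulrA ler_wpM2r//.
rewrite mulrCA ler_piMr ?divr_ge0 ?ltW// ltr_pdivrMr// mul1r.
by rewrite ltrDl.
Qed.

Lemma wdiff_inv p : p != 0 -> wdiff (fun z => z^-1) p (- (p ^+ 2)^-1) 0.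
Proof.
move=> p0 e e0; have np : 0 < normc p by rewrite lt0r normc_eq0 p0 normc_ge0.
(* The remainder is exactly [v^2 / ((p + v) p^2)]. The first bound keeps [|p + v|] above [|p| / 2],
   and the second makes [2 |v| / |p|^3] at most [e]. *)
exists (Num.min (normc p / 2) (e * normc p ^+ 3 / 2)).
  by rewrite lt_min divr_gt0//= divr_gt0// mulr_gt0// exprn_gt0.
move=> v; rewrite lt_min => /andP[v1 v2].
have pv : normc p / 2 <= normc (p + v).
  have : normc p <= normc (p + v) + normc v.
    by rewrite -[normc v]normcN (le_trans _ (le_normcD _ _))// addrK.
  lra.
have pv0 : p + v != 0 by rewrite -normc_eq0 gt_eqF// (lt_le_trans _ pv)// divr_gt0.
rewrite (_ : _ - _ = v ^+ 2 * ((p + v)^-1 * (p ^+ 2)^-1)); last first.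
  by field; rewrite p0 pv0.
rewrite !(ncM, normcX, ComplexField.Normc.normcV) expr2 -mulrA mulrC ler_wpM2r ?normc_ge0//.
have c0 : 0 < normc p / 2 by rewrite divr_gt0.
have ib : (normc (p + v))^-1 <= (normc p / 2)^-1.
  by rewrite lef_pV2// posrE (lt_le_trans c0).
have q0 : 0 <= (normc p ^+ 2)^-1 by rewrite invr_ge0 exprn_ge0 ?ltW.
rewrite (le_trans (ler_wpM2l (normc_ge0 v) (ler_wpM2r q0 ib)))//.
rewrite (le_trans (ler_wpM2r _ (ltW v2)))//; first by rewrite mulr_ge0// invr_ge0 ltW.
rewrite le_eqVlt; apply/orP; left; apply/eqP.
by field; rewrite gt_eqF.
Qed.

Lemma wdiff_cexp p : wdiff (@cexp R) p (cexp p) 0.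
Proof.
move=> e e0; pose K := normc (cexp p) * (5 * expR 1).
have K0 : 0 < K by rewrite !mulr_gt0// ?normc_cexp ?expR_gt0.
exists (Num.min 1 (e / K)); first by rewrite lt_min ltr01 divr_gt0.
move=> v; rewrite lt_min => /andP[v1 v2]; rewrite mul0r subr0 cexpD.
rewrite (_ : _ - _ = cexp p * (cexp v - 1 - v)); last by ring.
have n0 := normc_ge0 v.
rewrite ncM (le_trans (ler_wpM2l (normc_ge0 _) (normc_cexp_sub v)))//.
have Ev : expR (normc v) <= expR 1 by rewrite ler_expR ltW.
have -> : normc (cexp p) * (5 * normc v ^+ 2 * expR (normc v)) =
   (normc v * (normc (cexp p) * (5 * expR (normc v)))) * normc v by ring.
rewrite ler_wpM2r//; rewrite ltr_pdivlMr// in v2; apply/ltW/(le_lt_trans _ v2).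
by rewrite ler_wpM2l// ler_wpM2l ?normc_ge0// ler_wpM2l.
Qed.

Lemma wdiff_near F G p A B (r : R) : 0 < r ->
  (forall v, normc v < r -> F (p + v) = G (p + v)) -> wdiff G p A B -> wdiff F p A B.
Proof.
move=> r0 FG dG e e0; have [d d0 H] := dG _ e0.
exists (Num.min d r); first by rewrite lt_min d0.
move=> v; rewrite lt_min => /andP[vd vr].
have := FG 0; rewrite addr0 ComplexField.Normc.normc0 => -> //.
by rewrite FG// H.
Qed.

(** The dictionary between the two kinds of derivatives: the derivative in [x] is [A + B] and the
    one in [y] is [i (A - B)]. *)
Lemma wdiff_differentiable F p A B : wdiff F p A B ->
  differentiable_at (fun x y => complex.Re (F (x +i* y))) (complex.Re p) (complex.Im p)
    (complex.Re (A + B)) (complex.Im (B - A)) /\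
  differentiable_at (fun x y => complex.Im (F (x +i* y))) (complex.Re p) (complex.Im p)
    (complex.Im (A + B)) (complex.Re (A - B)).
Proof.
move=> dF; have key e : 0 < e -> exists2 delta : R, 0 < delta & forall x y : R,
    `|x - complex.Re p| < delta -> `|y - complex.Im p| < delta ->
    normc (F (x +i* y) - F p - A * ((x +i* y) - p) - B * ((x +i* y) - p)^*) <=
    e * (`|x - complex.Re p| + `|y - complex.Im p|).
  move=> e0; have [d d0 H] := dF e e0; exists (d / 2); first by rewrite divr_gt0.
  move=> x y xd yd; set v := (x +i* y) - p.
  have vE : normc v <= `|x - complex.Re p| + `|y - complex.Im p|.
    by rewrite (le_trans (normc_le_ReIm _))// /v !(ReD, ReN, ImD, ImN).
  have := H v; rewrite {1}/v [p + _]addrC subrK => Hv.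
  apply: (le_trans (Hv _)); last by rewrite ler_wpM2l// ltW.
  by rewrite (le_lt_trans vE)//; lra.
split=> e e0; have [d d0 H] := key e e0; exists d => // x y xd yd.
- apply: le_trans (H x y xd yd); apply: le_trans (Re_le_normc _).
  rewrite le_eqVlt; apply/orP; left; apply/eqP; congr `|_|.
  case: p {dF key H xd yd} => a b; case: A => A1 A2; case: B => B1 B2 /=.
  by rewrite !(ReD, ReN, ReM, ReJ, ImJ, ImD, ImN)/=; ring.
- apply: le_trans (H x y xd yd); apply: le_trans (Im_le_normc _).
  rewrite le_eqVlt; apply/orP; left; apply/eqP; congr `|_|.
  case: p {dF key H xd yd} => a b; case: A => A1 A2; case: B => B1 B2 /=.
  by rewrite !(ReD, ReN, ImM, ReJ, ImJ, ImD, ImN)/=; ring.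
Qed.

End Wirtinger.

(** * Measurability and integrability of continuous functions in the plane *)

Section CaratheodoryFunctions.
Context (R : realType).
Local Notation rT := (measurableTypeR R).

(** Freezing the first variable at the grid point of mesh [1 / (n + 1)] just below it gives
    functions that are measurable strip by strip and converge pointwise by continuity. *)
Lemma measurable_caratheodory (f : R -> R -> R) :
  (forall x y (e : R), 0 < e -> exists2 d, 0 < d &
    forall x', `|x' - x| < d -> `|f x' y - f x y| < e) ->
  (forall x, measurable_fun (setT : set rT) (f x)) ->
  measurable_fun (setT : set (rT * rT)) (fun p => f p.1 p.2).
Proof.
move=> cf mf.
pose h n (p : rT * rT) := f ((Num.floor (p.1 * n.+1%:R))%:~R / n.+1%:R) p.2.
apply: (@measurable_fun_cvg _ _ _ _ h); last first.
  move=> [x y] _; apply/cvgrPdist_lt => e e0; have [d d0 H] := cf x y e e0.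
  have := near_infty_natSinv_lt (PosNum d0); apply: filterS => n /= nd.
  rewrite distrC; apply: H.
  have n0 : 0 < n.+1%:R :> R by rewrite ltr0n.
  have /andP[f1 f2] := floor_itv (x * n.+1%:R).
  rewrite distrC ger0_norm; last by rewrite subr_ge0 ler_pdivrMr.
  apply: le_lt_trans nd; rewrite /= lerBlDr -[X in X + _]mul1r -mulrDl.
  by rewrite ler_pdivlMr// addrC (le_trans (ltW f2))// intrD.
move=> n; have n0 : 0 < n.+1%:R :> R by rewrite ltr0n.
(* The strips are indexed by integers; [unpickle] turns this into a union over the natural numbers,
   with empty sets for the codes of no integer. *)
pose E k : set (rT * rT) := if unpickle k is Some m then
  (`[m%:~R / n.+1%:R, (m + 1)%:~R / n.+1%:R[%classic : set rT) `*` setT else set0.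
have mE k : measurable (E k).
  by rewrite /E; case: unpickle => [m|//]; apply: measurableX => //; exact: measurable_itv.
have -> : setT = \bigcup_k E k.
  apply/seteqP; split => // -[x y] _.
  exists (pickle (Num.floor (x * n.+1%:R))); first exact: I.
  rewrite /E pickleK.
  split => //=; have /andP[f1 f2] := floor_itv (x * n.+1%:R).
  by rewrite in_itv/= ler_pdivrMr// ltr_pdivlMr// f1.
apply/(measurable_fun_bigcup _ mE) => k; rewrite /E; case: unpickle => [m|]; last first.
  exact: measurable_fun_set0.
apply: (@eq_measurable_fun _ _ _ _ _ (fun p : rT * rT => f (m%:~R / n.+1%:R) p.2)).
  move=> [x y]; rewrite inE => -[/=]; rewrite in_itv/= => xm _.
  rewrite /h /= (@floor_def _ _ m)//.
  by move: xm; rewrite ler_pdivrMr// ltr_pdivlMr.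
apply: measurable_funTS; apply: (measurableT_comp (mf _)).
exact: measurable_snd.
Qed.

Lemma eps_continuous (f : R -> R) : (forall x (e : R), 0 < e -> exists2 d, 0 < d &
    forall x', `|x' - x| < d -> `|f x' - f x| < e) -> continuous f.
Proof.
move=> H x; apply/cvgrPdist_lt => e e0; have [d d0 Hd] := H x e e0.
apply/nbhs_ballP; exists d => // y; rewrite /ball /= => xy.
by rewrite distrC; apply: Hd; rewrite distrC.
Qed.

Definition ccontinuous (F : R[i] -> R[i]) := forall p (e : R), 0 < e ->
  exists2 d, 0 < d & forall v, normc v < d -> normc (F (p + v) - F p) < e.

Lemma ccontinuous_xy (F : R[i] -> R[i]) : ccontinuous F ->
  forall x y (e : R), 0 < e -> exists2 d, 0 < d & forall x' y',
    `|x' - x| < d -> `|y' - y| < d -> normc (F (x' +i* y') - F (x +i* y)) < e.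
Proof.
move=> cF x y e e0; have [d d0 H] := cF (x +i* y) e e0.
exists (d / 2); first by rewrite divr_gt0.
move=> x' y' xd yd.
have -> : x' +i* y' = (x +i* y) + ((x' - x) +i* (y' - y)).
  by apply: complex_eq => /=; ring.
by apply: H; rewrite (le_lt_trans (normc_le_ReIm _))//=; lra.
Qed.

Lemma ccontinuous_Re (F : R[i] -> R[i]) : ccontinuous F ->
  forall x y (e : R), 0 < e -> exists2 d, 0 < d & forall x' y',
    `|x' - x| < d -> `|y' - y| < d ->
    `|complex.Re (F (x' +i* y')) - complex.Re (F (x +i* y))| < e.
Proof.
move=> cF x y e e0; have [d d0 H] := ccontinuous_xy cF x y e0.
exists d => // x' y' h1 h2; apply: le_lt_trans (H _ _ h1 h2).
by rewrite -ReN -ReD Re_le_normc.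
Qed.

Lemma ccontinuous_Im (F : R[i] -> R[i]) : ccontinuous F ->
  forall x y (e : R), 0 < e -> exists2 d, 0 < d & forall x' y',
    `|x' - x| < d -> `|y' - y| < d ->
    `|complex.Im (F (x' +i* y')) - complex.Im (F (x +i* y))| < e.
Proof.
move=> cF x y e e0; have [d d0 H] := ccontinuous_xy cF x y e0.
exists d => // x' y' h1 h2; apply: le_lt_trans (H _ _ h1 h2).
by rewrite -ImN -ImD Im_le_normc.
Qed.

Lemma continuous_sections (f : R -> R -> R) :
  (forall x y (e : R), 0 < e -> exists2 d, 0 < d & forall x' y',
    `|x' - x| < d -> `|y' - y| < d -> `|f x' y' - f x y| < e) ->
  (forall x, continuous (f x)) /\ (forall y, continuous (f^~ y)).
Proof.
move=> H; split => [x|y]; apply: eps_continuous => z e e0.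
- have [d d0 K] := H x z e e0; exists d => // z' zd; apply: K => //.
  by rewrite subrr normr0.
- have [d d0 K] := H z y e e0; exists d => // z' zd; apply: K => //.
  by rewrite subrr normr0.
Qed.

Lemma measurable_continuous2 (f : R -> R -> R) :
  (forall x y (e : R), 0 < e -> exists2 d, 0 < d & forall x' y',
    `|x' - x| < d -> `|y' - y| < d -> `|f x' y' - f x y| < e) ->
  measurable_fun (setT : set (rT * rT)) (fun p => f p.1 p.2).
Proof.
move=> H; apply: measurable_caratheodory.
- move=> x y e e0; have [d d0 K] := H x y e e0; exists d => // x' xd.
  by apply: K; rewrite // subrr normr0.
- move=> x; apply: continuous_measurable_fun.
  by have [] := continuous_sections H.
Qed.

Lemma cmeasurable_plane (F : R[i] -> R[i]) : ccontinuous F ->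
  cmeasurable (fun p : rT * rT => F (plane p)).
Proof.
move=> cF; split.
- exact: (measurable_continuous2 (ccontinuous_Re cF)).
- exact: (measurable_continuous2 (ccontinuous_Im cF)).
Qed.

Lemma integrable_seg (f : R -> R) (a r : R) : continuous f ->
  (@lebesgue_measure R).-integrable (seg a r) (EFin \o f).
Proof.
move=> cf.
have iC : (@lebesgue_measure R).-integrable `[a, a + r]%classic (EFin \o f).
  apply: continuous_compact_integrable; first exact: segment_compact.
  exact: continuous_subspaceT.
apply: integrableS iC.
- exact: measurable_itv.
- exact: measurable_seg.
- by move=> x; rewrite /seg /= !in_itv/= => /andP[/ltW -> ->].
Qed.

End CaratheodoryFunctions.

(** * Integrable fields with integrable divergence on the whole plane *)

Section IntegrableDivergence.
Context (R : realType).
Local Notation rT := (measurableTypeR R).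
Local Notation leb := (@lebesgue_measure R).
Local Notation area := (leb \x leb)%E.

Definition box (t : R) : set (rT * rT) := seg (- t) (2 * t) `*` seg (- t) (2 * t).

Lemma measurable_box t : measurable (box t).
Proof. by apply: measurableX; exact: measurable_seg. Qed.

Lemma box_sub s t : 0 <= s <= t -> box s `<=` box t.
Proof.
move=> st [x y]; rewrite /box /seg /= !in_itv/= => -[/andP[h1 h2] /andP[h3 h4]].
by split; lra.
Qed.

Lemma box_cover (p : rT * rT) : exists n, box n.+1%:R p.
Proof.
case: p => x y; exists (Num.bound (`|x| + `|y|)).
have := archi_boundP (addr_ge0 (normr_ge0 x) (normr_ge0 y)).
set b := Num.bound _; move=> xyb.
have ns : b%:R < b.+1%:R :> R by rewrite ltr_nat.
rewrite /box /seg /= !in_itv/=.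
have := ler_norm x; have := ler_norm y; have := ler_norm (- x); have := ler_norm (- y).
rewrite !normrN; have := normr_ge0 x; have := normr_ge0 y; split; lra.
Qed.

Lemma box_mono m n : (m <= n)%N -> box m.+1%:R `<=` box n.+1%:R.
Proof. by move=> mn; apply: box_sub; rewrite ler0n ler_nat ltnS mn. Qed.

Lemma Rintegral_box_tail (D : R * R -> R) (e : R) : 0 < e ->
  area.-integrable setT (EFin \o D) -> exists2 T, 0 < T &
  forall t, T <= t -> `|Rintegral area setT D - Rintegral area (box t) D| < e.
Proof.
move=> e0 iD; have mD := measurable_int _ iD.
have iDS (A : set (rT * rT)) : measurable A -> area.-integrable A (EFin \o D).
  by move=> mA; apply: integrableS iD.
pose f n (p : rT * rT) := (`|D p| * \1_(~` box n.+1%:R) p)%:E.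
have mf n : measurable_fun setT (f n).
  apply/measurable_EFinP; apply: measurable_funM; last first.
    by apply: measurable_indic; apply: measurableC; exact: measurable_box.
  by apply: measurableT_comp => //; exact/measurable_EFinP.
have f0 : {ae area, forall p, setT p -> f n p @[n --> \oo] --> (0%E : \bar R)}.
  apply: aeW => p _; apply: cvg_near_cst.
  have [b pb] := box_cover p; exists b => // n /= bn.
  by rewrite /f indicE memNset ?mulr0//= => H; apply: H; exact: (box_mono bn pb).
have dom : {ae area, forall p n, setT p -> (`|f n p| <= `|D p|%:E)%E}.
  apply: aeW => p n _; rewrite /f /= lee_fin normrM normr_id ler_piMr//.
  by rewrite indicE; case: (_ \in _); rewrite ?normr1 ?normr0.
have [_ _] := dominated_convergence measurableT mf (measurable_cst _) f0
  (integrable_norm iD) dom.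
rewrite integral0 => /fine_cvgP[_ /cvgrPdist_lt /(_ e e0)[n _ /(_ n (leqnn n))]].
rewrite /= sub0r normrN => fe.
exists n.+1%:R; first by rewrite ltr0n.
move=> t nt; apply: le_lt_trans fe.
have -> : Rintegral area setT D = Rintegral area (box t) D + Rintegral area (~` box t) D.
  rewrite -Rintegral_setU ?setUv//; first exact: measurable_box.
    by apply: measurableC; exact: measurable_box.
  by apply/disj_set2P; rewrite setICr.
rewrite addrC addKr; have mC s : measurable (~` box s).
  by apply: measurableC; exact: measurable_box.
rewrite (le_trans (le_normr_Rintegral (mC t) (iDS _ (mC t))))//.
rewrite (le_trans _ (ler_norm _))//.
have -> : fine (\int[area]_p f n p)%E =
    Rintegral area (~` box n.+1%:R) (fun p => `|D p|).
  rewrite Rintegral_mkcond /Rintegral; congr fine; apply: eq_integral => p _.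
  by rewrite /f patchE indicE; case: (_ \in _); rewrite ?mulr1 ?mulr0.
have iN s : area.-integrable (~` box s) (EFin \o (fun p => `|D p|)).
  by apply: integrable_norm; apply: iDS; exact: mC.
rewrite /Rintegral fine_le//; try by apply: integrable_fin_num; [exact: mC|exact: iN].
apply: ge0_subset_integral => //; try exact: mC.
- exact: measurable_int (iN _).
- by apply: subsetC; apply: box_sub; rewrite nt ler0n.
Qed.

Variables (P Q : R -> R -> R) (D : R * R -> R).
Hypothesis iP : forall x b r, leb.-integrable (seg b r) (EFin \o P x).
Hypothesis iQ : forall y a r, leb.-integrable (seg a r) (EFin \o Q^~ y).
Hypothesis iP2 : area.-integrable setT (EFin \o (fun p => P p.1 p.2)).
Hypothesis iQ2 : area.-integrable setT (EFin \o (fun p => Q p.1 p.2)).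
Hypothesis iD : area.-integrable setT (EFin \o D).
Hypothesis flux0 : forall t, 0 < t -> flux P Q D (- t) (- t) (2 * t) = 0.

(** [phi t] and [psi t] are the integrals of [|P|] over the line [x = t] and of [|Q|] over the line
    [y = t]. By Tonelli both are integrable functions of [t]. *)
Let phi (t : rT) : \bar R := (\int[leb]_y `|(P t y)%:E|)%E.
Let psi (t : rT) : \bar R := (\int[leb]_x `|(Q x t)%:E|)%E.

Let mphi : measurable_fun setT phi.
Proof.
apply: (measurable_fun_fubini_tonelli_F (fun p : rT * rT => `|(P p.1 p.2)%:E|%E)) => //.
by apply: measurableT_comp => //; exact: measurable_int iP2.
Qed.

Let mpsi : measurable_fun setT psi.
Proof.
apply: (measurable_fun_fubini_tonelli_G (fun p : rT * rT => `|(Q p.1 p.2)%:E|%E)) => //.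
by apply: measurableT_comp => //; exact: measurable_int iQ2.
Qed.

Let iphi : (\int[leb]_t phi t < +oo)%E.
Proof.
have /integrable12ltyP := iP2; apply.
exact: measurable_int iP2.
Qed.

Let ipsi : (\int[leb]_t psi t < +oo)%E.
Proof.
have /integrable21ltyP := iQ2; apply.
exact: measurable_int iQ2.
Qed.

Let phi0 t : (0 <= phi t)%E. Proof. exact: integral_ge0. Qed.
Let psi0 t : (0 <= psi t)%E. Proof. exact: integral_ge0. Qed.

Let seg_le (f : R -> R) a r : leb.-integrable (seg a r) (EFin \o f) ->
  measurable_fun (setT : set rT) f ->
  (`|Rintegral leb (seg a r) f|%:E <= \int[leb]_x `|(f x)%:E|)%E.
Proof.
move=> intf mf; have := le_normr_Rintegral (measurable_seg _ _) intf.
rewrite -lee_fin => /le_trans; apply.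
have iN := integrable_norm intf.
rewrite /Rintegral fineK; last by apply: integrable_fin_num iN; exact: measurable_seg.
apply: ge0_subset_integral => //; first exact: measurable_seg.
by apply/measurable_EFinP; exact: (measurableT_comp _ mf).
Qed.

Let mP2 := measurable_int _ iP2.
Let mQ2 := measurable_int _ iQ2.

Let bd (t : R) : \bar R := (phi t + phi (- t)%R + psi t + psi (- t)%R)%E.

Let flux_bound t : 0 < t -> (`|Rintegral area (box t) D|%:E <= bd t)%E.
Proof.
move=> t0; have := flux0 t0; rewrite /flux -/(box t).
rewrite (_ : - t + 2 * t = t); last by ring.
move/eqP; rewrite subr_eq0 => /eqP <-.
have mP x : measurable_fun (setT : set rT) (P x).
  move/measurable_EFinP : mP2 => mP2'.
  exact: (measurableT_comp mP2' (pair1_measurable x)).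
have mQ y : measurable_fun (setT : set rT) (Q^~ y).
  move/measurable_EFinP : mQ2 => mQ2'.
  exact: (measurableT_comp mQ2' (pair2_measurable y)).
have K1 := seg_le (iP t (- t) (2 * t)) (mP t).
have K2 := seg_le (iP (- t) (- t) (2 * t)) (mP (- t)).
have K3 := seg_le (iQ t (- t) (2 * t)) (mQ t).
have K4 := seg_le (iQ (- t) (- t) (2 * t)) (mQ (- t)).
rewrite /bd; apply: le_trans (leeD (leeD (leeD K1 K2) K3) K4).
rewrite -!EFinD lee_fin.
rewrite (le_trans (ler_normD _ _))// -[leRHS]addrA lerD// (le_trans (ler_normB _ _))//.
Qed.

Let ibd : (\int[leb]_t bd t < +oo)%E.
Proof.
have mo (f : rT -> \bar R) : measurable_fun setT f ->
    measurable_fun (setT : set rT) (fun t => f (- t)%R).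
  move=> mf; apply: (measurableT_comp mf).
  exact: (measurable_funN (measurable_id (D := setT))).
have io (f : rT -> \bar R) : measurable_fun setT f -> (forall t, (0 <= f t)%E) ->
    (\int[leb]_t f t < +oo)%E -> (\int[leb]_t f (- t)%R < +oo)%E.
  move=> mf f0 foo.
  have := @integral_affine_lty R (-1) 0 _ f mf f0 foo.
  rewrite oppr_eq0 oner_eq0 => /(_ isT).
  by under eq_integral do rewrite mulN1r addr0.
have lD (f g : rT -> \bar R) : measurable_fun setT f -> measurable_fun setT g ->
    (forall t, (0 <= f t)%E) -> (forall t, (0 <= g t)%E) ->
    (\int[leb]_t f t < +oo)%E -> (\int[leb]_t g t < +oo)%E ->
    (\int[leb]_t (f t + g t)%E < +oo)%E.
  by move=> mf mg f0 g0 fo go; rewrite ge0_integralD// lte_add_pinfty.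
have mphi' := mo _ mphi; have mpsi' := mo _ mpsi.
have m2 := emeasurable_funD mphi mphi'; have m3 := emeasurable_funD m2 mpsi.
have phi0' t : (0 <= phi (- t)%R)%E by exact: phi0.
rewrite /bd; apply: (lD _ _ m3 mpsi').
- by move=> t; apply: adde_ge0 (psi0 t); exact: adde_ge0.
- by move=> t; exact: psi0.
- apply: (lD _ _ m2 mpsi _ psi0 _ ipsi); first by move=> t; exact: adde_ge0.
  exact: (lD _ _ mphi mphi' phi0 phi0' iphi (io phi mphi phi0 iphi)).
- exact: (io psi mpsi psi0 ipsi).
Qed.

(** By Green's formula the integral of [D] over the box of half side [t] is at most [bd t], the
    total of [|P|] and [|Q|] over the four lines that carry its sides. Since [bd] is integrable, it
    cannot stay above a positive constant, so the limit of these integrals is zero. *)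
Lemma Rintegral_divergence0 : Rintegral area setT D = 0.
Proof.
apply/eqP; rewrite -normr_eq0 eq_le normr_ge0 andbT leNgt; apply/negP => c0.
set c := `|_| in c0; have c2 : 0 < c / 2 by rewrite divr_gt0.
have [T T0 HT] := Rintegral_box_tail c2 iD.
have lower t : T <= t -> ((c / 2)%:E <= bd t)%E.
  move=> Tt; apply: le_trans (flux_bound (lt_le_trans T0 Tt)).
  rewrite lee_fin; have := HT t Tt.
  have := ler_normB (Rintegral area setT D - Rintegral area (box t) D) (- Rintegral area (box t) D).
  rewrite opprK subrK normrN -/c; lra.
(* A positive constant has infinite integral over the half line, against [ibd]. *)
have : (\int[leb]_(t in `[T, +oo[) (c / 2)%:E <= \int[leb]_t bd t)%E.
  have mI : measurable (`[T, +oo[%classic : set rT) by exact: measurable_itv.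
  have mbd : measurable_fun (setT : set rT) bd.
    have mo (f : rT -> \bar R) : measurable_fun setT f ->
        measurable_fun (setT : set rT) (fun t => f (- t)%R).
      move=> mf; apply: (measurableT_comp mf).
      exact: (measurable_funN (measurable_id (D := setT))).
    have m2 := emeasurable_funD mphi (mo _ mphi).
    exact: emeasurable_funD (emeasurable_funD m2 mpsi) (mo _ mpsi).
  have bd0 t : (0 <= bd t)%E by do 3 apply: adde_ge0 => //.
  apply: (@le_trans _ _ (\int[leb]_(t in `[T, +oo[) bd t)%E).
    apply: ge0_le_integral => //.
    - by move=> t _; rewrite lee_fin ltW.
    - exact: measurable_funTS.
    - by move=> t; rewrite /= in_itv/= andbT; exact: lower.
  exact: ge0_subset_integral.
have mT : leb `[T, +oo[%classic = +oo%E by rewrite lebesgue_measure_itv/= ltry.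
have -> : (\int[leb]_(t in `[T, +oo[) (c / 2)%:E = +oo)%E.
  rewrite integral_cst//; transitivity ((c / 2)%:E * +oo)%E.
    by congr (_ * _)%E; exact: mT.
  by rewrite mulry gtr0_sg// mul1e.
by rewrite leye_eq => /eqP h; move: ibd; rewrite h.
Qed.

End IntegrableDivergence.

(** * Mean value property and reproducing formula *)

Section TensorProducts.
Context (R : realType).
Local Notation rT := (measurableTypeR R).
Local Notation leb := (@lebesgue_measure R).
Local Notation area := (leb \x leb)%E.

Lemma integrable_tensor (f g : rT -> R) :
  leb.-integrable setT (EFin \o f) -> leb.-integrable setT (EFin \o g) ->
  area.-integrable setT (EFin \o (fun p => f p.1 * g p.2)).
Proof.
move=> intf intg.
have mf : measurable_fun setT f by apply/measurable_EFinP; exact: measurable_int intf.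
have mg : measurable_fun setT g by apply/measurable_EFinP; exact: measurable_int intg.
have mfg : measurable_fun (setT : set (rT * rT)) (EFin \o (fun p => f p.1 * g p.2)).
  apply/measurable_EFinP; apply: measurable_funM; apply: measurableT_comp => //.
apply/(integrable12ltyP _ _ mfg).
have [/integrableP[_ foo] /integrableP[_ goo]] := (intf, intg).
under eq_integral => x _.
  under eq_integral do rewrite /= normrM EFinM.
  rewrite ge0_integralZl//; last first.
    by apply/measurable_EFinP; exact: measurableT_comp.
  over.
rewrite /= ge0_integralZr//; last 2 first.
- by apply/measurable_EFinP; exact: measurableT_comp.
- by apply: integral_ge0.
rewrite muleC; have g0 : (0 <= \int[leb]_x `|(EFin \o g) x|)%E by exact: integral_ge0.
by apply: lte_mul_pinfty => //; rewrite ge0_fin_numE.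
Qed.

Lemma Rintegral_tensor (f g : rT -> R) :
  leb.-integrable setT (EFin \o f) -> leb.-integrable setT (EFin \o g) ->
  Rintegral area setT (fun p => f p.1 * g p.2) =
  Rintegral leb setT f * Rintegral leb setT g.
Proof.
move=> intf intg; rewrite -(Rintegral_prod1 (integrable_tensor intf intg)).
transitivity (Rintegral leb setT (fun x => f x * Rintegral leb setT g)).
  by apply: eq_Rintegral => x _ /=; rewrite (RintegralZl _ measurableT).
by rewrite RintegralZr.
Qed.

Lemma gauss_plane (p : R * R) :
  expR (- (normc (plane p) ^+ 2)) = gauss_fun p.1 * gauss_fun p.2.
Proof. by rewrite /gauss_fun -expRD sqr_normcE /= opprD. Qed.

Lemma integrable_gauss_plane :
  area.-integrable setT (EFin \o (fun p => expR (- (normc (plane p) ^+ 2)))).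
Proof.
apply: eq_integrable (integrable_tensor (@integrableT_gauss R) (@integrableT_gauss R)) => //.
by move=> p _ /=; rewrite gauss_plane.
Qed.

Lemma Rintegral_gauss_plane :
  Rintegral area setT (fun p => expR (- (normc (plane p) ^+ 2))) = pi.
Proof.
transitivity (Rintegral area setT (fun p : rT * rT => gauss_fun p.1 * gauss_fun p.2)).
  by apply: eq_Rintegral => p _; rewrite gauss_plane.
rewrite (Rintegral_tensor (@integrableT_gauss R) (@integrableT_gauss R)).
by rewrite /Rintegral integralT_gauss/= -expr2 sqr_sqrtr// pi_ge0.
Qed.

End TensorProducts.

Section CenteredFlux.
Context (R : realType).
Local Notation leb := (@lebesgue_measure R).
Local Notation area := (leb \x leb)%E.

(** The box is cut into four squares with a common corner at the origin, the only point where
    differentiability may fail. On small squares at that corner boundedness alone makes the flux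
    [O(r)], which is what [bisection_corner] asks for. *)
Lemma flux_centered (P Q : R -> R -> R) (D : R * R -> R) (C d t : R) :
  (forall x b r, leb.-integrable (seg b r) (EFin \o P x)) ->
  (forall y a r, leb.-integrable (seg a r) (EFin \o Q^~ y)) ->
  area.-integrable setT (EFin \o D) ->
  (forall p q, (p, q) != (0, 0) -> negligible_at (flux P Q D) p q) ->
  0 < d -> (forall x y, `|x| < d -> `|y| < d ->
    [/\ `|P x y| <= C, `|Q x y| <= C & `|D (x, y)| <= C]) ->
  0 < t -> flux P Q D (- t) (- t) (2 * t) = 0.
Proof.
move=> iP iQ iD loc d0 bd t0; have addf := flux_additive iP iQ iD.
have C0 : 0 <= C.
  have [] := bd 0 0; rewrite ?normr0// => h _ _; exact: le_trans (normr_ge0 _) h.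
(* Side at most 1 gives [r ^+ 2 <= r] for the area term; side at most [d / 2] keeps a square that
   contains the origin inside the region of the bounds. *)
have r10 : 0 < Num.min 1 (d / 2) by rewrite lt_min ltr01 divr_gt0.
have corner s s' : (s == 0) || (s == 1) -> (s' == 0) || (s' == 1) ->
    flux P Q D (- s * t) (- s' * t) t = 0.
  move=> hs hs'; apply: (bisection_corner (C := 5 * C) addf t0 r10 hs hs' loc).
  move=> a b r r0; rewrite le_min => /andP[r1 rd] a0 b0.
  have ad x : a <= x <= a + r -> `|x| < d by rewrite ltr_norml; lra.
  have bd' x : b <= x <= b + r -> `|x| < d by rewrite ltr_norml; lra.
  have KP x : a <= x <= a + r -> `|Rintegral leb (seg b r) (P x)| <= C * r.
    move=> xa; apply: (Rintegral_bound (mu := leb)).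
    - exact: measurable_seg.
    - exact: lebesgue_seg.
    - exact: iP.
    - move=> y; rewrite /seg /= in_itv/= => /andP[y1 y2].
      by have [] := bd x y (ad _ xa) (bd' y _); first by rewrite (ltW y1).
  have KQ y : b <= y <= b + r -> `|Rintegral leb (seg a r) (Q^~ y)| <= C * r.
    move=> yb; apply: (Rintegral_bound (mu := leb)).
    - exact: measurable_seg.
    - exact: lebesgue_seg.
    - exact: iQ.
    - move=> x; rewrite /seg /= in_itv/= => /andP[x1 x2].
      by have [] := bd x y (ad x _) (bd' _ yb); first by rewrite (ltW x1).
  have mX : measurable (seg a r `*` seg b r :
      set (measurableTypeR R * measurableTypeR R)).
    by apply: measurableX; exact: measurable_seg.
  have KD : `|Rintegral area (seg a r `*` seg b r) D| <= C * r ^+ 2.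
    apply: (Rintegral_bound (mu := area)) => //.
    - exact: area_seg.
    - exact: integrableS iD.
    - move=> [x y]; rewrite /seg /= !in_itv/= => -[/andP[x1 x2] /andP[y1 y2]].
      by have [] := bd x y (ad x _) (bd' y _); rewrite ?(ltW x1) ?(ltW y1).
  have K1 := KP (a + r); have K2 := KP a; have K3 := KQ (b + r); have K4 := KQ b.
  have r2 : C * r ^+ 2 <= C * r by rewrite ler_wpM2l// expr2 ler_piMr// ltW.
  rewrite /flux; apply: (le_trans (ler_normB _ _)).
  have -> : 5 * C * r = (C * r + C * r) + (C * r + C * r) + C * r by ring.
  apply: lerD; last exact: le_trans r2.
  apply: (le_trans (ler_normD _ _)); apply: lerD; apply: (le_trans (ler_normB _ _)).
    by apply: lerD; [apply: K1|apply: K2]; lra.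
  by apply: lerD; [apply: K3|apply: K4]; lra.
rewrite addf ?mulr_gt0// (_ : 2 * t / 2 = t); last by field.
have := corner 0 0; have := corner 0 1; have := corner 1 0; have := corner 1 1.
rewrite eqxx orbT !eqxx !orTb addNr => /(_ isT isT) + /(_ isT isT) + /(_ isT isT) + /(_ isT isT).
by rewrite !mulN1r oppr0 mul0r => -> -> -> ->; rewrite !addr0.
Qed.

End CenteredFlux.

Section MeanValue.
Context (R : realType).
Local Notation rT := (measurableTypeR R).
Local Notation leb := (@lebesgue_measure R).
Local Notation area := (leb \x leb)%E.

Let ncM := @ComplexField.Normc.normcM R.

Lemma wdiff_ccontinuous (F : R[i] -> R[i]) :
  (forall p, exists A B, wdiff F p A B) -> ccontinuous F.
Proof. by move=> dF p; have [A [B]] := dF p; exact: wdiff_continuous. Qed.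

Lemma cexp_gauss (z : R[i]) : cexp (- (z * z^*)) = (expR (- (normc z ^+ 2)))%:C.
Proof. by rewrite mulcJ_normc -rmorphN cexp_real. Qed.

Variable h : R[i] -> R[i].
Hypothesis dh : forall z, exists A, wdiff h z A 0.
Variable A0 : R[i].
Hypothesis dh0 : wdiff h 0 A0 0.

Let H z := h z - h 0.
Let E (z : R[i]) := cexp (- (z * z^*)).
Let G z := H z * E z.
(** Off the origin [G] is the derivative of [F] with respect to the conjugate, because that of [E]
    is [- z * E]. The value [- A0] is the limit of the quotient at the origin and makes [F]
    continuous there. *)
Let F z := if z == 0 then - A0 else - (H z * z^-1 * E z).

Let wE p : wdiff E p (- p^* * E p) (- p * E p).
Proof.
have dN := wdiffB (wdiff_cst 0 p) (wdiffM (wdiff_id p) (wdiff_conj p)).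
have := wdiff_comp (wdiff_cexp _) dN.
have -> : (fun z => cexp (0 - z * z^*)) = E by apply/funext => z; rewrite sub0r.
rewrite sub0r -/(E p); congr wdiff; ring.
Qed.

Let wH p : exists A, wdiff H p A 0.
Proof.
have [A dA] := dh p; exists (A - 0).
by have := wdiffB dA (wdiff_cst (h 0) p); rewrite [0 - 0]subr0.
Qed.

Let wG p : exists A B, wdiff G p A B.
Proof. by have [A dA] := wH p; do 2 eexists; exact: (wdiffM dA (wE p)). Qed.

Let wF p : p != 0 -> exists A, wdiff F p A (G p).
Proof.
move=> p0; have [A dA] := wH p.
have := wdiffB (wdiff_cst 0 p) (wdiffM (wdiffM dA (wdiff_inv p0)) (wE p)).
set A' := (0 - _); set B' := (0 - _) => dF.
have <- : B' = G p by rewrite /B' /G; field.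
exists A'; apply: (wdiff_near (r := normc p)) dF; first by rewrite lt0r normc_eq0 p0 normc_ge0.
move=> v vp; rewrite /F sub0r ifF//; apply/eqP => pv0.
by move: vp; rewrite -(addr0_eq pv0) normcN ltxx.
Qed.

Let normcE z : normc (E z) = expR (- (normc z ^+ 2)).
Proof. by rewrite /E cexp_gauss normc_real ger0_norm// expR_ge0. Qed.

Let normcE1 z : normc (E z) <= 1.
Proof. by rewrite normcE -expR0 ler_expR oppr_le0 sqr_ge0. Qed.

Let cF : ccontinuous F.
Proof.
move=> p; have [->|p0] := eqVneq p 0; last first.
  by have [A dA] := wF p0; exact: wdiff_continuous dA.
move=> e e0; have e2 : 0 < e / 2 by rewrite divr_gt0.
have e4 : 0 < e / 4 by rewrite divr_gt0.
have a0 : 0 < normc A0 + 1 by rewrite ltr_wpDl ?normc_ge0.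
have ea : 0 < e / 2 / (normc A0 + 1) by rewrite divr_gt0.
have [d1 d10 H1] := dh0 e4.
have [d2 d20 H2] := wdiff_continuous (wE 0) ea.
exists (Num.min d1 d2); first by rewrite lt_min d10.
move=> v; rewrite lt_min => /andP[/H1 K1 /H2 K2]; rewrite add0r in K1 K2 *.
rewrite /F eqxx; case: eqVneq => [_|v0].
  by rewrite opprK addNr ComplexField.Normc.normc0.
have nv : 0 < normc v by rewrite lt0r normc_eq0 v0 normc_ge0.
rewrite mul0r subr0 in K1.
have -> : - (H v * v^-1 * E v) - - A0 =
    - ((h v - h 0 - A0 * v) * v^-1 * E v) - A0 * (E v - E 0).
  have E0 : E 0 = 1 by rewrite /E mul0r oppr0 cexp0.
  by rewrite /H E0; field.
rewrite (le_lt_trans (le_normcD _ _))// !normcN (ncM A0).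
rewrite (ncM (_ * v^-1)) (ncM _ v^-1) ComplexField.Normc.normcV.
have L1 : normc (h v - h 0 - A0 * v) * (normc v)^-1 * normc (E v) <= e / 4.
  rewrite -[leRHS]mulr1 ler_pM ?normcE1 ?mulr_ge0 ?invr_ge0 ?normc_ge0//.
  by rewrite ler_pdivrMr.
have L2 : normc A0 * normc (E v - E 0) <= e / 2.
  rewrite (le_trans (ler_wpM2l (normc_ge0 _) (ltW K2)))// mulrCA ler_piMr ?ltW//.
  by rewrite ltr_pdivrMr// mul1r ltrDl.
by apply: (le_lt_trans (lerD L1 L2)); lra.
Qed.

Let cG : ccontinuous G.
Proof. exact: wdiff_ccontinuous wG. Qed.

Hypothesis ih : cintegrable area (fun p => h (plane p) * E (plane p)).

Let iE : cintegrable area (fun p => E (plane p)).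
Proof.
apply: (le_cintegrable _ _ (@integrable_gauss_plane R)).
- apply: cmeasurable_plane; apply: wdiff_ccontinuous => p.
  by do 2 eexists; exact: wE.
- by move=> p; rewrite normcE.
Qed.

Let iG : cintegrable area (fun p => G (plane p)).
Proof.
have := cintegrableB ih (cintegrableZl (h 0) iE).
by apply: eq_cintegrable => p; rewrite /G /H mulrBl.
Qed.

Let bound0 (K : R[i] -> R[i]) : ccontinuous K -> exists C, exists2 d, 0 < d &
  forall v, normc v < d -> normc (K v) <= C.
Proof.
move=> cK; have [d d0 Hd] := cK 0 1 ltr01; exists (normc (K 0) + 1), d => // v /Hd.
rewrite add0r => Kv; have -> : K v = (K v - K 0) + K 0 by rewrite subrK.
by rewrite (le_trans (le_normcD _ _))// addrC lerD// ltW.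
Qed.

Let iF : cintegrable area (fun p => F (plane p)).
Proof.
have [C [d d0 Hd]] := bound0 cF.
(* The first term is at least [|C|] on the disc of radius [d], where [F] is bounded by [C]; outside
   it [|F| = |G| / |z|] is at most the second term. *)
pose g (p : rT * rT) := `|C| * expR (d ^+ 2) * expR (- (normc (plane p) ^+ 2)) +
  d^-1 * normc (G (plane p)).
apply: (@le_cintegrable _ _ _ _ _ g).
- exact: cmeasurable_plane.
- move=> p; rewrite /g; set z := plane p; have [zd|dz] := ltP (normc z) d.
    apply: (le_trans (Hd _ zd)); apply: (le_trans (ler_norm _)).
    rewrite -mulrA -expRD -[leLHS]addr0 lerD//; last first.
      by rewrite mulr_ge0 ?invr_ge0 ?normc_ge0// ltW.
    rewrite ler_peMr// -expR0 ler_expR subr_ge0 lerXn2r ?nnegrE ?normc_ge0 ?ltW//.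
  have z0 : 0 < normc z by exact: lt_le_trans dz.
  rewrite /F ifF; last by rewrite -normc_eq0 gt_eqF.
  rewrite normcN mulrAC -/(G z) (ncM _ z^-1) ComplexField.Normc.normcV mulrC.
  rewrite -[leLHS]add0r lerD//.
  by rewrite ler_wpM2r ?normc_ge0// lef_pV2// posrE.
- have i1 := integrableZl measurableT (`|C| * expR (d ^+ 2)) (@integrable_gauss_plane R).
  have i2 := integrableZl measurableT d^-1 (cintegrable_normc iG).
  exact: (integrableD measurableT i1 i2).
Qed.

(** With [F = u + i v], twice the derivative of [F] in the conjugate variable is
    [(u_x - v_y) + i (v_x + u_y)]. Thus [2 Re G] and [2 Im G] are the divergences of [(u, - v)] and
    [(v, u)], and both have integral zero. What remains of the integral is [h 0] times the total
    mass [pi]. *)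
Lemma gauss_mean_value : cintegral area (fun p => h (plane p) * E (plane p)) = pi%:C * h 0.
Proof.
have [C1 [d1 d10 B1]] := bound0 cF; have [C2 [d2 d20 B2]] := bound0 cG.
have [cG1 cG2] := (ccontinuous_Re cG, ccontinuous_Im cG).
pose C := Num.max C1 (2 * C2); pose d := Num.min d1 d2 / 2.
have d0 : 0 < d by rewrite divr_gt0// lt_min d10.
have small x y : `|x| < d -> `|y| < d ->
    normc (F (x +i* y)) <= C /\ 2 * normc (G (x +i* y)) <= C.
  move=> xd yd; have : normc (x +i* y) < Num.min d1 d2.
    apply: (le_lt_trans (normc_le_ReIm _)) => /=; move: xd yd; rewrite /d.
    by move: (Num.min d1 d2) => m xd yd; lra.
  rewrite lt_min => /andP[/B1 H1 /B2 H2]; rewrite /C !le_max H1 orTb; split => //.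
  by apply/orP; right; rewrite ler_wpM2l.
pose u x y := complex.Re (F (x +i* y)); pose v x y := complex.Im (F (x +i* y)).
have [cu1 cu2] := continuous_sections (ccontinuous_Re cF).
have [cv1 cv2] := continuous_sections (ccontinuous_Im cF).
have iu1 x b r : leb.-integrable (seg b r) (EFin \o u x) by exact: integrable_seg (cu1 x).
have iu2 y b r : leb.-integrable (seg b r) (EFin \o u^~ y) by exact: integrable_seg (cu2 y).
have iv1 x b r : leb.-integrable (seg b r) (EFin \o v x) by exact: integrable_seg (cv1 x).
have iv2 y b r : leb.-integrable (seg b r) (EFin \o (fun x => - v x y)).
  by apply: integrable_seg => x; apply: cvgN; exact: cv2.
have [iu iv] := iF; have [iG1 iG2] := iG.
have iD1 := integrableZl measurableT 2 iG1; have iD2 := integrableZl measurableT 2 iG2.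
have ivN : area.-integrable setT (EFin \o (fun p => - v p.1 p.2)).
  exact: (integrableN iv).
have dF p q : (p, q) != (0, 0) -> exists A, wdiff F (p +i* q) A (G (p +i* q)).
  move=> pq0; apply: wF; apply: contraNneq pq0 => -[-> ->]; exact: eqxx.
have R1 : Rintegral area setT (fun p => 2 * complex.Re (G (plane p))) = 0.
  apply: (Rintegral_divergence0 iu1 iv2 iu ivN iD1) => t t0.
  apply: (@flux_centered _ u (fun x y => - v x y) _ C d) => //.
  - move=> p q /dF[A /wdiff_differentiable[du dv]].
    have dv' : differentiable_at (fun x y => - v x y) p q
        (- complex.Im (A + G (p +i* q))) (- complex.Re (A - G (p +i* q))).
      move=> e e0; have [dd dd0 HH] := dv e e0; exists dd => // x y xd yd.
      rewrite (le_trans _ (HH x y xd yd))// -normrN le_eqVlt; apply/orP; left.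
      by apply/eqP; congr `|_|; rewrite /v /=; ring.
    apply: (flux_negligible iu1 iv2 iD1 du dv').
      by rewrite !(ReD, ReN)/= /plane/=; ring.
    move=> e e0; have [dd dd0 HH] := cG1 p q _ (divr_gt0 e0 (ltr0n _ 2)).
    exists dd => // x y xd yd; have K := HH x y xd yd.
    by rewrite -mulrBr normrM (ger0_norm (ler0n _ _)) mulrC -ltr_pdivlMr.
  - move=> x y xd yd; have [H1 H2] := small x y xd yd; split.
    + exact: le_trans (Re_le_normc _) H1.
    + by rewrite normrN; exact: le_trans (Im_le_normc _) H1.
    + rewrite normrM (ger0_norm (ler0n _ _)) (le_trans _ H2)// ler_wpM2l//.
      exact: Re_le_normc.
have R2 : Rintegral area setT (fun p => 2 * complex.Im (G (plane p))) = 0.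
  apply: (Rintegral_divergence0 iv1 iu2 iv iu iD2) => t t0.
  apply: (@flux_centered _ v u _ C d) => //.
  - move=> p q /dF[A /wdiff_differentiable[du dv]].
    apply: (flux_negligible iv1 iu2 iD2 dv du).
      by rewrite !(ImD, ImN)/= /plane/=; ring.
    move=> e e0; have [dd dd0 HH] := cG2 p q _ (divr_gt0 e0 (ltr0n _ 2)).
    exists dd => // x y xd yd; have K := HH x y xd yd.
    by rewrite -mulrBr normrM (ger0_norm (ler0n _ _)) mulrC -ltr_pdivlMr.
  - move=> x y xd yd; have [H1 H2] := small x y xd yd; split.
    + exact: le_trans (Im_le_normc _) H1.
    + exact: le_trans (Re_le_normc _) H1.
    + rewrite normrM (ger0_norm (ler0n _ _)) (le_trans _ H2)// ler_wpM2l//.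
      exact: Im_le_normc.
have G0 : cintegral area (fun p => G (plane p)) = 0.
  move: R1 R2; rewrite !RintegralZl// => /eqP; rewrite mulf_eq0 pnatr_eq0/= => /eqP e1.
  move=> /eqP; rewrite mulf_eq0 pnatr_eq0/= => /eqP e2.
  by apply: complex_eq.
have -> : (fun p => h (plane p) * E (plane p)) =
    (fun p => G (plane p) + h 0 * E (plane p)).
  by apply/funext => p; rewrite /G /H; ring.
rewrite cintegralD//; last exact: cintegrableZl.
rewrite G0 add0r cintegralZl// mulrC; congr (_ * _).
rewrite -(Rintegral_gauss_plane R) -cintegral_real; apply: eq_cintegral => p.
exact: cexp_gauss.
Qed.

End MeanValue.

(* Otherwise [rewrite] matches the product in the body of [cexp]. *)
#[local] Opaque cexp.

Section ComplexDerivative.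
Context (R : realType).
Local Notation C := R[i].

Lemma derivable_wdiff (f : C -> C) (z : C) :
  derivable (f : C^o -> C^o) z 1 -> exists A, wdiff f z A 0.
Proof.
move=> /cvg_ex[/= l fl]; exists l => e e0.
have eC : (0 : C) < e%:C by rewrite ltcR.
move/cvgrPdist_lt : fl => /(_ _ eC); rewrite near_withinE => /nbhs_ballP[d /= d0 H].
(* Radii of balls live in the complex field; being positive there forces [d] to be real. *)
have d0' : 0 < complex.Re d by move: d0; rewrite ltcE /= => /andP[].
have dE : d = (complex.Re d)%:C.
  by move: d0; rewrite ltcE /= => /andP[/eqP + _]; case: (d) => a b /= ->.
exists (complex.Re d) => // v vd; rewrite mul0r subr0.
have [->|v0] := eqVneq v 0.
  by rewrite addr0 subrr mulr0 subrr ComplexField.Normc.normc0 mulr0.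
have := H v; rewrite /ball /= sub0r normrN dE normr_normc ltcR => /(_ vd v0).
rewrite normr_normc ltcR scaler1 [v + z]addrC => K.
rewrite -normcN (_ : - _ = (l - v^-1 *: (f (z + v) - f z)) * v); last first.
  rewrite mulrBl -[_ *: _]/(v^-1 * (f (z + v) - f z)); field.
  by [].
by rewrite ComplexField.Normc.normcM ler_wpM2r ?normc_ge0// ltW.
Qed.

Lemma wdiff_derivable (f : C -> C) (z A : C) :
  wdiff f z A 0 -> derivable (f : C^o -> C^o) z 1.
Proof.
move=> df; apply/cvg_ex; exists A; apply/cvgrPdist_lt => e.
rewrite ltcE /= => /andP[/eqP eI e0].
have eE : e = (complex.Re e)%:C by move: eI; case: (e) => a b /= ->.
have [d d0 H] := df _ (divr_gt0 e0 (ltr0n _ 2)).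
rewrite near_withinE; apply/nbhs_ballP; exists d%:C; first by rewrite /= ltcR.
move=> v; rewrite /ball /= sub0r normrN normr_normc ltcR => vd v0.
rewrite eE normr_normc ltcR scaler1 [v + z]addrC.
have := H v vd; rewrite mul0r subr0 => K.
have nv : 0 < normc v by rewrite lt0r normc_eq0 v0 normc_ge0.
rewrite -normcN (_ : - _ = (f (z + v) - f z - A * v) * v^-1); last first.
  by rewrite -[_ *: _]/(v^-1 * (f (z + v) - f z)); field.
rewrite ComplexField.Normc.normcM ComplexField.Normc.normcV ltr_pdivrMr//.
by rewrite (le_lt_trans K)// ltr_pM2r// ltr_pdivrMr// ltr_pMr// ltr1n.
Qed.

End ComplexDerivative.

Section Reproducing.
Context (R : realType).
Local Notation C := R[i].
Local Notation rT := (measurableTypeR R).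
Local Notation leb := (@lebesgue_measure R).
Local Notation area := (leb \x leb)%E.

Lemma fock_weightE (z : C) : (fock_weight z)%:C = pi^-1%:C * cexp (- (z * z^*)).
Proof. by rewrite cexp_gauss -rmorphM. Qed.

Lemma ge0_area_shift (f : rT * rT -> \bar R) (a b : R) : measurable_fun setT f ->
  (forall p, (0 <= f p)%E) ->
  (\int[area]_p f p = \int[area]_p f (p.1 + a, p.2 + b)%R)%E.
Proof.
move=> mf f0.
have shift (g : rT -> \bar R) (c : R) : measurable_fun setT g ->
    (forall x, (0 <= g x)%E) -> (\int[leb]_x g x = \int[leb]_x g (x + c)%R)%E.
  move=> mg g0; rewrite (@ge0_integral_affine R 1 c (oner_neq0 _) g mg g0) normr1 mul1e.
  by under eq_integral do rewrite mul1r.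
have msh : measurable_fun (setT : set (rT * rT)) (fun p => (p.1 + a, p.2 + b)).
  by apply: measurable_fun_pair; apply: measurable_funD.
rewrite (fubini_tonelli1 _ mf f0) (fubini_tonelli1 _ (measurableT_comp mf msh)); last first.
  by move=> p; exact: f0.
rewrite /fubini_F [LHS](shift _ a); last 2 first.
- exact: (measurable_fun_fubini_tonelli_F _ mf f0).
- by move=> x; exact: integral_ge0.
apply: eq_integral => x _ /=; apply: (shift (fun y => f ((x + a)%R, y))) => //.
exact: (measurableT_comp mf (pair1_measurable _)).
Qed.

Lemma integral_area_shift (f : rT * rT -> R) (a b : R) :
  area.-integrable setT (EFin \o f) ->
  area.-integrable setT (EFin \o (fun p => f (p.1 + a, p.2 + b))) /\
  Rintegral area setT f = Rintegral area setT (fun p => f (p.1 + a, p.2 + b)).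
Proof.
move=> /[dup] /integrableP[mf foo] intf.
have msh : measurable_fun (setT : set (rT * rT)) (fun p => (p.1 + a, p.2 + b)).
  by apply: measurable_fun_pair; apply: measurable_funD.
split.
  apply/integrableP; split; first exact: (measurableT_comp mf msh).
  by rewrite -(@ge0_area_shift (fun p => `|(f p)%:E|%E))//; exact: measurableT_comp.
rewrite /Rintegral -[fun p => (f (_, _))%:E]/((EFin \o f) \o (fun p => (p.1 + a, p.2 + b))).
rewrite [in LHS]integralE [in RHS]integralE.
rewrite (funepos_comp (EFin \o f) (fun p => (p.1 + a, p.2 + b))).
rewrite (funeneg_comp (EFin \o f) (fun p => (p.1 + a, p.2 + b))).
rewrite (ge0_area_shift a b (measurable_funepos mf))//.
by rewrite (ge0_area_shift a b (measurable_funeneg mf)).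
Qed.

Lemma cintegral_area_shift (f : rT * rT -> C) (a b : R) : cintegrable area f ->
  cintegrable area (fun p => f (p.1 + a, p.2 + b)) /\
  cintegral area f = cintegral area (fun p => f (p.1 + a, p.2 + b)).
Proof.
move=> [/integral_area_shift rf /integral_area_shift If].
have [r1 r2] := rf a b; have [i1 i2] := If a b.
by split; [split|rewrite /cintegral r2 i2].
Qed.

(** [|h| <= 1 + |h|^2], and the Gaussian has finite mass. *)
Lemma sqr_integrable_gauss (h : C -> C) : ccontinuous h ->
  (\int[area]_p (normc (h (plane p)) ^+ 2 * expR (- normc (plane p) ^+ 2))%:E < +oo)%E ->
  cintegrable area (fun p => h (plane p) * cexp (- (plane p * (plane p)^*))).
Proof.
move=> ch hoo; have mh := cmeasurable_plane ch.
have mE : cmeasurable (fun p : rT * rT => cexp (- (plane p * (plane p)^*))).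
  apply: cmeasurable_cexp; apply: cmeasurableN.
  have mid : cmeasurable (fun p : rT * rT => plane p).
    by split; [exact: measurable_fst|exact: measurable_snd].
  by apply: cmeasurableM => //; exact: cmeasurableJ.
pose g1 (p : rT * rT) := normc (h (plane p)) ^+ 2 * expR (- (normc (plane p) ^+ 2)).
have ig1 : area.-integrable setT (EFin \o g1).
  apply: ge0_integrable => //; last by move=> p; rewrite mulr_ge0 ?expR_ge0 ?sqr_ge0.
  apply: measurable_funM; first exact: measurable_sqr_normc.
  have [+ _] := mE; apply: eq_measurable_fun => p _.
  by rewrite cexp_gauss.
apply: (le_cintegrable _ _ (integrableD measurableT (@integrable_gauss_plane R) ig1)).
  exact: cmeasurableM.
move=> p; rewrite ComplexField.Normc.normcM cexp_gauss normc_real.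
rewrite (ger0_norm (expR_ge0 _)) /g1 -[X in _ <= X + _]mul1r -mulrDl ler_wpM2r ?expR_ge0//.
have := sqr_ge0 (normc (h (plane p)) - 1); have := normc_ge0 (h (plane p)).
by move: (normc _) => n; nra.
Qed.

Lemma entire_wdiff (f : C -> C) : entire f -> forall z, exists A, wdiff f z A 0.
Proof. by move=> ef z; exact: derivable_wdiff (ef z). Qed.

Lemma entire_ccontinuous (f : C -> C) : entire f -> ccontinuous f.
Proof.
move=> ef; apply: wdiff_ccontinuous => p; have [A dA] := entire_wdiff ef p.
by exists A, 0.
Qed.

Lemma measurable_F2_density (f : C -> C) : ccontinuous f ->
  measurable_fun (setT : set (rT * rT))
    (fun p => normc (f (plane p)) ^+ 2 * expR (- normc (plane p) ^+ 2)).
Proof.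
move=> cf; apply: measurable_funM.
  exact: measurable_sqr_normc (cmeasurable_plane cf).
by apply/measurable_EFinP; exact: measurable_int (@integrable_gauss_plane R).
Qed.

Lemma F2_gauss (f : C -> C) : F2 f ->
  (\int[area]_p (normc (f (plane p)) ^+ 2 * expR (- normc (plane p) ^+ 2))%:E < +oo)%E.
Proof.
move=> [ef]; have cf := entire_ccontinuous ef.
under eq_integral do rewrite /fock_weight mulrCA EFinM.
rewrite ge0_integralZl//; last 3 first.
- by apply/measurable_EFinP; exact: measurable_F2_density.
- by move=> p _; rewrite lee_fin mulr_ge0 ?sqr_ge0 ?expR_ge0.
- by rewrite lee_fin invr_ge0 pi_ge0.
set I := (\int[area]_p _)%E => H; rewrite ltey; apply: contraPN H => /eqP ->.
by rewrite mulry gtr0_sg ?invr_gt0 ?pi_gt0// mul1e.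
Qed.

Lemma fock_reproducing (f : C -> C) (z : C) : F2 f ->
  lambda_integrable (fun w => f w * cexp (z * w^*)) /\
  lambda_integral (fun w => f w * cexp (z * w^*)) = f z.
Proof.
move=> F2f; have [ef _] := F2f; have foo := F2_gauss F2f.
(* With [w = z + u], the exponent [z * conj w - |w|^2] becomes [- conj z * u - |u|^2], and its first
   term is holomorphic in [u]. *)
pose h u := f (z + u) * cexp (- (z^* * u)).
have dh u : exists A, wdiff h u A 0.
  have [A dA] := entire_wdiff ef (z + u).
  have dz : wdiff (fun v => f (z + v)) u A 0.
    by move=> e e0; have [d d0 H] := dA e e0; exists d => // v /H; rewrite addrA.
  have := wdiffM dz (wdiff_comp (wdiff_cexp _)
    (wdiffB (wdiff_cst 0 u) (wdiffM (wdiff_cst z^* u) (wdiff_id u)))).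
  rewrite (_ : (fun v => _) = h); last first.
    by apply/funext => v; rewrite /h sub0r.
  set A' := (X in wdiff h u X _); set B' := (X in wdiff h u _ X).
  have -> : B' = 0 by rewrite /B'; ring.
  by exists A'.
have ch : ccontinuous h.
  by apply: wdiff_ccontinuous => p; have [A dA] := dh p; exists A, 0.
(* The same substitution transfers square integrability from [f] to [h], at the cost of the constant
   [expR (|z|^2)]. *)
have hE u : normc (h u) ^+ 2 * expR (- normc u ^+ 2) =
    expR (normc z ^+ 2) * (normc (f (u + z)) ^+ 2 * expR (- normc (u + z) ^+ 2)).
  rewrite /h ComplexField.Normc.normcM exprMn normc_cexp -expRM_natl [RHS]mulrCA -!mulrA.
  rewrite -!expRD [u + z]addrC; congr (_ * (_ * expR _)).
  by rewrite !sqr_normcE !(ReN, ReM, ReD, ImD, ReJ, ImJ); ring.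
have hoo : (\int[area]_p (normc (h (plane p)) ^+ 2 * expR (- normc (plane p) ^+ 2))%:E < +oo)%E.
  under eq_integral do rewrite hE EFinM.
  have mq := measurable_F2_density (entire_ccontinuous ef).
  have := ge0_area_shift (complex.Re z) (complex.Im z) ((measurable_EFinP _ _).2 mq).
  have sE (p : rT * rT) : plane (p.1 + complex.Re z, p.2 + complex.Im z) = plane p + z.
    by apply: complex_eq; rewrite ?ReD ?ImD.
  under [in RHS]eq_integral do rewrite /= sE.
  move=> H; have q0 (p : rT * rT) : (0 <= (normc (f (plane p + z)) ^+ 2 *
      expR (- normc (plane p + z) ^+ 2))%:E)%E.
    by rewrite lee_fin mulr_ge0 ?sqr_ge0 ?expR_ge0.
  rewrite ge0_integralZl//; last first.
  - have msh : measurable_fun (setT : set (rT * rT))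
        (fun p => (p.1 + complex.Re z, p.2 + complex.Im z)).
      by apply: measurable_fun_pair; apply: measurable_funD.
    have := measurableT_comp ((measurable_EFinP _ _).2 mq) msh.
    by apply: eq_measurable_fun => p _; rewrite /= sE.
  apply: lte_mul_pinfty => //.
  by rewrite -H// => p; rewrite lee_fin mulr_ge0 ?sqr_ge0 ?expR_ge0.
have ih := sqr_integrable_gauss ch hoo.
have [A0 dh0] := dh 0.
have := gauss_mean_value dh dh0 ih.
have [ih' ->] := cintegral_area_shift (- complex.Re z) (- complex.Im z) ih.
have E p : h (plane (p.1 - complex.Re z, p.2 - complex.Im z)) *
    cexp (- (plane (p.1 - complex.Re z, p.2 - complex.Im z) *
      (plane (p.1 - complex.Re z, p.2 - complex.Im z))^*)) =
    f (plane p) * cexp (z * (plane p)^*) * cexp (- (plane p * (plane p)^*)).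
  have -> : plane (p.1 - complex.Re z, p.2 - complex.Im z) = plane p - z.
    by apply: complex_eq; rewrite ?ReD ?ImD ?ReN ?ImN.
  rewrite /h [z + _]addrC subrK -[LHS]mulrA -[RHS]mulrA -!cexpD; congr (_ * cexp _).
  by rewrite rmorphB /=; ring.
have w p : f (plane p) * cexp (z * (plane p)^*) * (fock_weight (plane p))%:C =
  pi^-1%:C * (f (plane p) * cexp (z * (plane p)^*) * cexp (- (plane p * (plane p)^*))).
  by rewrite fock_weightE; ring.
have ih2 : cintegrable area
    (fun p => f (plane p) * cexp (z * (plane p)^*) * cexp (- (plane p * (plane p)^*))).
  by apply: eq_cintegrable ih' => p; exact: E.
move=> I; have I2 : cintegral area (fun p => f (plane p) * cexp (z * (plane p)^*) *
    cexp (- (plane p * (plane p)^*))) = pi%:C * h 0.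
  by rewrite -I; apply: eq_cintegral => p; rewrite E.
split.
  by apply: eq_cintegrable (cintegrableZl pi^-1%:C ih2) => p; rewrite w.
transitivity (cintegral area (fun p => pi^-1%:C *
    (f (plane p) * cexp (z * (plane p)^*) * cexp (- (plane p * (plane p)^*))))).
  by apply: eq_cintegral => p; exact: w.
rewrite cintegralZl// I2 mulrA -rmorphM/= mulVf.
  by rewrite mul1r /h addr0 mulr0 oppr0 cexp0 mulr1.
by rewrite gt_eqF// pi_gt0.
Qed.

End Reproducing.

(** * Gaussian integrals with a complex linear term *)

Section ComplexGaussian.
Context (R : realType).
Local Notation C := R[i].
Local Notation rT := (measurableTypeR R).
Local Notation leb := (@lebesgue_measure R).
Local Notation area := (leb \x leb)%E.

Lemma gauss_square (a b x : R) : 0 < a ->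
  expR (b * x - a * x ^+ 2) = expR (b ^+ 2 / (4 * a)) * expR (- (a * (x - b / (2 * a)) ^+ 2)).
Proof.
by move=> a0; rewrite -expRD; congr expR; field; rewrite gt_eqF.
Qed.

Lemma integrable_gauss_linear (a b : R) : 0 < a ->
  leb.-integrable setT (EFin \o (fun x : rT => expR (b * x - a * x ^+ 2))).
Proof.
move=> a0; have := integrableZl measurableT (expR (b ^+ 2 / (4 * a)))
  (integrable_gauss (b / (2 * a)) a0).
by apply: eq_integrable => // x _; rewrite /= gauss_square.
Qed.

Lemma Rintegral_gauss_linear (a b : R) : 0 < a ->
  Rintegral leb setT (fun x => expR (b * x - a * x ^+ 2)) =
  Num.sqrt (pi / a) * expR (b ^+ 2 / (4 * a)).
Proof.
move=> a0; under eq_Rintegral do rewrite (gauss_square _ _ a0).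
rewrite RintegralZl//; last exact: integrable_gauss.
by rewrite /Rintegral integral_gauss//= mulrC.
Qed.

Lemma cmeasurable_id_real : cmeasurable (fun x : rT => x%:C).
Proof. by apply: cmeasurable_real; exact: measurable_id. Qed.

Lemma cmeasurable_gauss (b : C) (a : R) :
  cmeasurable (fun x : rT => cexp (b * x%:C - (a * x ^+ 2)%:C)).
Proof.
apply: cmeasurable_cexp; apply: cmeasurableB.
  by apply: cmeasurableM; [exact: cmeasurable_cst|exact: cmeasurable_id_real].
by apply: cmeasurable_real; apply: measurable_funM => //; exact: measurable_funX.
Qed.

Lemma normc_gauss (b : C) (a x : R) :
  normc (cexp (b * x%:C - (a * x ^+ 2)%:C)) = expR (complex.Re b * x - a * x ^+ 2).
Proof. by rewrite normc_cexp ReD ReN ReM !Re_real Im_real mulr0 subr0. Qed.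

Lemma cintegrable_gauss (b : C) (a : R) : 0 < a ->
  cintegrable leb (fun x : rT => cexp (b * x%:C - (a * x ^+ 2)%:C)).
Proof.
move=> a0; apply: le_cintegrable (integrable_gauss_linear (complex.Re b) a0).
- exact: cmeasurable_gauss.
- by move=> x; rewrite normc_gauss.
Qed.

Lemma cintegral_tensor (f g : rT -> C) : cintegrable leb f -> cintegrable leb g ->
  cintegrable area (fun p => f p.1 * g p.2) /\
  cintegral area (fun p => f p.1 * g p.2) = cintegral leb f * cintegral leb g.
Proof.
move=> intf intg; have ifg : cintegrable area (fun p => f p.1 * g p.2).
  apply: le_cintegrable (integrable_tensor (cintegrable_normc intf) (cintegrable_normc intg)).
  - apply: cmeasurableM.
      exact: (cmeasurable_comp (cintegrable_cmeasurable intf) measurable_fst).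
    exact: (cmeasurable_comp (cintegrable_cmeasurable intg) measurable_snd).
  - by move=> p; rewrite ComplexField.Normc.normcM.
split => //; rewrite -cintegral_prod1//=.
transitivity (cintegral leb (fun x => cintegral leb g * f x)).
  by apply: eq_cintegral => x; rewrite cintegralZl// mulrC.
by rewrite cintegralZl// mulrC.
Qed.

Let A (b : C) := cintegral leb (fun x : rT => cexp (b * x%:C - (1 * x ^+ 2)%:C)).

Let A_real (r : R) : A r%:C = (Num.sqrt pi * expR (r ^+ 2 / 4))%:C.
Proof.
have := Rintegral_gauss_linear r ltr01; rewrite divr1 mulr1 => <-.
rewrite -cintegral_real; apply: eq_cintegral => x.
by rewrite -rmorphM -rmorphB cexp_real.
Qed.

(** The mean value property of [u |-> cexp (r u)]: its integral against the Gaussian in the plane is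
    [pi] and factors into a real and an imaginary frequency. As [A r] is known, this determines
    [A (r i)]. *)
Let A_mul (r : R) : A r%:C * A (r%:C * 'i) = pi%:C.
Proof.
pose h (u : C) := cexp (r%:C * u).
have dh z : exists B, wdiff h z B 0.
  have := wdiff_comp (wdiff_cexp _) (wdiffM (wdiff_cst r%:C z) (wdiff_id z)).
  rewrite !mul0r mulr0 addr0 mulr0 => H; eexists; exact: H.
have hE p : h (plane p) * cexp (- (plane p * (plane p)^*)) =
    cexp (r%:C * p.1%:C - (1 * p.1 ^+ 2)%:C) *
    cexp (r%:C * 'i * p.2%:C - (1 * p.2 ^+ 2)%:C).
  rewrite /h -!cexpD; congr cexp.
  by apply: complex_eq; rewrite !(ReD, ImD, ReN, ImN, ReM, ImM, ReJ, ImJ)/=; ring.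
have [it tE] := cintegral_tensor (cintegrable_gauss r%:C ltr01)
  (cintegrable_gauss (r%:C * 'i) ltr01).
have [A0 dh0] := dh 0.
have := gauss_mean_value dh dh0.
have -> : h 0 = 1 by rewrite /h mulr0 cexp0.
rewrite mulr1 => <-.
  by rewrite /A -tE; apply: eq_cintegral => p; rewrite hE.
by apply: eq_cintegrable it => p; rewrite hE.
Qed.

(** A real translation by half the real part of [b] completes the square and leaves a purely
    imaginary frequency, which [A_mul] evaluates. *)
Lemma gauss_fourier (b : C) :
  cintegral leb (fun x : rT => cexp (b * x%:C - (1 * x ^+ 2)%:C)) =
  (Num.sqrt pi)%:C * cexp (b ^+ 2 / 4%:R).
Proof.
pose r := complex.Re b; pose rho := complex.Im b.
have sp : Num.sqrt pi != 0 :> R by rewrite gt_eqF// sqrtr_gt0 pi_gt0.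
have AI : A (rho%:C * 'i) = (Num.sqrt pi * expR (- (rho ^+ 2 / 4)))%:C.
  have := A_mul rho; rewrite A_real => H.
  have e0 : (Num.sqrt pi * expR (rho ^+ 2 / 4))%:C != 0 :> C.
    by rewrite -(rmorph0 (real_complex R)) (inj_eq (@complexI R)) mulf_neq0// gt_eqF// expR_gt0.
  apply: (mulfI e0); rewrite H -rmorphM; congr _%:C.
  rewrite mulrACA -expRD subrr expR0 mulr1 -expr2 sqr_sqrtr//; exact: pi_ge0.
rewrite (@cintegral_affine R 1 (r / 2) (oner_neq0 _) _ (cintegrable_gauss b ltr01)) normr1 mul1r.
transitivity (cexp ((r ^+ 2 / 4)%:C + (rho * r / 2)%:C * 'i) * A (rho%:C * 'i)).
  rewrite /A -cintegralZl; last exact: cintegrable_gauss.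
  apply: eq_cintegral => x; rewrite -cexpD; congr cexp.
  by apply: complex_eq; rewrite !(ReD, ImD, ReN, ImN, ReM, ImM, ReJ, ImJ)/= -/r -/rho; field.
have AI' : (Num.sqrt pi * expR (- (rho ^+ 2 / 4)))%:C =
    (Num.sqrt pi)%:C * cexp (- (rho ^+ 2 / 4))%:C.
  by rewrite cexp_real -rmorphM.
rewrite AI AI'.
rewrite mulrCA.
rewrite -cexpD.
have -> : b ^+ 2 / 4%:R = b ^+ 2 * (4^-1)%:C.
  by congr (_ * _); rewrite fmorphV rmorph_nat.
congr (_ * cexp _).
by apply: complex_eq; rewrite !(ReD, ImD, ReN, ImN, ReM, ImM, ReJ, ImJ)/= -/r -/rho; field.
Qed.

Lemma gauss_fourier2 (b : C) :
  cintegral leb (fun x : rT => cexp (2%:R * b * x%:C - (2 * x ^+ 2)%:C)) =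
  (Num.sqrt (pi / 2))%:C * cexp (b ^+ 2 / 2%:R).
Proof.
have s2 : 0 < Num.sqrt 2 :> R by rewrite sqrtr_gt0.
have s2C : (Num.sqrt 2)%:C ^+ 2 = 2%:R :> C.
  by rewrite -rmorphXn sqr_sqrtr// rmorph_nat.
have s2C0 : (Num.sqrt 2)%:C != 0 :> C.
  by rewrite -(rmorph0 (real_complex R)) (inj_eq (@complexI R)) gt_eqF.
have a0 : (Num.sqrt 2)^-1 != 0 :> R by rewrite invr_neq0// gt_eqF.
rewrite (cintegral_affine 0 a0 (cintegrable_gauss (2%:R * b) (ltr0n _ 2))).
rewrite gtr0_norm ?invr_gt0//.
have E (x : R) : cexp (2%:R * b * ((Num.sqrt 2)^-1 * x + 0)%:C -
    (2 * ((Num.sqrt 2)^-1 * x + 0) ^+ 2)%:C) =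
    cexp ((Num.sqrt 2)%:C * b * x%:C - (1 * x ^+ 2)%:C).
  have h1 : 2%:R * b * ((Num.sqrt 2)^-1 * x + 0)%:C = (Num.sqrt 2)%:C * b * x%:C.
    by rewrite addr0 rmorphM fmorphV -s2C; field.
  have h2 : 2 * ((Num.sqrt 2)^-1 * x + 0) ^+ 2 = 1 * x ^+ 2.
    by rewrite addr0 exprMn exprVn sqr_sqrtr// mulrA divff.
  by rewrite h1 h2.
have EI : cintegral leb (fun x : rT => cexp (2%:R * b * ((Num.sqrt 2)^-1 * x + 0)%:C -
    (2 * ((Num.sqrt 2)^-1 * x + 0) ^+ 2)%:C)) =
    (Num.sqrt pi)%:C * cexp (((Num.sqrt 2)%:C * b) ^+ 2 / 4%:R).
  by rewrite -gauss_fourier; apply: eq_cintegral => x; exact: E.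
apply: etrans (congr1 (fun y => (Num.sqrt 2)^-1%:C * y) EI) _.
have h3 : ((Num.sqrt 2)%:C * b) ^+ 2 / 4%:R = b ^+ 2 / 2%:R.
  by rewrite exprMn s2C; field.
have h4 : Num.sqrt (pi / 2) = (Num.sqrt 2)^-1 * Num.sqrt pi :> R.
  by rewrite (sqrtrM _ (pi_ge0 R)) sqrtrV// mulrC.
by rewrite h3 h4 rmorphM mulrA.
Qed.

End ComplexGaussian.

(** * Integral operators and Schur's test *)

Section GeometricCauchy.
Context (R : realType).

(** [2 * K / 2 ^+ n] bounds the sum of all increments from [n] on, so adding it to [s n] gives a
    decreasing sequence and subtracting it an increasing one. The limit lies between the two. *)
Lemma geometric_cauchy_real (s : nat -> R) (K : R) :
  (forall n, `|s n.+1 - s n| <= K / 2 ^+ n) ->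
  exists l, forall n, `|s n - l| <= 2 * K / 2 ^+ n.
Proof.
move=> H; pose a n := s n + 2 * K / 2 ^+ n; pose b n := s n - 2 * K / 2 ^+ n.
have K0 : 0 <= K by have := H 0%N; rewrite expr0 divr1; exact: le_trans.
have e0 n : 0 <= 2 * K / 2 ^+ n by rewrite divr_ge0 ?mulr_ge0 ?exprn_ge0.
have half n : 2 * K / 2 ^+ n.+1 = K / 2 ^+ n by rewrite exprS; field; rewrite expf_neq0.
have full n : 2 * K / 2 ^+ n = K / 2 ^+ n + K / 2 ^+ n by ring.
have aS n : a n.+1 <= a n.
  by rewrite /a half full; have := H n; rewrite ler_norml => /andP[]; lra.
have bS n : b n <= b n.+1.
  by rewrite /b half full; have := H n; rewrite ler_norml => /andP[]; lra.
have adec m n : (m <= n)%N -> a n <= a m.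
  by move=> /subnKC <-; elim: (n - m)%N => [|k IH]; rewrite ?addn0// addnS (le_trans (aS _)).
have binc m n : (m <= n)%N -> b m <= b n.
  by move=> /subnKC <-; elim: (n - m)%N => [|k IH]; rewrite ?addn0// addnS (le_trans IH).
have ba m n : b m <= a n.
  apply: (@le_trans _ _ (b (maxn m n))); first by apply: binc; rewrite leq_maxl.
  apply: (@le_trans _ _ (a (maxn m n))); last by apply: adec; rewrite leq_maxr.
  by rewrite /a /b; have := e0 (maxn m n); lra.
pose A := [set b n | n in [set: nat]].
have ubA n : ubound A (a n) by move=> _ [m _ <-].
exists (sup A) => n; have h1 : b n <= sup A.
  by apply: ub_le_sup; [exists (a 0%N)|exists n].
have h2 : sup A <= a n by apply: ge_sup; [exists (b 0%N); exists 0%N|].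
by rewrite ler_norml; move: h1 h2; rewrite /a /b; lra.
Qed.

Lemma geometric_cauchy (s : nat -> R[i]) (K : R) :
  (forall n, normc (s n.+1 - s n) <= K / 2 ^+ n) ->
  exists l, forall n, normc (s n - l) <= 4 * K / 2 ^+ n.
Proof.
move=> H.
have [|l1 h1] := @geometric_cauchy_real (fun n => complex.Re (s n)) K.
  by move=> n; rewrite -ReN -ReD (le_trans (Re_le_normc _)).
have [|l2 h2] := @geometric_cauchy_real (fun n => complex.Im (s n)) K.
  by move=> n; rewrite -ImN -ImD (le_trans (Im_le_normc _)).
exists (l1 +i* l2) => n; rewrite (le_trans (normc_le_ReIm _))//.
rewrite ReD ImD ReN ImN /= (le_trans (lerD (h1 n) (h2 n)))//.
by rewrite le_eqVlt; apply/orP; left; apply/eqP; ring.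
Qed.

Lemma ae_eq_cintegral (d : measure_display) (T : measurableType d)
    (mu : {measure set T -> \bar R}) (f g : T -> R[i]) :
  cmeasurable f -> cmeasurable g -> {ae mu, forall x, f x = g x} ->
  cintegral mu f = cintegral mu g.
Proof.
move=> [rf If] [rg Ig] fg; rewrite /cintegral /Rintegral.
congr (fine _ +i* fine _); apply: ae_eq_integral => //.
- exact/measurable_EFinP.
- exact/measurable_EFinP.
- by apply: filterS fg => x -> _.
- exact/measurable_EFinP.
- exact/measurable_EFinP.
- by apply: filterS fg => x -> _.
Qed.

Lemma cvg_cmeasurable (d : measure_display) (T : measurableType d)
    (s : nat -> T -> R[i]) (f : T -> R[i]) :
  (forall n, cmeasurable (s n)) ->
  (forall x, normc (s n x - f x) @[n --> \oo] --> (0 : R)) -> cmeasurable f.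
Proof.
move=> ms sf; split.
- apply: (@measurable_fun_cvg _ _ _ _ (fun n x => complex.Re (s n x))) => [n|x _].
    by have [] := ms n.
  apply/cvgrPdist_lt => e e0; have /cvgrPdist_lt/(_ e e0) := sf x.
  apply: filterS => n /=; rewrite sub0r normrN ger0_norm ?normc_ge0// distrC.
  by apply: le_lt_trans; rewrite -ReN -ReD Re_le_normc.
- apply: (@measurable_fun_cvg _ _ _ _ (fun n x => complex.Im (s n x))) => [n|x _].
    by have [] := ms n.
  apply/cvgrPdist_lt => e e0; have /cvgrPdist_lt/(_ e e0) := sf x.
  apply: filterS => n /=; rewrite sub0r normrN ger0_norm ?normc_ge0// distrC.
  by apply: le_lt_trans; rewrite -ImN -ImD Im_le_normc.
Qed.

(* [sum_n 4^n |s_{n+1} - s_n|^2] is integrable, hence finite on a set [E] of full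
   measure, where the increments decay geometrically. *)
Lemma fast_L2_limit (d : measure_display) (T : measurableType d)
    (mu : {measure set T -> \bar R}) (s : nat -> T -> R[i]) (K : R) :
  0 <= K -> (forall n, cmeasurable (s n)) ->
  mu.-integrable setT (EFin \o (fun x => normc (s 0%N x) ^+ 2)) ->
  (forall n, (\int[mu]_x (normc (s n.+1 x - s n x) ^+ 2)%:E <= (K / 8 ^+ n)%:E)%E) ->
  exists E (f : T -> R[i]) (H : T -> R), [/\ measurable E,
    {ae mu, forall x, E x},
    mu.-integrable setT (EFin \o H),
    (forall n x, normc (s n x * (\1_E x)%:C) ^+ 2 <= H x) /\
      (forall x, normc (f x) ^+ 2 <= H x) &
    forall x, normc (s n x * (\1_E x)%:C - f x) @[n --> \oo] --> (0 : R)].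
Proof.
move=> K0 ms is0 su.
(* The factor [4 ^+ n] loses against the bound [K / 8 ^+ n], so the series of integrals converges;
   conversely [v n x <= w x] makes the increments at most [sqrt (w x) / 2 ^+ n]. *)
pose v n x : \bar R := (4 ^+ n * normc (s n.+1 x - s n x) ^+ 2)%:E.
have v0 n x : (0 <= v n x)%E by rewrite lee_fin mulr_ge0 ?exprn_ge0 ?normc_ge0.
have mv n : measurable_fun setT (v n).
  apply/measurable_EFinP; apply: measurable_funM => //.
  by apply: measurable_sqr_normc; apply: cmeasurableB.
pose w x := (\sum_(n <oo) v n x)%E.
have w0 x : (0 <= w x)%E by apply: nneseries_ge0.
have mw : measurable_fun setT w.
  have := @ge0_emeasurable_sum _ _ R setT v xpredT (fun k x _ _ => v0 k x) (fun k _ => mv k).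
  by [].
have iv n : (\int[mu]_x v n x <= (2 * K / (2 ^ n.+1)%:R)%:E)%E.
  rewrite /v; under eq_integral do rewrite EFinM.
  rewrite ge0_integralZl//; last 2 first.
  - apply/measurable_EFinP; apply: measurable_sqr_normc; exact: cmeasurableB.
  - by move=> x _; rewrite lee_fin exprn_ge0 ?normc_ge0.
  apply: le_trans (lee_wpmul2l _ (su n)) _; first by rewrite lee_fin exprn_ge0.
  rewrite -EFinM lee_fin natrX exprS (_ : 8 = 4 * 2 :> R); last by ring.
  rewrite exprMn le_eqVlt; apply/orP; left; apply/eqP; field.
  by rewrite !expf_neq0.
have iw : (\int[mu]_x w x < +oo)%E.
  rewrite /w integral_nneseries//.
  apply: (@le_lt_trans _ _ (2 * K)%:E); last by rewrite ltry.
  apply: le_trans (epsilon_trick0 xpredT _); last by rewrite mulr_ge0.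
  by apply: lee_nneseries => [n _ _|n _]; [exact: integral_ge0|exact: iv].
have intw : mu.-integrable setT w.
  by apply/integrableP; split => //; under eq_integral do rewrite gee0_abs//.
pose W x := fine (w x).
have W0 x : 0 <= W x by exact: fine_ge0.
have mW : measurable_fun setT W by exact: measurableT_comp.
have iW : mu.-integrable setT (EFin \o W).
  apply: le_integrable intw => //; first exact/measurable_EFinP.
  move=> x _ /=; rewrite /W; case: (w x) (w0 x) => [r| |]//= _.
  by rewrite normr0 leey.
pose E := [set x | (w x < +oo)%E].
have mE : measurable E.
  by rewrite -[E]setTI; apply: measurable_lte => //; exact: measurable_cst.
have incr x n : E x -> normc (s n.+1 x - s n x) <= Num.sqrt (W x) / 2 ^+ n.
  move=> Ex; have wE : w x = (W x)%:E by rewrite /W fineK// ge0_fin_numE.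
  have : (v n x <= w x)%E.
    apply: le_trans (nneseries_lim_ge n.+1 _); last by move=> k _ _; exact: v0.
    by rewrite big_nat_recr//= leeDr//; apply: sume_ge0.
  rewrite wE lee_fin => vW; rewrite ler_pdivlMr ?exprn_gt0//.
  rewrite -(@ler_pXn2r _ 2)// ?nnegrE ?mulr_ge0 ?normc_ge0 ?exprn_ge0 ?sqrtr_ge0//.
  rewrite sqr_sqrtr// exprMn mulrC -exprM mulnC exprM.
  by rewrite (_ : 2 ^+ 2 = 4 :> R)//; ring.
(* Off [E] the limit is set to 0, which is the value of the truncated [s n] there, so that
   convergence holds at every point. *)
have ex x : exists l : R[i], (E x -> forall n, normc (s n x - l) <= 4 * Num.sqrt (W x) / 2 ^+ n)
    /\ (~ E x -> l = 0).
  have [Ex|nEx] := pselect (E x); last by exists 0.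
  have [l Hl] := geometric_cauchy (fun n => incr x n Ex).
  by exists l; split.
have [f Hf] := choice ex.
(* On [E], [|s n - f|] is at most [4 sqrt W] and [|f|] at most [|s 0| + 4 sqrt W]. The bound
   [|s 0| + 8 sqrt W] squares to at most [2 |s 0|^2 + 128 W]. *)
pose H x := 2 * normc (s 0%N x) ^+ 2 + 128 * W x.
have s2 x : Num.sqrt (W x) ^+ 2 = W x by rewrite sqr_sqrtr.
have H0 x : 0 <= H x by apply: addr_ge0; apply: mulr_ge0; rewrite ?sqr_ge0 ?W0 ?ler0n.
have sq x (z : R[i]) : normc z <= normc (s 0%N x) + 8 * Num.sqrt (W x) -> normc z ^+ 2 <= H x.
  move=> zb; rewrite /H -s2.
  have z0 := normc_ge0 z; have n0 := normc_ge0 (s 0%N x); have q0 := sqrtr_ge0 (W x).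
  move: (normc z) (normc (s 0%N x)) (Num.sqrt (W x)) zb z0 n0 q0 => a b c zb z0 n0 q0.
  apply: (@le_trans _ _ ((b + 8 * c) ^+ 2)).
    by rewrite lerXn2r ?nnegrE ?addr_ge0 ?mulr_ge0 ?ler0n.
  rewrite -subr_ge0 (_ : _ - _ = (b - 8 * c) ^+ 2) ?sqr_ge0//; ring.
have fb x : E x -> normc (f x) <= normc (s 0%N x) + 4 * Num.sqrt (W x).
  move=> Ex; have := (Hf x).1 Ex 0%N; rewrite expr0 divr1 => h.
  have -> : f x = s 0%N x - (s 0%N x - f x) by ring.
  by rewrite (le_trans (le_normcD _ _))// normcN lerD.
have q0 x := sqrtr_ge0 (W x).
exists E, f, H; split => //.
- have := integrable_ae measurableT intw; apply: filterS => x /(_ I).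
  by rewrite ge0_fin_numE.
- exact: (integrableD measurableT (integrableZl measurableT 2 is0)
    (integrableZl measurableT 128 iW)).
- split => [n x|x].
    rewrite indicE; have [|nEx] := boolP (x \in E); last first.
      by rewrite mulr0 ComplexField.Normc.normc0 expr0n.
    rewrite inE mulr1 => Ex; apply: sq.
    have := (Hf x).1 Ex n => h; have -> : s n x = (s n x - f x) + f x by ring.
    rewrite (le_trans (le_normcD _ _))// (le_trans (lerD h (fb x Ex)))//.
    have : 4 * Num.sqrt (W x) / 2 ^+ n <= 4 * Num.sqrt (W x).
      by rewrite ler_pdivrMr ?exprn_gt0// ler_peMr ?mulr_ge0// exprn_ege1// ler1n.
    lra.
  have [Ex|nEx] := pselect (E x).
    by apply: sq; rewrite (le_trans (fb x Ex))// lerD2l ler_wpM2r// ler_nat.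
  by rewrite (Hf x).2// ComplexField.Normc.normc0 expr0n.
- move=> x; rewrite indicE; have [|nEx] := boolP (x \in E); last first.
    rewrite (Hf x).2; last by move=> Ex; move: nEx; rewrite mem_set.
    by under eq_fun do rewrite mulr0 subr0 ComplexField.Normc.normc0; exact: cvg_cst.
  rewrite inE => Ex; under eq_fun do rewrite mulr1.
  apply: (@squeeze_cvgr _ _ _ _ (fun=> 0) (fun n => 4 * Num.sqrt (W x) / 2 ^+ n)).
  + by apply: nearW => n; rewrite normc_ge0 (Hf x).1.
  + exact: cvg_cst.
  + have := @cvg_geometric R (4 * Num.sqrt (W x)) 2^-1.
    rewrite ger0_norm// invf_lt1// ltr1n => /(_ isT).
    by apply: cvg_trans; apply: near_eq_cvg; apply: nearW => n; rewrite /geometric /= exprVn.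
Qed.

End GeometricCauchy.

Section SquareIntegrable.
Context (d : measure_display) (T : measurableType d) (R : realType).
Variable mu : {measure set T -> \bar R}.

Definition square_integrable (f : T -> R[i]) : Prop :=
  cmeasurable f /\ mu.-integrable setT (EFin \o (fun x => normc (f x) ^+ 2)).

Definition sqnorm (f : T -> R[i]) : R := Rintegral mu setT (fun x => normc (f x) ^+ 2).

Lemma sqnorm_ge0 f : 0 <= sqnorm f.
Proof. by apply: Rintegral_ge0 => x _; exact: sqr_ge0. Qed.

Lemma normc_mul_le (c : R) (z w : R[i]) : 0 < c ->
  normc (z * w) <= c / 2 * normc z ^+ 2 + (2 * c)^-1 * normc w ^+ 2.
Proof.
move=> c0; rewrite ComplexField.Normc.normcM; move: (normc z) (normc w) => x y.
have : 0 <= (c * x - y) ^+ 2 / (2 * c) by rewrite divr_ge0 ?sqr_ge0 ?mulr_ge0 ?ltW.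
have -> : (c * x - y) ^+ 2 / (2 * c) = c / 2 * x ^+ 2 + (2 * c)^-1 * y ^+ 2 - x * y.
  by field; rewrite gt_eqF.
by rewrite subr_ge0.
Qed.

Lemma cintegrableM_sqr f g : square_integrable f -> square_integrable g ->
  cintegrable mu (fun x => f x * g x).
Proof.
move=> [mf f2] [mg g2]; have i1 := integrableZl measurableT (1 / 2) f2.
have i2 := integrableZl measurableT (2 * 1)^-1 g2.
apply: (le_cintegrable _ _ (integrableD measurableT i1 i2)).
- exact: cmeasurableM.
- by move=> x; exact: normc_mul_le.
Qed.

End SquareIntegrable.

Section SchurWeights.
Context (R : realType).

Lemma integrable_weight (d d' : measure_display) (U : measurableType d)
    (V : measurableType d') (m : {sigma_finite_measure set U -> \bar R})
    (n : {sigma_finite_measure set V -> \bar R}) (f : U -> R) (k : U -> V -> R) (c : R) :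
  measurable_fun setT (fun p : U * V => k p.1 p.2) -> (forall x y, 0 <= k x y) ->
  0 <= c ->
  (forall x, (\int[n]_y (k x y)%:E <= c%:E)%E) -> (forall x, 0 <= f x) ->
  m.-integrable setT (EFin \o f) ->
  (m \x n)%E.-integrable setT (EFin \o (fun p => f p.1 * k p.1 p.2)) /\
  Rintegral (m \x n)%E setT (fun p => f p.1 * k p.1 p.2) <= c * Rintegral m setT f.
Proof.
move=> mk k0 c0 kc f0 intf.
have mf : measurable_fun setT f by apply/measurable_EFinP; exact: measurable_int intf.
have mg : measurable_fun setT (fun p : U * V => f p.1 * k p.1 p.2).
  by apply: measurable_funM => //; exact: measurableT_comp.
have g0 p : (0 <= (f p.1 * k p.1 p.2)%:E)%E by rewrite lee_fin mulr_ge0.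
have mk1 x : measurable_fun setT (k x) by exact: (measurableT_comp mk (pair1_measurable x)).
have mf' := (measurable_EFinP _ _).2 mf; have mg' := (measurable_EFinP _ _).2 mg.
have E : (\int[m \x n]_p (f p.1 * k p.1 p.2)%:E <= c%:E * \int[m]_x (f x)%:E)%E.
  rewrite (fubini_tonelli1 (fun p => (f p.1 * k p.1 p.2)%:E) mg' g0).
  rewrite -ge0_integralZl ?lee_fin//; last by move=> x _; rewrite lee_fin.
  apply: ge0_le_integral => //.
  - by move=> x _; apply: integral_ge0 => y _; exact: (g0 (x, y)).
  - exact: (measurable_fun_fubini_tonelli_F (fun p => (f p.1 * k p.1 p.2)%:E) mg' g0).
  - exact: ((measurable_EFinP _ _).2 (measurable_funM (measurable_cst c) mf)).
  move=> x _; rewrite /fubini_F /=; under eq_integral do rewrite EFinM.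
  rewrite ge0_integralZl ?lee_fin//.
  - by rewrite muleC; apply: lee_wpmul2r; rewrite ?lee_fin.
  - exact: ((measurable_EFinP _ _).2 (mk1 x)).
  - by move=> y _; rewrite lee_fin.
have fin : (\int[m]_x (f x)%:E)%E \is a fin_num by exact: integrable_fin_num.
have ig : (m \x n)%E.-integrable setT (EFin \o (fun p => f p.1 * k p.1 p.2)).
  apply: (ge0_integrable mg); first by move=> p; rewrite mulr_ge0.
  by apply: le_lt_trans E _; rewrite -(fineK fin) -EFinM ltry.
split => //; rewrite /Rintegral -lee_fin fineK; last exact: integrable_fin_num.
by rewrite EFinM fineK.
Qed.

Lemma integrable_weight2 (d d' : measure_display) (U : measurableType d)
    (V : measurableType d') (m : {sigma_finite_measure set U -> \bar R})
    (n : {sigma_finite_measure set V -> \bar R}) (f : V -> R) (k : U -> V -> R) (c : R) :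
  measurable_fun setT (fun p : U * V => k p.1 p.2) -> (forall x y, 0 <= k x y) ->
  0 <= c ->
  (forall y, (\int[m]_x (k x y)%:E <= c%:E)%E) -> (forall y, 0 <= f y) ->
  n.-integrable setT (EFin \o f) ->
  (m \x n)%E.-integrable setT (EFin \o (fun p => f p.2 * k p.1 p.2)) /\
  Rintegral (m \x n)%E setT (fun p => f p.2 * k p.1 p.2) <= c * Rintegral n setT f.
Proof.
move=> mk k0 c0 kc f0 intf.
have mf : measurable_fun setT f by apply/measurable_EFinP; exact: measurable_int intf.
have mg : measurable_fun setT (fun p : U * V => f p.2 * k p.1 p.2).
  by apply: measurable_funM => //; exact: measurableT_comp.
have g0 p : (0 <= (f p.2 * k p.1 p.2)%:E)%E by rewrite lee_fin mulr_ge0.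
have mk1 y : measurable_fun setT (k^~ y) by exact: (measurableT_comp mk (pair2_measurable y)).
have mf' := (measurable_EFinP _ _).2 mf; have mg' := (measurable_EFinP _ _).2 mg.
have E : (\int[m \x n]_p (f p.2 * k p.1 p.2)%:E <= c%:E * \int[n]_y (f y)%:E)%E.
  rewrite (fubini_tonelli2 (fun p => (f p.2 * k p.1 p.2)%:E) mg' g0).
  rewrite -ge0_integralZl ?lee_fin//; last by move=> x _; rewrite lee_fin.
  apply: ge0_le_integral => //.
  - by move=> x _; apply: integral_ge0 => y _; exact: (g0 (y, x)).
  - exact: (measurable_fun_fubini_tonelli_G (fun p => (f p.2 * k p.1 p.2)%:E) mg' g0).
  - exact: ((measurable_EFinP _ _).2 (measurable_funM (measurable_cst c) mf)).
  move=> x _; rewrite /fubini_G /=; under eq_integral do rewrite EFinM.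
  rewrite ge0_integralZl ?lee_fin//.
  - by rewrite muleC; apply: lee_wpmul2r; rewrite ?lee_fin.
  - exact: ((measurable_EFinP _ _).2 (mk1 x)).
  - by move=> y _; rewrite lee_fin.
have fin : (\int[n]_y (f y)%:E)%E \is a fin_num by exact: integrable_fin_num.
have ig : (m \x n)%E.-integrable setT (EFin \o (fun p => f p.2 * k p.1 p.2)).
  apply: (ge0_integrable mg); first by move=> p; rewrite mulr_ge0.
  by apply: le_lt_trans E _; rewrite -(fineK fin) -EFinM ltry.
split => //; rewrite /Rintegral -lee_fin fineK; last exact: integrable_fin_num.
by rewrite EFinM fineK.
Qed.

(** Bilinear form of the test: [2 |a b| <= |a|^2 + |b|^2], and in each of the two terms the kernel
    is integrated first over the variable that does not occur in the square. *)
Lemma schur_test (d d' : measure_display) (U : measurableType d)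
    (V : measurableType d') (m : {sigma_finite_measure set U -> \bar R})
    (n : {sigma_finite_measure set V -> \bar R}) (a : U -> R[i]) (b : V -> R[i])
    (k : U -> V -> R[i]) (c : R) :
  square_integrable m a -> square_integrable n b ->
  cmeasurable (fun p : U * V => k p.1 p.2) -> 0 <= c ->
  (forall x, (\int[n]_y (normc (k x y))%:E <= c%:E)%E) ->
  (forall y, (\int[m]_x (normc (k x y))%:E <= c%:E)%E) ->
  cintegrable (m \x n)%E (fun p => a p.1 * b p.2 * k p.1 p.2) /\
  normc (cintegral (m \x n)%E (fun p => a p.1 * b p.2 * k p.1 p.2)) <=
    c * (2^-1 * sqnorm m a + 2^-1 * sqnorm n b).
Proof.
move=> [ma a2] [mb b2] mk c0 kc1 kc2; have mnk := measurable_normc mk.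
have [i1 b1] := integrable_weight mnk (fun _ _ => normc_ge0 _) c0 kc1 (fun x => sqr_ge0 _) a2.
have [i2 b2'] := integrable_weight2 mnk (fun _ _ => normc_ge0 _) c0 kc2 (fun x => sqr_ge0 _) b2.
have j1 := integrableZl measurableT 2^-1 i1; have j2 := integrableZl measurableT 2^-1 i2.
have j12 := integrableD measurableT j1 j2.
have mD : cmeasurable (fun p : U * V => a p.1 * b p.2 * k p.1 p.2).
  apply: cmeasurableM => //; apply: cmeasurableM.
    exact: (cmeasurable_comp ma measurable_fst).
  exact: (cmeasurable_comp mb measurable_snd).
have leD p : normc (a p.1 * b p.2 * k p.1 p.2) <=
    2^-1 * (normc (a p.1) ^+ 2 * normc (k p.1 p.2)) +
    2^-1 * (normc (b p.2) ^+ 2 * normc (k p.1 p.2)).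
  rewrite ComplexField.Normc.normcM !mulrA -mulrDl ler_wpM2r ?normc_ge0//.
  have := normc_mul_le (a p.1) (b p.2) ltr01.
  by rewrite mul1r mulr1 !expr2 !mulrA.
split; first exact: le_cintegrable mD leD j12.
apply: (le_trans (normc_cintegral_le mD leD j12)).
rewrite RintegralD// !RintegralZl// mulrDr ![c * _]mulrCA.
by rewrite lerD// ler_wpM2l.
Qed.

End SchurWeights.

Lemma cintegrable_fubini2 (d1 d2 : measure_display) (T1 : measurableType d1)
    (T2 : measurableType d2) (R : realType)
    (m1 : {sigma_finite_measure set T1 -> \bar R})
    (m2 : {sigma_finite_measure set T2 -> \bar R}) (f : T1 * T2 -> R[i]) :
  cintegrable (m1 \x m2)%E f -> (forall y, cintegrable m1 (fun x => f (x, y))) ->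
  cintegrable m2 (fun y => cintegral m1 (fun x => f (x, y))).
Proof.
move=> intf iy; have mnf := measurable_normc (cintegrable_cmeasurable intf).
have mf' := (measurable_EFinP _ _).2 mnf.
have f0 (p : T1 * T2) : (0 <= (normc (f p))%:E)%E by rewrite lee_fin normc_ge0.
apply: normc_cintegrable; first exact: (cmeasurable_fubini2 intf).
apply: (@le_lt_trans _ _ (\int[m2]_y \int[m1]_x (normc (f (x, y)))%:E)%E).
  apply: ge0_le_integral => //.
  - by move=> y _; rewrite lee_fin normc_ge0.
  - apply/measurable_EFinP; apply: measurable_normc; exact: (cmeasurable_fubini2 intf).
  - exact: (measurable_fun_fubini_tonelli_G (fun p => (normc (f p))%:E) mf' f0).
  - move=> y _; have := le_normc_cintegral (iy y); rewrite -lee_fin /Rintegral fineK//.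
    exact: (integrable_fin_num measurableT (cintegrable_normc (iy y))).
rewrite -(fubini_tonelli2 (fun p => (normc (f p))%:E) mf' f0).
have /integrableP[_] := cintegrable_normc intf.
by under eq_integral do rewrite gee0_abs//.
Qed.

(** * An integral operator, its adjoint and the kernel of their composition *)

Section KernelOperator.
Context (d1 d2 : measure_display) (X : measurableType d1) (Y : measurableType d2)
  (R : realType).
Variables (mu : {sigma_finite_measure set X -> \bar R})
  (nu : {sigma_finite_measure set Y -> \bar R}).
Variables (kap : X -> Y -> R[i]) (Theta : X -> X -> R[i]) (C M : R).
Hypothesis C_ge0 : 0 <= C.
Hypothesis M_gt0 : 0 < M.
Hypothesis mkap : cmeasurable (fun p : X * Y => kap p.1 p.2).
Hypothesis kap_le : forall p y, normc (kap p y) <= C.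
Hypothesis int_kap : forall p, (\int[nu]_y (normc (kap p y))%:E <= C%:E)%E.
Hypothesis kap_rep : forall p q, cintegral nu (fun y => kap p y * (kap q y)^*) = Theta p q.
Hypothesis mTheta : cmeasurable (fun p : X * X => Theta p.1 p.2).
Hypothesis int_Theta1 : forall p, (\int[mu]_q (normc (Theta p q))%:E <= M%:E)%E.
Hypothesis int_Theta2 : forall q, (\int[mu]_p (normc (Theta p q))%:E <= M%:E)%E.

(** To be used with [kap = bkap] and [Theta = btheta]: [kop] is then the Bargmann transform times
    the square root of the Gaussian weight, and [kadj] its adjoint. *)
Definition kop (phi : Y -> R[i]) (p : X) : R[i] := cintegral nu (fun y => phi y * kap p y).

Definition kadj (h : X -> R[i]) (y : Y) : R[i] := cintegral mu (fun p => h p * (kap p y)^*).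

Let mkap1 p : cmeasurable (kap p).
Proof. exact: (cmeasurable_comp mkap (pair1_measurable p)). Qed.

Let mkap2 y : cmeasurable (kap^~ y).
Proof. exact: (cmeasurable_comp mkap (pair2_measurable y)). Qed.

Let ncM := @ComplexField.Normc.normcM R.

Let int_kap_fin p : nu.-integrable setT (EFin \o (fun y => normc (kap p y))).
Proof.
apply: ge0_integrable; first exact: measurable_normc.
  by move=> y; exact: normc_ge0.
by apply: le_lt_trans (int_kap p) _; rewrite ltry.
Qed.

Lemma Theta_le p q : normc (Theta p q) <= C * C.
Proof.
rewrite -kap_rep; apply: le_trans (normc_cintegral_le _ _
  (integrableZl measurableT C (int_kap_fin q))) _.
- by apply: cmeasurableM => //; exact: cmeasurableJ.
- by move=> y; rewrite ncM normc_conj ler_wpM2r ?normc_ge0.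
- rewrite RintegralZl// ler_wpM2l// -lee_fin /Rintegral fineK//.
  exact: (integrable_fin_num measurableT (int_kap_fin q)).
Qed.

Section Adjoint.
Variable h : X -> R[i].
Hypothesis mh : cmeasurable h.
Hypothesis h1 : mu.-integrable setT (EFin \o (fun p => normc (h p))).
Hypothesis h2 : mu.-integrable setT (EFin \o (fun p => normc (h p) ^+ 2)).

Let mnkap : measurable_fun setT (fun p : X * Y => normc (kap p.1 p.2)).
Proof. exact: measurable_normc mkap. Qed.

Let mh1 : cmeasurable (fun p : X * Y => h p.1).
Proof. exact: (cmeasurable_comp mh measurable_fst). Qed.

Let ihk : cintegrable (mu \x nu)%E (fun p => h p.1 * (kap p.1 p.2)^*).
Proof.
have [ik _] := integrable_weight (m := mu) (n := nu) mnkap (fun _ _ => normc_ge0 _)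
  C_ge0 int_kap (fun _ => normc_ge0 _) h1.
apply: le_cintegrable ik; first by apply: cmeasurableM => //; exact: cmeasurableJ.
by move=> p; rewrite ncM normc_conj.
Qed.

Let ihk2 y : cintegrable mu (fun p => h p * (kap p y)^*).
Proof.
apply: (le_cintegrable _ _ (integrableZl measurableT C h1)).
- by apply: cmeasurableM => //; exact: cmeasurableJ.
- by move=> p; rewrite ncM normc_conj mulrC ler_wpM2r ?normc_ge0.
Qed.

Lemma cmeasurable_kadj : cmeasurable (kadj h).
Proof. exact: (cmeasurable_fubini2 ihk). Qed.

Let N := C * Rintegral mu setT (fun p => normc (h p)).

Lemma kadj_le y : normc (kadj h y) <= N.
Proof.
rewrite /N -RintegralZl//; apply: normc_cintegral_le.
- exact: cintegrable_cmeasurable (ihk2 y).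
- by move=> p; rewrite ncM normc_conj mulrC ler_wpM2r ?normc_ge0.
- exact: (integrableZl measurableT C h1).
Qed.

Lemma cintegrable_kadj : cintegrable nu (kadj h).
Proof. exact: (cintegrable_fubini2 ihk ihk2). Qed.

Lemma kop_kadj q : kop (kadj h) q = cintegral mu (fun p => h p * Theta q p).
Proof.
have ik : cintegrable (mu \x nu)%E (fun p => h p.1 * (kap p.1 p.2)^* * kap q p.2).
  apply: (le_cintegrable _ _ (integrableZl measurableT C (cintegrable_normc ihk))).
  - apply: cmeasurableM; first exact: cintegrable_cmeasurable ihk.
    exact: (cmeasurable_comp (mkap1 q) measurable_snd).
  - by move=> p; rewrite ncM mulrC ler_wpM2r ?normc_ge0.
have := cintegral_swap ik; rewrite /= => E.
transitivity (cintegral nu (fun y => cintegral mu (fun p => h p * (kap p y)^* * kap q y))).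
  by apply: eq_cintegral => y; rewrite /kadj mulrC -cintegralZl//;
    apply: eq_cintegral => p; rewrite mulrC.
rewrite -E; apply: eq_cintegral => p; rewrite -kap_rep -cintegralZl.
  by apply: eq_cintegral => y; ring.
apply: (le_cintegrable _ _ (integrableZl measurableT C (int_kap_fin p))).
- by apply: cmeasurableM => //; exact: cmeasurableJ.
- by move=> y; rewrite ncM normc_conj ler_wpM2r ?normc_ge0.
Qed.

Lemma square_integrable_kadj : square_integrable nu (kadj h).
Proof.
split; first exact: cmeasurable_kadj.
apply: ge0_le_integrable (integrableZl measurableT N (cintegrable_normc cintegrable_kadj)).
- exact: measurable_sqr_normc cmeasurable_kadj.
- by move=> y; exact: sqr_ge0.
- by move=> y; rewrite expr2 ler_wpM2r ?normc_ge0// kadj_le.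
Qed.

(* The left-hand side is the inner product of [h] with its image under [Theta]. *)
Lemma sqnorm_kadj : sqnorm nu (kadj h) <= M * sqnorm mu h.
Proof.
have hJ : cintegrable (mu \x nu)%E (fun p => (h p.1)^* * kap p.1 p.2 * kadj h p.2).
  apply: (le_cintegrable _ _ (integrableZl measurableT N (cintegrable_normc ihk))).
  - apply: cmeasurableM; first by apply: cmeasurableM => //; exact: cmeasurableJ.
    exact: (cmeasurable_comp cmeasurable_kadj measurable_snd).
  - move=> p; rewrite ncM mulrC (le_trans (ler_wpM2r (normc_ge0 _) (kadj_le _)))//.
    by rewrite !ncM !normc_conj.
have E : (sqnorm nu (kadj h))%:C =
    cintegral mu (fun q => (h q)^* * cintegral mu (fun p => h p * Theta q p)).
  rewrite -cintegral_real.
  transitivity (cintegral nu (fun y => cintegral mu (fun q => (h q)^* * kap q y * kadj h y))).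
    apply: eq_cintegral => y; rewrite -mulcJ_normc.
    transitivity (kadj h y * cintegral mu (fun p => (h p * (kap p y)^*)^*)).
        by rewrite cintegralJ.
      rewrite -cintegralZl.
      by apply: eq_cintegral => p; rewrite rmorphM /= conjcK; ring.
    exact: cintegrableJ.
  rewrite -(cintegral_swap hJ) /=; apply: eq_cintegral => q.
  rewrite -kop_kadj -cintegralZl.
    by apply: eq_cintegral => y; ring.
  apply: (le_cintegrable _ _ (integrableZl measurableT C (cintegrable_normc cintegrable_kadj))).
  - by apply: cmeasurableM => //; exact: cmeasurable_kadj.
  - by move=> y; rewrite ncM mulrC ler_wpM2r ?normc_ge0.
have hJ2 : square_integrable mu (fun p => (h p)^*).
  split; first exact: cmeasurableJ.
  by apply: eq_integrable h2 => // p _; rewrite /= normc_conj.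
(* Both functions have the norm of [h], so the two halves in Schur's bound add up to
   [M * sqnorm mu h]. *)
have [iD] := schur_test hJ2 (conj mh h2) mTheta (ltW M_gt0) int_Theta1 int_Theta2.
have -> : sqnorm mu (fun p => (h p)^*) = sqnorm mu h.
  by apply: eq_Rintegral => p _; rewrite normc_conj.
rewrite -mulrDl (_ : 2^-1 + 2^-1 = 1 :> R) ?mul1r; last by field.
rewrite -(cintegral_prod1 iD) /= => K.
rewrite -[leLHS]Re_real E (le_trans (ler_norm _))// (le_trans (Re_le_normc _))//.
rewrite (le_trans _ K)// le_eqVlt; apply/orP; left; apply/eqP; congr normc.
apply: eq_cintegral => q; rewrite -cintegralZl.
  by apply: eq_cintegral => p; rewrite mulrA.
apply: (le_cintegrable _ _ (integrableZl measurableT (C * C) h1)).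
- by apply: cmeasurableM => //; exact: (cmeasurable_comp mTheta (pair1_measurable q)).
- by move=> p; rewrite ncM mulrC ler_wpM2r ?normc_ge0// Theta_le.
Qed.

End Adjoint.

Lemma le_kop_integrand (phi : Y -> R[i]) p y : normc (phi y * kap p y) <=
  C / 2 * normc (phi y) ^+ 2 + 2^-1 * normc (kap p y).
Proof.
have n0 := normc_ge0 (kap p y); have kC := kap_le p y; rewrite ncM.
have : 0 <= (normc (phi y) - 1) ^+ 2 by exact: sqr_ge0.
move: (normc (phi y)) (normc (kap p y)) n0 kC => x k n0 kC x1.
have : x * k <= 2^-1 * (x ^+ 2 + 1) * k by rewrite ler_wpM2r//; lra.
have : x ^+ 2 * k <= x ^+ 2 * C by rewrite ler_wpM2l// sqr_ge0.
lra.
Qed.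

Section Operator.
Variable phi : Y -> R[i].
Hypothesis phi2 : square_integrable nu phi.

Let mphi := phi2.1.
Let iphi := phi2.2.

Let idom p : nu.-integrable setT (EFin \o (fun y =>
  C / 2 * normc (phi y) ^+ 2 + 2^-1 * normc (kap p y))).
Proof.
exact: (integrableD measurableT (integrableZl measurableT (C / 2) iphi)
  (integrableZl measurableT 2^-1 (int_kap_fin p))).
Qed.

Lemma cintegrable_kop p : cintegrable nu (fun y => phi y * kap p y).
Proof.
apply: le_cintegrable (idom p); first exact: cmeasurableM.
by move=> y; exact: le_kop_integrand.
Qed.

Let B := C / 2 * sqnorm nu phi + 2^-1 * C.

Let B_ge0 : 0 <= B.
Proof. by rewrite addr_ge0// !mulr_ge0// ?invr_ge0// sqnorm_ge0. Qed.

Lemma kop_le p : normc (kop phi p) <= B.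
Proof.
apply: (le_trans (normc_cintegral_le _ (fun y => le_kop_integrand phi p y) (idom p))).
  exact: cmeasurableM.
rewrite RintegralD//; last 2 first.
- exact: (integrableZl measurableT (C / 2) iphi).
- exact: (integrableZl measurableT 2^-1 (int_kap_fin p)).
rewrite !RintegralZl//; apply: lerD => //; rewrite ler_wpM2l//.
rewrite -lee_fin /Rintegral fineK//.
exact: (integrable_fin_num measurableT (int_kap_fin p)).
Qed.

Variable A : set X.
Hypothesis mA : measurable A.
Hypothesis A_fin : (mu A < +oo)%E.

(** [kop phi] is bounded, so its restriction to a set of finite measure is integrable and square
    integrable from the outset; this is what [kadj] requires. *)
Definition kop_on (p : X) : R[i] := kop phi p * (\1_A p)%:C.

Let iA : mu.-integrable setT (EFin \o (\1_A : X -> R)).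
Proof.
apply: ge0_integrable; first exact: measurable_indic.
  by move=> x; rewrite indicE; case: (_ \in _).
by rewrite integral_indic// setIT.
Qed.

Let A0 p : 0 <= (\1_A p : R). Proof. by rewrite indicE; case: (_ \in _). Qed.

Let weighted (f : X -> R) : (forall p, 0 <= f p) -> mu.-integrable setT (EFin \o f) ->
  (mu \x nu)%E.-integrable setT (EFin \o (fun q =>
    C / 2 * (f q.1 * normc (phi q.2) ^+ 2) + 2^-1 * (f q.1 * normc (kap q.1 q.2)))).
Proof.
move=> f0 intf.
have [i1 _] := integrable_weight (m := mu) (n := nu) (measurable_normc mkap)
  (fun _ _ => normc_ge0 _) C_ge0 int_kap f0 intf.
have [||i2 _] := integrable_weight (m := mu) (n := nu) (f := f)
  (k := fun _ y => normc (phi y) ^+ 2) (c := sqnorm nu phi) _ (fun _ _ => sqr_ge0 _)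
  (sqnorm_ge0 nu phi) _ f0 intf.
- exact: (measurableT_comp (measurable_sqr_normc mphi) measurable_snd).
- move=> _; rewrite /sqnorm /Rintegral fineK//.
  exact: (integrable_fin_num measurableT iphi).
exact: (integrableD measurableT (integrableZl measurableT (C / 2) i2)
  (integrableZl measurableT 2^-1 i1)).
Qed.

Let mphi2 : cmeasurable (fun q : X * Y => phi q.2).
Proof. exact: (cmeasurable_comp mphi measurable_snd). Qed.

Lemma cmeasurable_kop_on : cmeasurable kop_on.
Proof.
have ig : cintegrable (mu \x nu)%E (fun q => (\1_A q.1)%:C * (phi q.2 * kap q.1 q.2)).
  apply: le_cintegrable (weighted A0 iA).
  - apply: cmeasurableM; last exact: cmeasurableM.
    apply: cmeasurable_real.
    exact: (measurableT_comp (measurable_indic mA) measurable_fst).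
  - move=> q; rewrite ncM normc_real (ger0_norm (A0 _)).
    rewrite mulrCA [X in _ + X]mulrCA -mulrDr ler_wpM2l//.
    exact: le_kop_integrand.
have := cmeasurable_fubini1 ig; congr cmeasurable; apply/funext => p.
by rewrite /= cintegralZl; [rewrite mulrC|exact: cintegrable_kop].
Qed.

Let kop_on_le p : normc (kop_on p) <= B * \1_A p.
Proof. by rewrite ncM normc_real (ger0_norm (A0 _)) ler_wpM2r// kop_le. Qed.

Let i1 : mu.-integrable setT (EFin \o (fun p => normc (kop_on p))).
Proof.
apply: ge0_le_integrable kop_on_le (integrableZl measurableT B iA).
- exact: measurable_normc cmeasurable_kop_on.
- by move=> p; exact: normc_ge0.
Qed.

Let i2 : mu.-integrable setT (EFin \o (fun p => normc (kop_on p) ^+ 2)).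
Proof.
apply: ge0_le_integrable (integrableZl measurableT B i1).
- exact: measurable_sqr_normc cmeasurable_kop_on.
- by move=> p; exact: sqr_ge0.
- move=> p; rewrite expr2 ler_wpM2r ?normc_ge0// (le_trans (kop_on_le p))//.
  by rewrite ler_piMr// indicE; case: (_ \in _).
Qed.

Lemma square_integrable_kop_on : square_integrable mu kop_on.
Proof. by split; [exact: cmeasurable_kop_on|exact: i2]. Qed.

(** By duality the left-hand side is the pairing of [phi] with [kadj kop_on], at most [M / 2 *
    sqnorm nu phi + (2 * M)^-1 * sqnorm nu (kadj kop_on)]. By [sqnorm_kadj] the second term is at
    most half of the left-hand side, which is finite and absorbs it. The bound is independent of
    [A]. *)
Lemma sqnorm_kop_on : sqnorm mu kop_on <= M * sqnorm nu phi.
Proof.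
have mk := cmeasurable_kop_on.
have iJ : cintegrable (mu \x nu)%E (fun q => (kop_on q.1)^* * (phi q.2 * kap q.1 q.2)).
  apply: le_cintegrable (weighted (fun _ => normc_ge0 _) i1).
  - apply: cmeasurableM; last exact: cmeasurableM.
    exact: (cmeasurable_comp (cmeasurableJ mk) measurable_fst).
  - move=> q; rewrite ncM normc_conj mulrCA [X in _ + X]mulrCA -mulrDr.
    by rewrite ler_wpM2l ?normc_ge0//; exact: le_kop_integrand.
have ka := square_integrable_kadj mk i1.
have E : (sqnorm mu kop_on)%:C = cintegral nu (fun y => phi y * (kadj kop_on y)^*).
  rewrite -cintegral_real.
  transitivity (cintegral mu (fun p => cintegral nu (fun y =>
      (kop_on p)^* * (phi y * kap p y)))).
    apply: eq_cintegral => p; rewrite cintegralZl; last exact: cintegrable_kop.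
    rewrite -mulcJ_normc mulrC -/(kop phi p) /kop_on indicE.
    by case: (_ \in _); rewrite ?mulr1// mulr0 rmorph0 !mul0r.
  rewrite (cintegral_swap iJ); apply: eq_cintegral => y.
  have ik : cintegrable mu (fun p => (kop_on p)^* * kap p y).
    apply: (le_cintegrable _ _ (integrableZl measurableT C i1)).
    - by apply: cmeasurableM => //; exact: cmeasurableJ.
    - by move=> p; rewrite ncM normc_conj mulrC ler_wpM2r ?normc_ge0.
  transitivity (phi y * cintegral mu (fun p => (kop_on p)^* * kap p y)).
    by rewrite -cintegralZl//; apply: eq_cintegral => p; ring.
  congr (_ * _); rewrite -[RHS](cintegralJ (f := fun p => kop_on p * (kap p y)^*)).
    by apply: eq_cintegral => p; rewrite [RHS]rmorphM /= conjcK.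
  apply: (le_cintegrable _ _ (integrableZl measurableT C i1)).
  - by apply: cmeasurableM => //; exact: cmeasurableJ.
  - by move=> p; rewrite ncM normc_conj mulrC ler_wpM2r ?normc_ge0.
have iM1 := integrableZl measurableT (M / 2) iphi.
have iM2 := integrableZl measurableT (2 * M)^-1 ka.2.
have mP : cmeasurable (fun y => phi y * (kadj kop_on y)^*).
  by apply: cmeasurableM => //; exact: (cmeasurableJ ka.1).
have leP y : normc (phi y * (kadj kop_on y)^*) <=
    M / 2 * normc (phi y) ^+ 2 + (2 * M)^-1 * normc (kadj kop_on y) ^+ 2.
  by rewrite (le_trans (normc_mul_le _ _ M_gt0))// normc_conj.
have := normc_cintegral_le mP leP (integrableD measurableT iM1 iM2).
rewrite -E normc_real (ger0_norm (sqnorm_ge0 _ _)) RintegralD// !RintegralZl//;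
  last exact: ka.2.
have key (x y z : R) : y <= M * x -> x <= M / 2 * z + (2 * M)^-1 * y -> x <= M * z.
  move=> K1 K2; have K3 : (2 * M)^-1 * y <= x / 2.
    rewrite ler_pdivrMl ?mulr_gt0//.
    by rewrite (_ : 2 * M * (x / 2) = M * x)//; field.
  have : M / 2 * z = (M * z) / 2 by field.
  lra.
exact: key (sqnorm_kadj mk i1 i2).
Qed.

End Operator.

Section Surjectivity.
Variable A : nat -> set X.
Hypothesis mA : forall n, measurable (A n).
Hypothesis A_fin : forall n, (mu (A n) < +oo)%E.
Hypothesis A_mono : forall m n, (m <= n)%N -> A m `<=` A n.
Hypothesis A_cover : forall p, exists n, A n p.
Variable F : X -> R[i].
Hypothesis F_sqr : square_integrable mu F.
Hypothesis F_int : forall p, cintegrable mu (fun q => F q * Theta p q).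
Hypothesis F_rep : forall p, cintegral mu (fun q => F q * Theta p q) = F p.

Let mF := F_sqr.1.
Let iF := F_sqr.2.

Let cut n (q : X) : R[i] := F q * (\1_(A n) q)%:C.

Let chi01 n q : (\1_(A n) q = 0 :> R) \/ (\1_(A n) q = 1 :> R).
Proof. by rewrite indicE; case: (_ \in _); [right|left]. Qed.

Let mcut n : cmeasurable (cut n).
Proof.
by apply: cmeasurableM => //; apply: cmeasurable_real; exact: measurable_indic.
Qed.

Let iA n : mu.-integrable setT (EFin \o (\1_(A n) : X -> R)).
Proof.
have mAn := mA n; apply: ge0_integrable; first exact: measurable_indic.
  by move=> x; rewrite indicE; case: (_ \in _).
by rewrite integral_indic// setIT A_fin.
Qed.

Let icut1 n : mu.-integrable setT (EFin \o (fun q => normc (cut n q))).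
Proof.
have i1 := integrableZl measurableT 2^-1 (integrableD measurableT (iA n) iF).
apply: ge0_le_integrable i1; first exact: measurable_normc (mcut n).
  by move=> q; exact: normc_ge0.
move=> q; rewrite /cut ncM normc_real; have := normc_ge0 (F q); move: (normc (F q)) => x x0.
have : 0 <= (x - 1) ^+ 2 by exact: sqr_ge0.
by case: (chi01 n q) => ->; rewrite ?normr0 ?normr1; have := sqr_ge0 x; lra.
Qed.

Let cut_le n q : normc (cut n q) <= normc (F q).
Proof.
rewrite /cut ncM normc_real; have := normc_ge0 (F q).
by case: (chi01 n q) => ->; rewrite ?normr0 ?normr1 ?mulr0 ?mulr1.
Qed.

Let tail n := Rintegral mu setT (fun q => normc (F q - cut n q) ^+ 2).

Let tail_le n q : normc (F q - cut n q) ^+ 2 <= normc (F q) ^+ 2.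
Proof.
rewrite lerXn2r ?nnegrE ?normc_ge0// /cut -{1}[F q]mulr1 -mulrBr ncM.
case: (chi01 n q) => ->; first by rewrite subr0 ComplexField.Normc.normc1 mulr1.
by rewrite subrr ComplexField.Normc.normc0 mulr0 normc_ge0.
Qed.

Let itail n : mu.-integrable setT (EFin \o (fun q => normc (F q - cut n q) ^+ 2)).
Proof.
apply: ge0_le_integrable (tail_le n) iF => [|q]; last exact: sqr_ge0.
by apply: measurable_sqr_normc; apply: cmeasurableB.
Qed.

Let tail_small (e : R) m : 0 < e -> exists2 n, (m <= n)%N & tail n <= e.
Proof.
move=> e0; pose f n q := (normc (F q - cut n q) ^+ 2)%:E.
have f0 : {ae mu, forall q, setT q -> f n q @[n --> \oo] --> (0%E : \bar R)}.
  apply: aeW => q _; apply: cvg_near_cst; have [k Ak] := A_cover q; exists k => // n /= kn.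
  rewrite /f /cut indicE mem_set; last exact: A_mono Ak.
  by rewrite mulr1 subrr ComplexField.Normc.normc0 expr0n.
have mf n : measurable_fun setT (f n) by exact: measurable_int (itail n).
have dom : {ae mu, forall q n, setT q -> (`|f n q| <= (normc (F q) ^+ 2)%:E)%E}.
  by apply: aeW => q n _; rewrite /f /= lee_fin ger0_norm ?sqr_ge0// tail_le.
have [_ _] := dominated_convergence measurableT mf (measurable_cst _) f0 iF dom.
rewrite integral0 => /fine_cvgP[_ /cvgrPdist_lt /(_ e e0)[n _ H]].
exists (maxn m n); first exact: leq_maxl.
have := H (maxn m n) (leq_maxr _ _); rewrite /= sub0r normrN => /ltW.
exact: le_trans (ler_norm _).
Qed.

(* As [kadj] is bounded, the [kadj (cut n)] form a Cauchy sequence, and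
   [kop (kadj (cut n))], the image of [cut n] under [Theta], converges to [F]. *)
Lemma kop_surjective : exists2 phi, square_integrable nu phi & forall p, kop phi p = F p.
Proof.
(* The rate [8 ^+ k] is the one that [fast_L2_limit] expects; [k <= n] makes the chosen truncations
   exhaust the whole space. *)
have exN k : exists n, (k <= n)%N /\ tail n <= 1 / 8 ^+ k.
  by have [|n ? ?] := @tail_small (1 / 8 ^+ k) k; [rewrite divr_gt0 ?exprn_gt0|exists n].
have [N HN] := choice exN.
pose S k := kadj (cut (N k)).
have diffE k y : S k.+1 y - S k y = kadj (fun q => cut (N k.+1) q - cut (N k) q) y.
  have ik n : cintegrable mu (fun q => cut n q * (kap q y)^*).
    apply: (le_cintegrable _ _ (integrableZl measurableT C (icut1 n))).
    - by apply: cmeasurableM => //; exact: cmeasurableJ.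
    - by move=> q; rewrite ncM normc_conj mulrC ler_wpM2r ?normc_ge0.
  rewrite /S /kadj -cintegralB//; by apply: eq_cintegral => q; rewrite mulrBl.
have mD k : cmeasurable (fun q => cut (N k.+1) q - cut (N k) q) by exact: cmeasurableB.
have D1 k : mu.-integrable setT (EFin \o (fun q => normc (cut (N k.+1) q - cut (N k) q))).
  apply: ge0_le_integrable (integrableD measurableT (icut1 (N k.+1)) (icut1 (N k))).
  - exact: measurable_normc.
  - by move=> q; exact: normc_ge0.
  - by move=> q; rewrite (le_trans (le_normcD _ _))// normcN.
(* After factoring out [F q], only values 0 and 1 of the two indicators are compared. *)
have Dle k q : normc (cut (N k.+1) q - cut (N k) q) ^+ 2 <=
    normc (F q - cut (N k.+1) q) ^+ 2 + normc (F q - cut (N k) q) ^+ 2.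
  rewrite /cut -mulrBr ncM -[X in _ <= normc (X - _) ^+ 2 + _]mulr1 -mulrBr ncM.
  rewrite -[X in _ <= _ + normc (X - _) ^+ 2]mulr1 -mulrBr ncM !exprMn -mulrDr.
  rewrite ler_wpM2l ?sqr_ge0//.
  case: (chi01 (N k.+1) q) => ->; case: (chi01 (N k) q) => ->;
    rewrite ?subrr ?subr0 ?sub0r ?normcN ?ComplexField.Normc.normc0
      ?ComplexField.Normc.normc1 ?expr0n ?expr1n ?addr0 ?add0r//=; lra.
have iD2 k := integrableD measurableT (itail (N k.+1)) (itail (N k)).
have D2 k : mu.-integrable setT
    (EFin \o (fun q => normc (cut (N k.+1) q - cut (N k) q) ^+ 2)).
  apply: ge0_le_integrable (Dle k) (iD2 k) => [|q]; last exact: sqr_ge0.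
  exact: measurable_sqr_normc.
have Sdiff k : (\int[nu]_y (normc (S k.+1 y - S k y) ^+ 2)%:E <= (2 * M / 8 ^+ k)%:E)%E.
  under eq_integral do rewrite diffE.
  have [_ i2] := square_integrable_kadj (mD k) (D1 k).
  rewrite -(fineK (integrable_fin_num measurableT i2)) lee_fin.
  apply: (le_trans (sqnorm_kadj (mD k) (D1 k) (D2 k))).
  have : sqnorm mu (fun q => cut (N k.+1) q - cut (N k) q) <= tail (N k.+1) + tail (N k).
    rewrite /tail -RintegralD//; apply: (le_Rintegral measurableT (D2 k) (iD2 k)) => q _.
    exact: Dle.
  have [_ t1] := HN k.+1; have [_ t2] := HN k.
  have t3 : 1 / 8 ^+ k.+1 <= 1 / 8 ^+ k :> R.
    by rewrite ler_pM2l// lef_pV2 ?posrE ?exprn_gt0// exprS ler_peMl ?exprn_ge0// ler1n.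
  move=> t4; rewrite (_ : 2 * M / 8 ^+ k = M * (1 / 8 ^+ k + 1 / 8 ^+ k)); last by ring.
  by rewrite ler_pM2l//; lra.
have mS k : cmeasurable (S k) by exact: cmeasurable_kadj.
have [S0 S02] := square_integrable_kadj (mcut (N 0%N)) (icut1 (N 0%N)).
have [|E [phi [H [mE aeE iH [HS Hphi] cvS]]]] := fast_L2_limit _ mS S02 Sdiff.
  by rewrite mulr_ge0 ?ltW.
have mSE k : cmeasurable (fun y => S k y * (\1_E y)%:C).
  by apply: cmeasurableM => //; apply: cmeasurable_real; exact: measurable_indic.
have mphi : cmeasurable phi by exact: cvg_cmeasurable mSE cvS.
have phi2 : square_integrable nu phi.
  split => //; apply: ge0_le_integrable Hphi iH => [|y]; last exact: sqr_ge0.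
  exact: measurable_sqr_normc.
exists phi => // p.
pose G y := C / 2 * H y + 2^-1 * normc (kap p y).
have iG : nu.-integrable setT (EFin \o G).
  exact: (integrableD measurableT (integrableZl measurableT (C / 2) iH)
    (integrableZl measurableT 2^-1 (int_kap_fin p))).
have domG (z : R[i]) y : normc z ^+ 2 <= H y -> normc (z * kap p y) <= G y.
  move=> zH; apply: (le_trans (le_kop_integrand (fun=> z) p y)).
  by rewrite lerD2r ler_wpM2l ?divr_ge0.
have cv1 : normc (cintegral nu (fun y => S k y * (\1_E y)%:C * kap p y) - kop phi p)
    @[k --> \oo] --> (0 : R).
  apply: (cvg_cintegral (G := G)) => //.
  - by move=> k; exact: cmeasurableM.
  - exact: cmeasurableM.
  - move=> y; have E1 : (fun k => normc (S k y * (\1_E y)%:C * kap p y - phi y * kap p y)) =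
        (fun k => normc (S k y * (\1_E y)%:C - phi y) * normc (kap p y)).
      by apply/funext => k; rewrite -mulrBl ncM.
    have cM : (fun k => normc (S k y * (\1_E y)%:C - phi y) * normc (kap p y)) @ \oo
        --> 0 * normc (kap p y).
      by apply: cvgM; [exact: cvS|exact: cvg_cst].
    by rewrite E1; rewrite mul0r in cM.
  - by move=> k y; exact: domG.
  - by move=> y; exact: domG.
(* [E] has full measure, so the cutoff does not change the integral. *)
have SE k : cintegral nu (fun y => S k y * (\1_E y)%:C * kap p y) =
    cintegral mu (fun q => cut (N k) q * Theta p q).
  rewrite -(kop_kadj (mcut (N k)) (icut1 (N k))) /kop; apply: ae_eq_cintegral.
  - exact: cmeasurableM.
  - by apply: cmeasurableM; [exact: mS|exact: mkap1].
  - by apply: filterS aeE => y Ey; rewrite indicE mem_set// mulr1.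
have mTh : cmeasurable (Theta p) by exact: (cmeasurable_comp mTheta (pair1_measurable p)).
have cv2 : normc (cintegral mu (fun q => cut (N k) q * Theta p q) - F p)
    @[k --> \oo] --> (0 : R).
  rewrite -F_rep; apply: (cvg_cintegral (G := fun q => normc (F q * Theta p q))) => //.
  - by move=> k; exact: cmeasurableM.
  - exact: cmeasurableM.
  - move=> q; apply: cvg_near_cst; have [m Am] := A_cover q; exists m => // k /= mk.
    rewrite /cut indicE mem_set; last by apply: A_mono Am; exact: leq_trans mk (HN k).1.
    by rewrite mulr1 -mulrBl subrr mul0r ComplexField.Normc.normc0.
  - exact: cintegrable_normc (F_int p).
  - move=> k q; rewrite [leLHS]ncM [leRHS]ncM; apply: ler_wpM2r; first exact: normc_ge0.
    exact: cut_le.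
apply/eqP; rewrite -subr_eq0 -normc_eq0 eq_le normc_ge0 andbT leNgt; apply/negP => c0.
have c2 : 0 < normc (kop phi p - F p) / 2 by rewrite divr_gt0.
have /cvgrPdist_lt/(_ _ c2) h1 := cv1; have /cvgrPdist_lt/(_ _ c2) h2 := cv2.
have [k [/=]] := filter_ex (filterI h1 h2).
rewrite !sub0r !normrN SE !(ger0_norm (normc_ge0 _)); set a := cintegral _ _ => k1 k2.
have : normc (kop phi p - F p) <= normc (a - kop phi p) + normc (a - F p).
  rewrite -(normcN (a - kop phi p)).
  have -> : kop phi p - F p = - (a - kop phi p) + (a - F p) by ring.
  exact: le_normcD.
lra.
Qed.

End Surjectivity.

End KernelOperator.

Section GaussianIntegrals.
Context (R : realType).
Local Notation C := R[i].
Local Notation rT := (measurableTypeR R).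
Local Notation leb := (@lebesgue_measure R).
Local Notation area := (leb \x leb)%E.

Lemma integral_scaled_gauss (k a m : R) : 0 <= k -> 0 < a ->
  (\int[leb]_x (k * expR (- (a * (x - m) ^+ 2)))%:E = (k * Num.sqrt (pi / a))%:E)%E.
Proof.
move=> k0 a0.
have mG : measurable_fun (setT : set rT) (EFin \o (fun x : rT => expR (- (a * (x - m) ^+ 2)))).
  by apply/measurable_EFinP; exact: measurable_gauss.
have -> : (\int[leb]_x (k * expR (- (a * (x - m) ^+ 2)))%:E =
    k%:E * \int[leb]_(x in setT) (EFin \o (fun x : rT => expR (- (a * (x - m) ^+ 2)))%R) x)%E.
  rewrite -(ge0_integralZl _ _ mG)//.
  by move=> x _; rewrite lee_fin expR_ge0.
by rewrite (integral_gauss m a0).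
Qed.

Lemma integral_plane_gauss (k a m m' : R) : 0 < a ->
  (\int[area]_p (k * (expR (- (a * (p.1 - m) ^+ 2)) * expR (- (a * (p.2 - m') ^+ 2))))%:E
   = (k * (pi / a))%:E)%E.
Proof.
move=> a0; pose G (m x : R) := expR (- (a * (x - m) ^+ 2)).
have IG x : leb.-integrable setT (EFin \o G x) by exact: integrable_gauss.
have RG x : Rintegral leb setT (G x) = Num.sqrt (pi / a) by rewrite /Rintegral integral_gauss.
have IT := integrable_tensor (IG m) (IG m').
have IT' : area.-integrable setT (EFin \o (fun q : rT * rT => k * (G m q.1 * G m' q.2))).
  by apply: eq_integrable (integrableZl measurableT k IT).
rewrite -(fineK (integrable_fin_num measurableT IT')).
change ((Rintegral area setT (fun q : rT * rT => k * (G m q.1 * G m' q.2)))%:E = (k * (pi / a))%:E).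
rewrite (RintegralZl k measurableT IT) (Rintegral_tensor (IG _) (IG _)) !RG -expr2.
by rewrite sqr_sqrtr// divr_ge0 ?pi_ge0// ltW.
Qed.

Lemma square_integrable_cgauss (b : C) (a : R) : 0 < a ->
  square_integrable leb (fun x : rT => cexp (b * x%:C - (a * x ^+ 2)%:C)).
Proof.
move=> a0; have [m1 m2] := cintegrable_cmeasurable (cintegrable_gauss b a0).
split; first by split.
have a2 : 0 < 2 * a by rewrite mulr_gt0.
apply: eq_integrable (integrable_gauss_linear (2 * complex.Re b) a2) => // x _ /=.
rewrite normc_cexp -expRM_natl !(ReD, ReN, ReM, Re_real, Im_real).
by congr (expR _)%:E; ring.
Qed.

End GaussianIntegrals.

(** * The Bargmann transform *)

Section BargmannKernel.
Context (R : realType).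
Local Notation C := R[i].
Local Notation rT := (measurableTypeR R).
Local Notation leb := (@lebesgue_measure R).
Local Notation area := (leb \x leb)%E.

Let ncM := @ComplexField.Normc.normcM R.

Definition bconst : R := (2 / pi) `^ (1 / 4).

Lemma bconst_ge0 : 0 <= bconst. Proof. exact: powR_ge0. Qed.

(** [sqrt (pi / 2)] is the factor produced by [gauss_fourier2], so this normalization makes
    [bkap_rep] hold with constant 1. *)
Lemma bconst_sqr : bconst ^+ 2 * Num.sqrt (pi / 2) = 1.
Proof.
rewrite -powR_mulrn ?bconst_ge0// /bconst -powRrM.
have p0 := @pi_gt0 R.
rewrite (_ : 1 / 4 * 2 = 2^-1); last by field.
have q0 : 0 <= 2 / pi :> R by apply: divr_ge0 => //; apply: ltW.
rewrite (powR12_sqrt q0) -(sqrtrM _ q0).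
have -> : 2 / pi * (pi / 2) = 1 :> R by rewrite mulrA divfK ?divff// gt_eqF.
exact: sqrtr1.
Qed.

Definition half_weight (z : C) : R := Num.sqrt pi^-1 * expR (- (normc z ^+ 2 / 2)).

Lemma half_weight_gt0 z : 0 < half_weight z.
Proof. by rewrite mulr_gt0 ?expR_gt0// sqrtr_gt0 invr_gt0 pi_gt0. Qed.

Lemma half_weight_sqr z : half_weight z ^+ 2 = fock_weight z.
Proof.
rewrite /half_weight exprMn sqr_sqrtr ?invr_ge0 ?pi_ge0// -expRM_natl.
by rewrite mulrN mulrCA mulfV ?mulr1.
Qed.

Definition bexp (z : C) (x : R) : C := cexp (2%:R * x%:C * z - (x ^+ 2)%:C - z ^+ 2 / 2%:R).

Definition bkap (p : rT * rT) (x : rT) : C :=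
  bexp (plane p) x * (bconst * half_weight (plane p))%:C.

Definition btheta (p q : rT * rT) : C :=
  cexp (plane p * (plane q)^*) * (half_weight (plane p) * half_weight (plane q))%:C.

Lemma inv2C : (2%:R)^-1 = (2^-1)%:C :> C.
Proof. by rewrite fmorphV rmorph_nat. Qed.

Lemma nat2C : 2%:R = 2%:C :> C.
Proof. by rewrite rmorph_nat. Qed.

(** Completing the square in [x] leaves a growth of [expR (|z|^2 / 2)], exactly the inverse of the
    exponential in [half_weight]. *)
Lemma normc_bexp z x : normc (bexp z x) =
  expR (- (1 * (x - complex.Re z) ^+ 2)) * expR (normc z ^+ 2 / 2).
Proof.
rewrite /bexp normc_cexp -expRD sqr_normcE inv2C nat2C !expr2; congr expR.
by rewrite !(ReD, ReN, ReM, ImM, Re_real, Im_real); field.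
Qed.

Lemma normc_bkap p x : normc (bkap p x) =
  bconst * Num.sqrt pi^-1 * expR (- (1 * (x - p.1) ^+ 2)).
Proof.
rewrite /bkap ncM normc_bexp normc_real ger0_norm; last first.
  by rewrite mulr_ge0 ?bconst_ge0// ltW// half_weight_gt0.
pose e := expR (normc (plane p) ^+ 2 / 2); pose G := expR (- (1 * (x - p.1) ^+ 2)).
have e0 : e != 0 by rewrite gt_eqF// expR_gt0.
transitivity (G * e * (bconst * (Num.sqrt pi^-1 * e^-1))); first by rewrite -expRN.
transitivity (G * (e * e^-1) * (bconst * Num.sqrt pi^-1)); first by ring.
by rewrite divff// mulr1 mulrC.
Qed.

Let kc : R := bconst * Num.sqrt pi^-1.
Let kc0 : 0 <= kc. Proof. by rewrite mulr_ge0 ?bconst_ge0. Qed.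
(** One constant for two bounds: the summand 1 is for the supremum of the Gaussian and [sqrt pi] for
    its integral. *)
Definition bbound : R := kc * (1 + Num.sqrt pi).

Lemma bbound_ge0 : 0 <= bbound.
Proof. by rewrite mulr_ge0// addr_ge0. Qed.

Lemma bkap_le p x : normc (bkap p x) <= bbound.
Proof.
rewrite normc_bkap /bbound ler_wpM2l// (@le_trans _ _ 1) ?lerDl//.
by rewrite expR_le1 oppr_le0 mul1r sqr_ge0.
Qed.

Lemma int_bkap p : (\int[leb]_x (normc (bkap p x))%:E <= bbound%:E)%E.
Proof.
under eq_integral do rewrite normc_bkap.
by rewrite integral_scaled_gauss// divr1 lee_fin /bbound ler_wpM2l// lerDr.
Qed.

Lemma cmeasurable_planef : cmeasurable (fun p : rT * rT => plane p).
Proof. by split; [exact: measurable_fst|exact: measurable_snd]. Qed.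

Lemma measurable_half_weight :
  measurable_fun (setT : set (rT * rT)) (fun p => half_weight (plane p)).
Proof.
apply: measurable_funM => //; apply: measurableT_comp => //; apply: measurableT_comp => //.
by apply: measurable_funM => //; apply: measurable_sqr_normc; exact: cmeasurable_planef.
Qed.

Lemma cmeasurable_bexp (d : measure_display) (T : measurableType d) (f : T -> C) (g : T -> rT) :
  cmeasurable f -> measurable_fun setT g -> cmeasurable (fun t => bexp (f t) (g t)).
Proof.
move=> mf mg; apply: cmeasurable_cexp.
have mg1 : cmeasurable (fun t => (g t)%:C) by exact: cmeasurable_real.
apply: cmeasurableB; first apply: cmeasurableB.
- by do 2 (apply: cmeasurableM => //); exact: cmeasurable_cst.
- by apply: cmeasurable_real; exact: measurable_funX.
- apply: cmeasurableM; last exact: cmeasurable_cst.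
  by under eq_fun do rewrite expr2; exact: cmeasurableM.
Qed.

Lemma cmeasurable_bkap : cmeasurable (fun q : (rT * rT) * rT => bkap q.1 q.2).
Proof.
apply: cmeasurableM.
  apply: cmeasurable_bexp => //.
  exact: (cmeasurable_comp cmeasurable_planef measurable_fst).
apply: cmeasurable_real; apply: measurable_funM => //.
exact: (measurableT_comp measurable_half_weight measurable_fst).
Qed.

Lemma cmeasurable_btheta : cmeasurable (fun q : (rT * rT) * (rT * rT) => btheta q.1 q.2).
Proof.
apply: cmeasurableM; last first.
  apply: cmeasurable_real; apply: measurable_funM.
    exact: (measurableT_comp measurable_half_weight measurable_fst).
  exact: (measurableT_comp measurable_half_weight measurable_snd).
apply: cmeasurable_cexp; apply: cmeasurableM.
  exact: (cmeasurable_comp cmeasurable_planef measurable_fst).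
exact: (cmeasurable_comp (cmeasurableJ cmeasurable_planef) measurable_snd).
Qed.

(** The product is a Gaussian in [x] with linear coefficient [2 (z + conj w)]. Its integral
    contributes [(z + conj w)^2 / 2] to the exponent, and the squares cancel against those of [E0],
    leaving [z * conj w]. *)
Lemma bkap_rep p q :
  cintegral leb (fun x => bkap p x * (bkap q x)^*) = btheta p q.
Proof.
pose z := plane p; pose w := plane q.
pose E0 : C := - (z ^+ 2 / 2%:R) - (w^*) ^+ 2 / 2%:R.
pose a : C := (bconst * half_weight z)%:C; pose b : C := (bconst * half_weight w)%:C.
have E (x : R) : bkap p x * (bkap q x)^* =
    (cexp E0 * (a * b)) * cexp (2%:R * (z + w^*) * x%:C - (2 * x ^+ 2)%:C).
  pose e1 : C := 2%:R * x%:C * z - (x ^+ 2)%:C - z ^+ 2 / 2%:R.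
  pose e2 : C := 2%:R * x%:C * w - (x ^+ 2)%:C - w ^+ 2 / 2%:R.
  have h1 : bkap p x * (bkap q x)^* = (cexp e1 * a) * (cexp e2^* * b).
    rewrite -conj_cexp; apply: (congr1 (fun y => bkap p x * y)).
    transitivity (conjc (cexp e2) * conjc b); first exact: (rmorphM (@conjc R)).
    by rewrite /b conjc_real.
  have h2 : e1 + e2^* = E0 + (2%:R * (z + w^*) * x%:C - (2 * x ^+ 2)%:C).
    rewrite /e1 /e2 /E0 inv2C nat2C !expr2.
    by apply: complex_eq; rewrite !(ReD, ImD, ReN, ImN, ReJ, ImJ, ReM, ImM, Re_real, Im_real); ring.
  by rewrite h1 mulrACA -cexpD h2 cexpD mulrAC.
rewrite (eq_cintegral leb E).
rewrite cintegralZl; last exact: (cintegrable_gauss (2%:R * (z + w^*)) (ltr0n _ 2)).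
rewrite gauss_fourier2.
have h3 : a * b * (Num.sqrt (pi / 2))%:C = (half_weight z * half_weight w)%:C.
  rewrite /a /b -!rmorphM; congr _%:C.
  by rewrite mulrACA -expr2 mulrAC bconst_sqr mul1r.
rewrite -mulrA [_ * (_ * cexp _)]mulrA h3 mulrCA -cexpD mulrC; congr (cexp _ * _).
rewrite /E0 inv2C !expr2 -/z -/w.
by apply: complex_eq; rewrite !(ReD, ImD, ReN, ImN, ReJ, ImJ, ReM, ImM, Re_real, Im_real); field.
Qed.

(** The real part of [z * conj w], minus [|z|^2 / 2] and [|w|^2 / 2], is [- |z - w|^2 / 2]. *)
Lemma normc_btheta p q : normc (btheta p q) =
  pi^-1 * (expR (- (2^-1 * (p.1 - q.1) ^+ 2)) * expR (- (2^-1 * (p.2 - q.2) ^+ 2))).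
Proof.
rewrite /btheta ncM normc_real normc_cexp gtr0_norm; last first.
  exact: mulr_gt0 (half_weight_gt0 _) (half_weight_gt0 _).
have -> : half_weight (plane p) * half_weight (plane q) =
    pi^-1 * expR (- (normc (plane p) ^+ 2 / 2) - normc (plane q) ^+ 2 / 2).
  by rewrite /half_weight mulrACA -expRD -expr2 sqr_sqrtr// invr_ge0 pi_ge0.
rewrite mulrCA -!expRD; congr (_ * expR _). 
by rewrite !sqr_normcE ReM ReJ ImJ /=; field.
Qed.

(** The Gaussian of exponent [- |w|^2 / 2] has mass [2 pi] in the plane. This is the origin of the
    value 2 for the Schur constant [M]. *)
Lemma int_btheta1 p : (\int[area]_q (normc (btheta p q))%:E <= 2%:E)%E.
Proof.
have E q : normc (btheta p q) = pi^-1 * (expR (- (2^-1 * (q.1 - p.1) ^+ 2)) *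
    expR (- (2^-1 * (q.2 - p.2) ^+ 2))).
  by rewrite normc_btheta -[_ - q.1]opprB -[_ - q.2]opprB !sqrrN.
under eq_integral do rewrite E.
by rewrite integral_plane_gauss// invrK mulKf// gt_eqF// pi_gt0.
Qed.

Lemma int_btheta2 q : (\int[area]_p (normc (btheta p q))%:E <= 2%:E)%E.
Proof.
have H p : normc (btheta p q) = normc (btheta q p).
  by rewrite !normc_btheta -[_ - q.1]opprB -[_ - q.2]opprB !sqrrN.
by under eq_integral do rewrite H; exact: int_btheta1.
Qed.

End BargmannKernel.

(** * Surjectivity of the Bargmann transform *)

Section BargmannRange.
Context (R : realType).
Local Notation C := R[i].
Local Notation rT := (measurableTypeR R).
Local Notation leb := (@lebesgue_measure R).
Local Notation area := (leb \x leb)%E.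

Let ncM := @ComplexField.Normc.normcM R.

Lemma L2P (phi : R -> C) : L2 phi <-> square_integrable leb (phi : rT -> C).
Proof.
have sq0 x : (0 <= (normc (phi x) ^+ 2)%:E)%E by rewrite lee_fin sqr_ge0.
split=> [[mphi phioo]|[mphi /integrableP[_ phioo]]]; split => //.
  apply: ge0_integrable phioo; last by move=> x; exact: sqr_ge0.
  exact: (@measurable_sqr_normc _ rT).
apply: le_lt_trans phioo; rewrite le_eqVlt; apply/orP; left; apply/eqP.
by apply: eq_integral => x _; exact: esym (gee0_abs (sq0 x)).
Qed.

Lemma bconst_gt0 : 0 < bconst R.
Proof. by apply: powR_gt0; apply: divr_gt0 => //; exact: pi_gt0. Qed.

Lemma bkap_factor_neq0 (z : C) : (bconst R * half_weight z)%:C != 0 :> C.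
Proof.
rewrite -(rmorph0 (real_complex R)) (inj_eq (@complexI R)) gt_eqF//.
by apply: mulr_gt0; [exact: bconst_gt0|exact: half_weight_gt0].
Qed.

Lemma half_weight_neq0 (z : C) : (half_weight z)%:C != 0 :> C.
Proof.
rewrite -(rmorph0 (real_complex R)) (inj_eq (@complexI R)) gt_eqF//.
exact: half_weight_gt0.
Qed.

Lemma planeE (z : C) : plane (complex.Re z, complex.Im z) = z.
Proof. by case: z. Qed.

Lemma cintegrable_bexp (phi : rT -> C) (z : C) : square_integrable leb phi ->
  cintegrable leb (fun x => phi x * bexp z x).
Proof.
move=> phi2; pose p : rT * rT := (complex.Re z, complex.Im z).
have := cintegrableZl (bconst R * half_weight z)%:C^-1
  (cintegrable_kop (@cmeasurable_bkap R) (@bkap_le R) (@int_bkap R) phi2 p).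
apply: eq_cintegrable => x; rewrite /bkap planeE (mulrC (bexp z x)) (mulrCA (phi x)) mulKf//.
exact: bkap_factor_neq0.
Qed.

Lemma kop_bargmann (phi : rT -> C) p : square_integrable leb phi ->
  kop leb (@bkap R) phi p = bargmann phi (plane p) * (half_weight (plane p))%:C.
Proof.
move=> phi2; rewrite /kop /bargmann -/(bconst R).
transitivity (cintegral leb (fun x : rT => (bconst R * half_weight (plane p))%:C *
   (phi x * bexp (plane p) x))).
  by apply: eq_cintegral => x; rewrite /bkap mulrA mulrC.
rewrite cintegralZl; last exact: cintegrable_bexp.
by rewrite rmorphM mulrAC.
Qed.

Lemma box_finite (t : R) : 0 < t -> (area (box t) < +oo)%E.
Proof. by move=> t0; rewrite /box area_seg ?ltry// mulr_gt0. Qed.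

Lemma sigma_finite_area : sigma_finite setT area.
Proof.
exists (fun n => box n.+1%:R).
  by apply/seteqP; split=> // p _; have [n np] := box_cover p; exists n.
by move=> n; split; [exact: measurable_box|exact: box_finite].
Qed.

(* The library's canonical sigma-finite structure on product measures is the one for
   subprobabilities, which shadows the general one. *)
Definition area_measure : {sigma_finite_measure set (rT * rT)%type -> \bar R} :=
  HB.pack_for {sigma_finite_measure set (rT * rT)%type -> \bar R} area
    (@Measure_isSigmaFinite.Build _ (rT * rT)%type R area sigma_finite_area).

Lemma square_integrable_F2 (f : C -> C) : F2 f ->
  square_integrable area (fun p => f (plane p) * (half_weight (plane p))%:C).
Proof.
move=> [ef foo]; split.
  apply: cmeasurableM; first exact: cmeasurable_plane (entire_ccontinuous ef).
  by apply: cmeasurable_real; exact: measurable_half_weight.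
have FE p : normc (f (plane p) * (half_weight (plane p))%:C) ^+ 2 =
    normc (f (plane p)) ^+ 2 * fock_weight (plane p).
  by rewrite ncM normc_real exprMn real_normK ?num_real// half_weight_sqr.
apply: ge0_integrable; last by under eq_integral do rewrite FE.
  apply: measurable_sqr_normc; apply: cmeasurableM.
    exact: cmeasurable_plane (entire_ccontinuous ef).
  by apply: cmeasurable_real; exact: measurable_half_weight.
by move=> p; exact: sqr_ge0.
Qed.

(** Multiplied by [half_weight], the reproducing formula says that [F] is fixed by the kernel
    [btheta], which is the hypothesis [F_rep] of [kop_surjective]. The weight vanishes nowhere and
    is divided out at the end. *)
Lemma bargmann_surjective (f : C -> C) : F2 f ->
  exists phi, L2 phi /\ bargmann phi = f.
Proof.
move=> F2f; pose F (p : rT * rT) : C := f (plane p) * (half_weight (plane p))%:C.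
have F_sqr : square_integrable area F := square_integrable_F2 F2f.
have E p q : F q * btheta p q = (half_weight (plane p))%:C *
    (f (plane q) * cexp (plane p * (plane q)^*) * (fock_weight (plane q))%:C).
  rewrite /F /btheta -half_weight_sqr.
  move: (f _) (cexp _) (half_weight (plane p)) (half_weight (plane q)) => u v a b.
  by rewrite rmorphXn rmorphM; ring.
have F_int p : cintegrable area (fun q => F q * btheta p q).
  have [i1 _] := fock_reproducing (plane p) F2f.
  by apply: eq_cintegrable (cintegrableZl (half_weight (plane p))%:C i1) => q; rewrite E.
have F_rep p : cintegral area (fun q => F q * btheta p q) = F p.
  have [i1 i2] := fock_reproducing (plane p) F2f.
  rewrite (eq_cintegral _ (E p)) cintegralZl// mulrC.
  exact: (congr1 (fun y => y * (half_weight (plane p))%:C) i2).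
have [phi phi2 kF] := kop_surjective (bbound_ge0 R) (ltr0n R 2) (@cmeasurable_bkap R)
  (@bkap_le R) (@int_bkap R) (@bkap_rep R) (mu := area_measure) (@cmeasurable_btheta R)
  (@int_btheta1 R) (@int_btheta2 R) (fun n => measurable_box n.+1%:R)
  (fun n => box_finite (ltr0Sn R n)) (@box_mono R) (@box_cover R) F_sqr F_int F_rep.
exists phi; split; first exact/L2P.
apply/funext => z; have := kF (complex.Re z, complex.Im z).
rewrite kop_bargmann// /F planeE => e.
exact: (mulIf (half_weight_neq0 z) e).
Qed.

Lemma bargmann_invP (f : C -> C) : F2 f ->
  L2 (bargmann_inv f) /\ bargmann (bargmann_inv f) = f.
Proof.
move=> /bargmann_surjective [phi phiP].
by have := xgetPex (fun=> 0) (ex_intro [set phi | L2 phi /\ bargmann phi = f] phi phiP).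
Qed.

End BargmannRange.

(** * Differentiation of the Bargmann transform under the integral sign *)

Section BargmannEntire.
Context (R : realType).
Local Notation C := R[i].
Local Notation rT := (measurableTypeR R).
Local Notation leb := (@lebesgue_measure R).
Local Notation area := (leb \x leb)%E.

Let ncM := @ComplexField.Normc.normcM R.

(** A majorant of [expR (2 m) * |bexp z x|] with [m = 2 |x| + |z| + 1]. The sum of two exponentials
    stands in for [expR (4 |x|)], so that its square is still dominated by Gaussians with linear
    terms. *)
Definition bgrowth (z : C) (x : R) : R :=
  (expR (4 * x) + expR (- 4 * x)) * expR (2 * normc z + 2) * normc (bexp z x).

Lemma expR_norm_le (x : R) : expR (4 * `|x|) <= expR (4 * x) + expR (- 4 * x).
Proof.
case: (ger0P x) => _; first by rewrite lerDl expR_ge0.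
by rewrite mulrN -mulNr lerDr expR_ge0.
Qed.

Lemma bgrowth_ge (z : C) (x : R) :
  expR (2 * (2 * `|x| + normc z + 1)) * normc (bexp z x) <= bgrowth z x.
Proof.
rewrite ler_wpM2r ?normc_ge0//.
have -> : 2 * (2 * `|x| + normc z + 1) = 4 * `|x| + (2 * normc z + 2) by ring.
by rewrite expRD ler_wpM2r ?expR_ge0// expR_norm_le.
Qed.

Lemma normc_slope (z : C) (x : R) : normc (2%:R * x%:C - z) <= 2 * `|x| + normc z.
Proof.
rewrite (le_trans (le_normcD _ _))// normcN lerD2r ncM normc_real nat2C normc_real.
by rewrite ger0_norm.
Qed.

Lemma slope_bexp_le (z : C) (x : R) :
  normc ((2%:R * x%:C - z) * bexp z x) <= bgrowth z x.
Proof.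
rewrite ncM; apply: le_trans (bgrowth_ge z x); rewrite ler_wpM2r ?normc_ge0//.
apply: (le_trans (normc_slope z x)).
have n0 := normc_ge0 z; have x0 := normr_ge0 x.
have := expR_ge1Dx (2 * (2 * `|x| + normc z + 1)); lra.
Qed.

(** The exponent changes by [eta = (2 x - z) h - h^2 / 2], with [|eta| <= |h| m]. The remainder of
    [cexp] at [eta] costs at most [5 * 2] times [|h|^2 * expR (2 m)], and the term [h^2 / 2] fits
    into the rest of the constant 12. *)
Lemma bexp_taylor (z h : C) (x : R) : normc h <= 1 ->
  normc (bexp (z + h) x - bexp z x - (2%:R * x%:C - z) * bexp z x * h) <=
  12 * normc h ^+ 2 * bgrowth z x.
Proof.
move=> h1; pose t : C := 2%:R * x%:C - z; pose eta : C := t * h - h ^+ 2 / 2%:R.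
have E1 : bexp (z + h) x = bexp z x * cexp eta.
  by rewrite /bexp -cexpD; congr cexp; rewrite /eta /t; field.
have -> : bexp (z + h) x - bexp z x - t * bexp z x * h =
    bexp z x * ((cexp eta - 1 - eta) - h ^+ 2 / 2%:R).
  by rewrite E1 /eta; ring.
set m : R := 2 * `|x| + normc z + 1.
have n0 := normc_ge0 z; have x0 := normr_ge0 x; have h0 := normc_ge0 h.
have hh : normc (h ^+ 2 / 2%:R) = normc h ^+ 2 / 2.
  by rewrite ncM normcX inv2C normc_real ger0_norm.
have em : normc eta <= normc h * m.
  rewrite (le_trans (le_normcD _ _))// normcN hh ncM.
  have h2 : normc h ^+ 2 <= normc h by rewrite expr2 ler_piMl.
  have := ler_wpM2r h0 (normc_slope z x); rewrite -/t /m.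
  by rewrite mulrDr mulr1 (mulrC (normc h) (_ + _)); lra.
have em1 : normc eta <= m by rewrite (le_trans em)// ler_piMl// /m; lra.
have m2 : m ^+ 2 <= 2 * expR m.
  have m0 : 0 <= m by rewrite /m; lra.
  have := expR_ge1Dxn 1 m0; rewrite (_ : (2`!)%N = 2%N)//; lra.
have e0 := normc_ge0 eta.
have eE : expR (normc eta) <= expR m by rewrite ler_expR.
have E2 : 1 <= expR m by have := expR_ge1Dx m; rewrite /m; lra.
have EE : expR (2 * m) = expR m * expR m by rewrite -expRD; congr expR; ring.
rewrite ncM mulrC; apply: le_trans (_ : 12 * normc h ^+ 2 * (expR (2 * m) * normc (bexp z x)) <= _).
  rewrite mulrA ler_wpM2r ?normc_ge0//.
  rewrite (le_trans (le_normcD _ _))// normcN hh.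
  apply: (le_trans (lerD (normc_cexp_sub eta) (lexx _))).
  have s1 : normc eta ^+ 2 <= normc h ^+ 2 * (2 * expR m).
    rewrite (@le_trans _ _ (normc h ^+ 2 * m ^+ 2))//; last by rewrite ler_wpM2l ?sqr_ge0.
    by rewrite -exprMn ler_pXn2r// nnegrE mulr_ge0// /m; lra.
  have s2 : normc eta ^+ 2 * expR (normc eta) <= normc h ^+ 2 * (2 * expR m) * expR m.
    by rewrite ler_pM ?sqr_ge0 ?expR_ge0.
  have s3 : normc h ^+ 2 * 1 <= normc h ^+ 2 * (expR m * expR m).
    by rewrite ler_wpM2l ?sqr_ge0//; nra.
  have -> : 5 * normc eta ^+ 2 * expR (normc eta) = 5 * (normc eta ^+ 2 * expR (normc eta)).
    by rewrite mulrA.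
  have -> : 12 * normc h ^+ 2 * expR (2 * m) = 12 * (normc h ^+ 2 * (expR m * expR m)).
    by rewrite EE mulrA.
  have s4 : normc h ^+ 2 * (2 * expR m) * expR m = 2 * (normc h ^+ 2 * (expR m * expR m)) by ring.
  rewrite s4 in s2; rewrite mulr1 in s3.
  have y0 : 0 <= normc h ^+ 2 * (expR m * expR m) by rewrite mulr_ge0 ?sqr_ge0// -expr2 sqr_ge0.
  move: (normc h ^+ 2 * (expR m * expR m)) (normc eta ^+ 2 * expR (normc eta)) s2 s3 y0
    => y w; lra.
by rewrite ler_wpM2l ?bgrowth_ge// mulr_ge0// sqr_ge0.
Qed.

Lemma measurable_bgrowth (z : C) : measurable_fun (setT : set rT) (bgrowth z).
Proof.
apply: measurable_funM.
  apply: measurable_funM; last exact: measurable_cst.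
  by apply: measurable_funD; apply: measurableT_comp => //; apply: measurable_funM.
apply: measurable_normc; apply: cmeasurable_bexp => //; exact: cmeasurable_cst.
Qed.

Lemma square_integrable_bgrowth (z : C) :
  square_integrable leb (fun x : rT => (bgrowth z x)%:C).
Proof.
pose a := complex.Re z.
pose k := expR (2 * normc z + 2) ^+ 2 * expR (normc z ^+ 2) * expR (- 2 * a ^+ 2).
split; first by apply: cmeasurable_real; exact: measurable_bgrowth.
have i b : leb.-integrable setT (EFin \o (fun x : rT => 2 * k * expR (b * x - 2 * x ^+ 2))).
  exact: (integrableZl measurableT (2 * k) (integrable_gauss_linear b (ltr0n R 2))).
(* The linear coefficients are those of [expR (4 x) ^+ 2] and [expR (- 4 x) ^+ 2], shifted by the
   [4 a] that comes from expanding [- 2 (x - a)^2]; the square of the sum costs a factor 2. *)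
apply: ge0_le_integrable (integrableD measurableT (i (8 + 4 * a)) (i (- 8 + 4 * a))).
- by apply: measurable_sqr_normc; apply: cmeasurable_real; exact: measurable_bgrowth.
- by move=> x; exact: sqr_ge0.
move=> x; rewrite normc_real real_normK ?num_real//.
have -> : bgrowth z x ^+ 2 = (expR (4 * x) + expR (- 4 * x)) ^+ 2 *
    (expR (2 * normc z + 2) ^+ 2 * expR (normc z ^+ 2) * expR (- (2 * (x - a) ^+ 2))).
  have nb : normc (bexp z x) ^+ 2 = expR (normc z ^+ 2) * expR (- (2 * (x - a) ^+ 2)).
    by rewrite normc_bexp exprMn -!expRM_natl -!expRD -/a; congr expR; field.
  by rewrite /bgrowth !exprMn nb !mulrA.
have e0 : 0 <= expR (2 * normc z + 2) ^+ 2 * expR (normc z ^+ 2) by rewrite mulr_ge0 ?sqr_ge0 ?expR_ge0.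
have -> : expR (- (2 * (x - a) ^+ 2)) = expR (- 2 * a ^+ 2) * expR (4 * a * x - 2 * x ^+ 2).
  by rewrite -expRD; congr expR; ring.
rewrite [X in _ * X]mulrA -/k.
have k0 : 0 <= k by rewrite /k mulr_ge0 ?expR_ge0.
have -> : expR ((8 + 4 * a) * x - 2 * x ^+ 2) = expR (4 * x) ^+ 2 * expR (4 * a * x - 2 * x ^+ 2).
  by rewrite -expRM_natl -expRD; congr expR; ring.
have -> : expR ((- 8 + 4 * a) * x - 2 * x ^+ 2) = expR (- 4 * x) ^+ 2 * expR (4 * a * x - 2 * x ^+ 2).
  by rewrite -expRM_natl -expRD; congr expR; ring.
move: (expR (4 * x)) (expR (- 4 * x)) (expR (4 * a * x - 2 * x ^+ 2))
  (expR_ge0 (4 * a * x - 2 * x ^+ 2)) => u v w w0.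
have -> : 2 * k * (u ^+ 2 * w) + 2 * k * (v ^+ 2 * w) = 2 * (u ^+ 2 + v ^+ 2) * (k * w) by ring.
rewrite ler_wpM2r ?mulr_ge0// -subr_ge0.
have -> : 2 * (u ^+ 2 + v ^+ 2) - (u + v) ^+ 2 = (u - v) ^+ 2 by ring.
exact: sqr_ge0.
Qed.

Lemma integrable_bgrowth (phi : rT -> C) (z : C) : square_integrable leb phi ->
  leb.-integrable setT (EFin \o (fun x : rT => normc (phi x) * bgrowth z x)).
Proof.
move=> phi2; have := cintegrable_normc (cintegrableM_sqr phi2 (square_integrable_bgrowth z)).
apply: eq_integrable => // x _; rewrite /= ncM normc_real ger0_norm//.
by rewrite !mulr_ge0 ?normc_ge0 ?addr_ge0 ?expR_ge0.
Qed.

Lemma wdiff_bargmann (phi : rT -> C) (z : C) : square_integrable leb phi ->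
  exists A, wdiff (bargmann phi) z A 0.
Proof.
move=> phi2; have mphi := phi2.1; have iG := integrable_bgrowth z phi2.
pose N := Rintegral leb setT (fun x : rT => normc (phi x) * bgrowth z x).
have bg0 x : 0 <= bgrowth z x.
  by rewrite !mulr_ge0 ?normc_ge0 ?addr_ge0 ?expR_ge0.
have N0 : 0 <= N by apply: Rintegral_ge0 => x _; rewrite mulr_ge0 ?normc_ge0.
pose D (x : rT) : C := phi x * ((2%:R * x%:C - z) * bexp z x).
have mbe w : cmeasurable (fun x : rT => bexp w x).
  by apply: cmeasurable_bexp => //; exact: cmeasurable_cst.
have mD : cmeasurable D.
  apply: cmeasurableM => //; apply: cmeasurableM => //.
  apply: cmeasurableB; last exact: cmeasurable_cst.
  by apply: cmeasurableM; [exact: cmeasurable_cst|exact: cmeasurable_real].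
have iD : cintegrable leb D.
  apply: (le_cintegrable mD _ iG) => x.
  by rewrite ncM ler_wpM2l ?normc_ge0// slope_bexp_le.
pose b : C := (bconst R)%:C.
exists (b * cintegral leb D) => e e0.
(* The remainder is at most [(K - 1) * |h|^2]; the added 1 keeps the divisor positive when
   [N = 0]. *)
pose K := bconst R * (12 * N) + 1.
have K0 : 0 < K by rewrite ltr_pwDr// !mulr_ge0// ltW// bconst_gt0.
exists (Num.min 1 (e / K)) => [|h]; first by rewrite lt_min ltr01 divr_gt0.
rewrite lt_min => /andP[h1 hK]; rewrite mul0r subr0.
have ib w := cintegrable_bexp w phi2.
have hB w : bargmann phi w = b * cintegral leb (fun x => phi x * bexp w x) by [].
have -> : bargmann phi (z + h) - bargmann phi z - b * cintegral leb D * h =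
    b * cintegral leb (fun x => (phi x * bexp (z + h) x - phi x * bexp z x) - h * D x).
  rewrite cintegralB; [|exact: cintegrableB|exact: cintegrableZl].
  rewrite cintegralB// cintegralZl// !hB.
  by move: (cintegral _ _) (cintegral _ _) (cintegral _ _) => I1 I2 I3; ring.
rewrite ncM normc_real ger0_norm ?bconst_ge0//.
have le1 : normc (cintegral leb (fun x => (phi x * bexp (z + h) x - phi x * bexp z x) - h * D x))
    <= 12 * normc h ^+ 2 * N.
  rewrite /N -RintegralZl//; apply: normc_cintegral_le.
  - by apply: cmeasurableB; [apply: cmeasurableB; exact: cmeasurableM|
      apply: cmeasurableM => //; exact: cmeasurable_cst].
  - move=> x; have -> : phi x * bexp (z + h) x - phi x * bexp z x - h * D x =
      phi x * (bexp (z + h) x - bexp z x - (2%:R * x%:C - z) * bexp z x * h).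
      by rewrite /D; ring.
    rewrite ncM [leRHS]mulrCA; apply: ler_wpM2l; first exact: normc_ge0.
    by apply: bexp_taylor; rewrite ltW.
  - exact: (integrableZl measurableT (12 * normc h ^+ 2) iG).
apply: (le_trans (ler_wpM2l (bconst_ge0 R) le1)).
have -> : bconst R * (12 * normc h ^+ 2 * N) = (bconst R * (12 * N)) * normc h * normc h by ring.
rewrite ler_wpM2r ?normc_ge0//.
have : K * normc h <= e by rewrite mulrC -ler_pdivlMr// ltW.
by apply: le_trans; rewrite ler_wpM2r ?normc_ge0// /K lerDl.
Qed.

End BargmannEntire.

Section BargmannF2.
Context (R : realType).
Local Notation C := R[i].
Local Notation rT := (measurableTypeR R).
Local Notation leb := (@lebesgue_measure R).
Local Notation area := (leb \x leb)%E.

Let ncM := @ComplexField.Normc.normcM R.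

(** On each box [sqnorm_kop_on] gives a bound that does not depend on the box; monotone convergence
    along the growing boxes extends it to the plane. *)
Lemma integral_sqr_bargmann_le (phi : rT -> C) : square_integrable leb phi ->
  (\int[area]_p (normc (bargmann phi (plane p)) ^+ 2 * fock_weight (plane p))%:E
    <= (2 * sqnorm leb phi)%:E)%E.
Proof.
move=> phi2; pose B n : set (rT * rT) := box n.+1%:R.
have mB n : measurable (B n) by exact: measurable_box.
have Boo n : (area_measure R (B n) < +oo)%E := box_finite (ltr0Sn R n).
pose k n (p : rT * rT) := kop_on leb (@bkap R) phi (B n) p.
have k2 n : square_integrable area (k n).
  exact: (square_integrable_kop_on (mu := area_measure R) (bbound_ge0 R)
    (@cmeasurable_bkap R) (@bkap_le R) (@int_bkap R) phi2 (mB n) (Boo n)).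
have kle n : sqnorm area (k n) <= 2 * sqnorm leb phi.
  exact: (sqnorm_kop_on (mu := area_measure R) (bbound_ge0 R) (ltr0n R 2)
    (@cmeasurable_bkap R) (@bkap_le R) (@int_bkap R) (@bkap_rep R)
    (@cmeasurable_btheta R) (@int_btheta1 R) (@int_btheta2 R) phi2 (mB n) (Boo n)).
pose g n p : \bar R := (normc (k n p) ^+ 2)%:E.
have mg n : measurable_fun setT (g n) by exact: measurable_int (k2 n).2.
have g0 n p : setT p -> (0 <= g n p)%E by move=> _; rewrite lee_fin sqr_ge0.
have kE n p : normc (k n p) ^+ 2 = normc (kop leb (@bkap R) phi p) ^+ 2 * (p \in B n)%:R.
  rewrite /k /kop_on ncM exprMn indicE; case: (_ \in _); rewrite normc_real.
    by rewrite normr1 expr1n.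
  by rewrite normr0 expr0n /= mulr0.
have nd p : setT p -> nondecreasing_seq (g^~ p).
  move=> _ m n mn; rewrite lee_fin !kE ler_wpM2l ?sqr_ge0// ler_nat.
  by case: (boolP (p \in B m)) => // /set_mem /(box_mono mn) /mem_set; rewrite /B => ->.
have lg p : limn (g^~ p) = (normc (bargmann phi (plane p)) ^+ 2 * fock_weight (plane p))%:E.
  apply: cvg_lim => //; apply: cvg_near_cst.
  have [N NB] := box_cover p; exists N => // n /= Nn.
  rewrite /g kE mem_set; last exact: box_mono NB.
  by rewrite mulr1 kop_bargmann// ncM normc_real exprMn real_normK ?num_real// half_weight_sqr.
under eq_integral do rewrite -lg.
rewrite monotone_convergence//; apply: lime_le.
  apply: ereal_nondecreasing_is_cvgn => m n mn.
  apply: ge0_le_integral => //.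
  - exact: g0.
  - by move=> p _; exact: (nd p Logic.I m n mn).
apply: nearW => n; have := kle n; rewrite -lee_fin /sqnorm /Rintegral fineK//.
exact: (integrable_fin_num measurableT (k2 n).2).
Qed.

Lemma F2_bargmann (phi : R -> C) : L2 phi -> F2 (bargmann phi).
Proof.
move=> /L2P phi2; split.
  by move=> z; have [A dA] := wdiff_bargmann z phi2; exact: wdiff_derivable dA.
exact: le_lt_trans (integral_sqr_bargmann_le phi2) (ltry _).
Qed.

End BargmannF2.

(** * The operator [T] *)

Section FockFormula.
Context (R : realType).
Local Notation C := R[i].
Local Notation rT := (measurableTypeR R).
Local Notation leb := (@lebesgue_measure R).
Local Notation area := (leb \x leb)%E.

Let ncM := @ComplexField.Normc.normcM R.

Lemma square_integrable_affine (f : rT -> C) (a b : R) : a != 0 ->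
  square_integrable leb f -> square_integrable leb (fun x : rT => f (a * x + b)).
Proof.
move=> a0 [mf f2]; split; first exact: cmeasurable_affine.
exact: (integrable_affine b a0 f2).
Qed.

Lemma square_integrable_bexp (z : C) : square_integrable leb (bexp z : rT -> C).
Proof.
have := square_integrable_cgauss (2%:R * z) ltr01 => -[[m1 m2] i].
have E x : bexp z x = cexp (- (z ^+ 2 / 2%:R)) * cexp (2%:R * z * x%:C - (1 * x ^+ 2)%:C).
  by rewrite -cexpD /bexp mul1r; congr cexp; ring.
split.
  apply: cmeasurable_bexp => //; exact: cmeasurable_cst.
have := integrableZl measurableT (normc (cexp (- (z ^+ 2 / 2%:R))) ^+ 2) i.
by apply: eq_integrable => // x _; rewrite /= E (ncM (cexp _) (cexp _)) exprMn EFinM.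
Qed.

(** Translating the real variable amounts to translating [z] by [s u], up to a factor free of [t].
    This factor is the source of the Gaussian in the kernel of the theorem. *)
Lemma bexp_shift (s : R) (z : C) (t u : R) :
  bexp z (t - s * u) =
  cexp (- (s ^+ 2 / 2 * u ^+ 2)%:C - (s * u)%:C * z) * bexp (z + (s * u)%:C) t.
Proof.
rewrite /bexp -cexpD inv2C nat2C !expr2; congr cexp.
by apply: complex_eq; rewrite !(ReD, ImD, ReN, ImN, ReM, ImM, Re_real, Im_real); field.
Qed.

End FockFormula.

Section WaveletBargmann.
Context (R : realType).
Local Notation C := R[i].
Local Notation rT := (measurableTypeR R).
Local Notation leb := (@lebesgue_measure R).
Local Notation area := (leb \x leb)%E.
Variables (s : R) (g phi : rT -> C) (z : C).
Hypothesis s_neq0 : s != 0.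
Hypothesis g2 : square_integrable leb g.
Hypothesis phi2 : square_integrable leb phi.

Let ncM := @ComplexField.Normc.normcM R.
Let a := complex.Re z.
Let E := expR (normc z ^+ 2 / 2).
Let s2 : 0 < s ^+ 2. Proof. by rewrite exprn_even_gt0. Qed.

Lemma wavelet_argE (x t : R) : s^-1 * (t - x) = s^-1 * t + (- s^-1 * x).
Proof. by rewrite mulrBr mulNr. Qed.

Let g_sh x : square_integrable leb (fun t : rT => g (s^-1 * (t - x))).
Proof.
have sV : s^-1 != 0 by rewrite invr_neq0.
have := square_integrable_affine (- s^-1 * x) sV g2.
by under eq_fun do rewrite -wavelet_argE.
Qed.

Let g_sh' t : square_integrable leb (fun x : rT => g (s^-1 * (t - x))).
Proof.
have sV : - s^-1 != 0 by rewrite oppr_eq0 invr_neq0.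
have := square_integrable_affine (s^-1 * t) sV g2.
by under eq_fun do rewrite addrC -wavelet_argE.
Qed.

Let mb w : cmeasurable (fun x : rT => bexp w x).
Proof. by apply: cmeasurable_bexp => //; exact: cmeasurable_cst. Qed.

(** [2 |phi g| <= |phi|^2 + |g|^2]. Integrated over [t], both squares have bounds that do not depend
    on [x], and [bexp z] is integrable in [x]. *)
Lemma cintegrable_wavelet_bexp :
  cintegrable area (fun p => phi p.2 * g (s^-1 * (p.2 - p.1)) * bexp z p.1).
Proof.
have f0 x : 0 <= normc (bexp z x) by exact: normc_ge0.
have ib : leb.-integrable setT (EFin \o (fun x : rT => normc (bexp z x))).
  apply: eq_integrable (integrableZl measurableT E (integrable_gauss a ltr01)) => // x _ /=.
  by rewrite normc_bexp EFinM muleC.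
have msub : measurable_fun (setT : set (rT * rT)) (fun p => s^-1 * (p.2 - p.1)).
  by apply: measurable_funM => //; apply: measurable_funB.
have mg2 : cmeasurable (fun p : rT * rT => g (s^-1 * (p.2 - p.1))).
  exact: (cmeasurable_comp g2.1 msub).
have mphi : cmeasurable (fun p : rT * rT => phi p.2).
  exact: (cmeasurable_comp phi2.1 measurable_snd).
have [i1 _] := integrable_weight (m := leb) (n := leb) (k := fun _ t => normc (phi t) ^+ 2)
  (measurable_sqr_normc mphi) (fun _ _ => sqr_ge0 _) (sqnorm_ge0 leb phi)
  (fun _ => ltac:(by rewrite /sqnorm /Rintegral fineK//;
    exact: (integrable_fin_num measurableT phi2.2))) f0 ib.
pose c := `|s^-1|^-1 * sqnorm leb g.
have c0 : 0 <= c by rewrite mulr_ge0 ?invr_ge0 ?sqnorm_ge0.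
have kc x : (\int[leb]_t (normc (g (s^-1 * (t - x))) ^+ 2)%:E <= c%:E)%E.
  have sV : s^-1 != 0 by rewrite invr_neq0.
  under eq_integral do rewrite wavelet_argE.
  rewrite (ge0_integral_affineV (- s^-1 * x) sV
    (f := fun u => (normc (g u) ^+ 2)%:E)); last 2 first.
  - exact: measurable_int g2.2.
  - by move=> u; rewrite lee_fin sqr_ge0.
  rewrite /c EFinM /sqnorm /Rintegral fineK//.
  exact: (integrable_fin_num measurableT g2.2).
have [i2 _] := integrable_weight (m := leb) (n := leb)
  (k := fun x t => normc (g (s^-1 * (t - x))) ^+ 2)
  (measurable_sqr_normc mg2) (fun _ _ => sqr_ge0 _) c0 kc f0 ib.
apply: (le_cintegrable _ _ (integrableD measurableT (integrableZl measurableT 2^-1 i1)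
  (integrableZl measurableT 2^-1 i2))).
- apply: cmeasurableM; first exact: cmeasurableM.
  exact: (cmeasurable_comp (mb z) measurable_fst).
- move=> p; rewrite ncM /=.
  have := normc_mul_le (phi p.2) (g (s^-1 * (p.2 - p.1))) ltr01.
  rewrite mul1r mulr1; move: (normc (_ * _)) (normc (bexp _ _)) (f0 p.1) => N b b0.
  move: (normc (phi p.2)) (normc (g (s^-1 * (p.2 - p.1)))) => u v h.
  have -> : 2^-1 * (b * u ^+ 2) + 2^-1 * (b * v ^+ 2) = (2^-1 * u ^+ 2 + 2^-1 * v ^+ 2) * b by ring.
  by rewrite ler_wpM2r.
Qed.

Let cmeasurable_bexp_sub : cmeasurable (fun p : rT * rT => bexp z (p.1 - s * p.2)).
Proof.
apply: cmeasurable_bexp; first exact: cmeasurable_cst.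
by apply: measurable_funB => //; apply: measurable_funM.
Qed.

(** After the substitution [x = t - s u] the kernel is a Gaussian in [t] for fixed [u] and in [u]
    for fixed [t], so Schur's test applies. *)
Lemma cintegrable_bexp_sub :
  cintegrable area (fun p => phi p.1 * g p.2 * bexp z (p.1 - s * p.2)).
Proof.
have E0 : 0 <= E by exact: expR_ge0.
(* The two summands are the masses in [u], with variance scaled by [s], and in [t]. *)
pose c := E * (Num.sqrt (pi / s ^+ 2) + Num.sqrt (pi / 1)).
have c0 : 0 <= c by rewrite mulr_ge0// addr_ge0.
apply: (schur_test (c := c) (k := fun t u : rT => bexp z (t - s * u)) _ _ _ _ _ _).1 => //.
- move=> t; have -> : (\int[leb]_u (normc (bexp z (t - s * u)))%:E =
      \int[leb]_u (E * expR (- (s ^+ 2 * (u - (t - a) / s) ^+ 2)))%:E)%E.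
    apply: eq_integral => u _; rewrite normc_bexp mulrC -/E -/a; congr (_ * expR _)%:E.
    by field.
  by rewrite integral_scaled_gauss// lee_fin ler_wpM2l// lerDl.
- move=> u; have -> : (\int[leb]_t (normc (bexp z (t - s * u)))%:E =
      \int[leb]_t (E * expR (- (1 * (t - (s * u + a)) ^+ 2)))%:E)%E.
    apply: eq_integral => t _; rewrite normc_bexp mulrC -/E -/a; congr (_ * expR _)%:E.
    by ring.
  by rewrite integral_scaled_gauss// lee_fin ler_wpM2l// lerDr.
Qed.

Let gauss0 (u : R) : C := cexp (- (s ^+ 2 / 2 * u ^+ 2)%:C - (s * u)%:C * z).

Lemma bargmann_wavelet : bargmann (wavelet s g phi) z =
  ((Num.sqrt (`|s| * pi))^-1 * `|s|)%:C *
  cintegral leb (fun u : rT => g u * gauss0 u * bargmann phi (z + (s * u)%:C)).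
Proof.
pose b : C := (bconst R)%:C; pose nu : C := (Num.sqrt (`|s| * pi))^-1%:C.
pose H1 (p : rT * rT) := phi p.2 * g (s^-1 * (p.2 - p.1)) * bexp z p.1.
pose H2 (p : rT * rT) := phi p.1 * g p.2 * bexp z (p.1 - s * p.2).
have i1 : cintegrable area H1 := cintegrable_wavelet_bexp.
have i2 : cintegrable area H2 := cintegrable_bexp_sub.
have ix x : cintegrable leb (fun t : rT => phi t * g (s^-1 * (t - x))).
  exact: cintegrableM_sqr phi2 (g_sh x).
have ix1 x : cintegrable leb (fun t : rT => H1 (x, t)).
  by apply: eq_cintegrable (cintegrableZl (bexp z x) (ix x)) => t; rewrite mulrC.
have it t : cintegrable leb (fun x : rT => g (s^-1 * (t - x)) * bexp z x).
  exact: cintegrableM_sqr (g_sh' t) (square_integrable_bexp z).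
have ns0 : - s != 0 by rewrite oppr_eq0.
have shE (t u : R) : s^-1 * (t - (- s * u + t)) = u.
  by rewrite mulNr opprD opprK addrCA subrr addr0 mulKf.
have it2 t : cintegrable leb (fun u : rT => g u * bexp z (t - s * u)).
  apply: eq_cintegrable (cintegrable_affine t ns0 (it t)) => u.
  by rewrite shE mulNr addrC.
(* The substitution [x = t - s u] at fixed [t], with Jacobian [|s|]. *)
have inner t : cintegral leb (fun x : rT => H1 (x, t)) =
    `|s|%:C * cintegral leb (fun u : rT => H2 (t, u)).
  transitivity (phi t * cintegral leb (fun x : rT => g (s^-1 * (t - x)) * bexp z x)).
    by rewrite -cintegralZl//; apply: eq_cintegral => x; rewrite /H1 /= mulrA.
  rewrite (cintegral_affine t ns0 (it t)) normrN mulrCA; congr (_ * _).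
  transitivity (phi t * cintegral leb (fun u : rT => g u * bexp z (t - s * u))).
    congr (_ * _); apply: eq_cintegral => u.
    by rewrite shE mulNr addrC.
  by rewrite -cintegralZl//; apply: eq_cintegral => u; rewrite /H2 /= mulrA.
have iu (u : rT) : cintegrable leb (fun t : rT => phi t * bexp (z + (s * u)%:C) t).
  exact: cintegrable_bexp.
have H2E t u : H2 (t, u) = (g u * gauss0 u) * (phi t * bexp (z + (s * u)%:C) t).
  by rewrite /H2 /= bexp_shift -/(gauss0 u); ring.
have iu2 u : cintegrable leb (fun t : rT => H2 (t, u)).
  by apply: eq_cintegrable (cintegrableZl (g u * gauss0 u) (iu u)) => t; rewrite H2E.
have S1 : cintegral leb (fun x : rT => wavelet s g phi x * bexp z x) =
    nu * cintegral leb (fun x => cintegral leb (fun t : rT => H1 (x, t))).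
  rewrite -cintegralZl; last exact: cintegrable_fubini1.
  apply: eq_cintegral => x; rewrite /wavelet -/nu -mulrA; congr (_ * _).
  by rewrite mulrC -cintegralZl//; apply: eq_cintegral => t; rewrite mulrC.
have S2 : cintegral leb (fun t : rT => cintegral leb (fun x : rT => H1 (x, t))) =
    `|s|%:C * cintegral leb (fun t : rT => cintegral leb (fun u : rT => H2 (t, u))).
  rewrite -cintegralZl; last first.
    apply: cintegrable_fubini1 => // t.
    by apply: eq_cintegrable (cintegrableZl (phi t) (it2 t)) => u; rewrite mulrA.
  by apply: eq_cintegral => t; exact: inner.
have S3 : b * cintegral leb (fun u : rT => cintegral leb (fun t : rT => H2 (t, u))) =
    cintegral leb (fun u : rT => g u * gauss0 u * bargmann phi (z + (s * u)%:C)).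
  rewrite -cintegralZl; last exact: cintegrable_fubini2.
  apply: eq_cintegral => u; rewrite /bargmann -/(bconst R) -/b.
  rewrite mulrCA; congr (_ * _); rewrite -cintegralZl; last exact: iu.
  by apply: eq_cintegral => t; exact: H2E.
rewrite -S3 -(cintegral_swap i2) rmorphM -/nu.
transitivity (b * cintegral leb (fun x : rT => wavelet s g phi x * bexp z x)) => //.
rewrite S1 (cintegral_swap i1) S2.
by move: (cintegral _ _) => I; ring.
Qed.

End WaveletBargmann.

Section FockKernel.
Context (R : realType).
Local Notation C := R[i].
Local Notation rT := (measurableTypeR R).
Local Notation leb := (@lebesgue_measure R).
Local Notation area := (leb \x leb)%E.
Variables (s : R) (g : rT -> C) (f : C -> C) (z : C).
Hypothesis s_neq0 : s != 0.
Hypothesis g2 : square_integrable leb g.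
Hypothesis F2f : F2 f.

Let ncM := @ComplexField.Normc.normcM R.
Let s2 : 0 < s ^+ 2. Proof. by rewrite exprn_even_gt0. Qed.

Let gauss0 (u : R) : C := cexp (- (s ^+ 2 / 2 * u ^+ 2)%:C - (s * u)%:C * z).

Definition fock_gauss (w : C) (u : R) : C :=
  g u * cexp (- (s ^+ 2 / 2 * u ^+ 2)%:C - (s * u)%:C * (z - w^*)).

Lemma cintegrable_fock_gauss (w : C) : cintegrable leb (fock_gauss w).
Proof.
have h : 0 < s ^+ 2 / 2 by rewrite divr_gt0.
apply: eq_cintegrable (cintegrableM_sqr g2
  (square_integrable_cgauss (- s%:C * (z - w^*)) h)) => u.
rewrite /fock_gauss; congr (_ * cexp _).
by rewrite [(s * u)%:C]rmorphM /=; ring.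
Qed.

Let F (p : rT * rT) : C := f (plane p) * (half_weight (plane p))%:C.
(** The fock weight is shared out: one square root goes into [F], making it square integrable for
    Lebesgue measure, and the other stays in [K], making it decay. *)
Let K (u : rT) (p : rT * rT) : C :=
  gauss0 u * cexp ((z + (s * u)%:C) * (plane p)^*) * (half_weight (plane p))%:C.

Let C0 : R := Num.sqrt pi^-1 * expR (normc z ^+ 2 / 2).
Let C0_ge0 : 0 <= C0. Proof. by rewrite mulr_ge0 ?expR_ge0. Qed.

(** Half of [|z + s u|^2] is [|z|^2 / 2 + s u Re z + s^2 u^2 / 2]. The terms in [u] cancel against
    [gauss0 u], so that [K] is a Gaussian in [w - (z + s u)] times a constant. *)
Let normc_K u p : normc (K u p) =
  C0 * (expR (- (2^-1 * (p.1 - (s * u + complex.Re z)) ^+ 2)) *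
        expR (- (2^-1 * (p.2 - complex.Im z) ^+ 2))).
Proof.
have -> : K u p = cexp (- (s ^+ 2 / 2 * u ^+ 2)%:C - (s * u)%:C * z +
    (z + (s * u)%:C) * (plane p)^*) * (half_weight (plane p))%:C.
  by rewrite /K /gauss0 -cexpD.
rewrite ncM normc_cexp normc_real gtr0_norm ?half_weight_gt0// /C0 /half_weight.
rewrite mulrCA -[RHS]mulrA -!expRD; congr (_ * expR _).
rewrite !sqr_normcE !(ReD, ImD, ReN, ReM, ImM, Re_real, Im_real, ReJ, ImJ) /=.
by field.
Qed.

Let mK : cmeasurable (fun q : rT * (rT * rT) => K q.1 q.2).
Proof.
have mu1 : measurable_fun (setT : set (rT * (rT * rT))) (fun q => s * q.1).
  by apply: measurable_funM.
have mw : cmeasurable (fun q : rT * (rT * rT) => plane q.2).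
  exact: (cmeasurable_comp (@cmeasurable_planef R) measurable_snd).
apply: cmeasurableM; first apply: cmeasurableM.
- apply: cmeasurable_cexp; apply: cmeasurableB.
    apply: cmeasurableN; apply: cmeasurable_real; apply: measurable_funM => //.
    exact: measurable_funX.
  by apply: cmeasurableM; [exact: cmeasurable_real|exact: cmeasurable_cst].
- apply: cmeasurable_cexp; apply: cmeasurableM; last exact: cmeasurableJ.
  by apply: cmeasurableD; [exact: cmeasurable_cst|exact: cmeasurable_real].
- apply: cmeasurable_real.
  exact: (measurableT_comp (@measurable_half_weight R) measurable_snd).
Qed.

(** The sum of the two Schur bounds: the mass over the plane at fixed [u], and the mass over [u] at
    fixed [p], where the factor in [p.2] is bounded by 1. *)
Let cK : R := C0 * (pi / 2^-1) + C0 * Num.sqrt (pi / (s ^+ 2 / 2)).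

Let c1_ge0 : 0 <= C0 * (pi / 2^-1).
Proof. by rewrite mulr_ge0// divr_ge0 ?pi_ge0. Qed.

Let c2_ge0 : 0 <= C0 * Num.sqrt (pi / (s ^+ 2 / 2)).
Proof. by rewrite mulr_ge0. Qed.

Let intK1 u : (\int[area]_p (normc (K u p))%:E <= cK%:E)%E.
Proof.
under eq_integral do rewrite normc_K.
by rewrite integral_plane_gauss// lee_fin lerDl.
Qed.

Let intK2 p : (\int[leb]_u (normc (K u p))%:E <= cK%:E)%E.
Proof.
have h : 0 < s ^+ 2 / 2 by rewrite divr_gt0.
pose m := (p.1 - complex.Re z) / s.
apply: (@le_trans _ _ (\int[leb]_u (C0 * expR (- (s ^+ 2 / 2 * (u - m) ^+ 2)))%:E)%E); last first.
  by rewrite integral_scaled_gauss// lee_fin lerDr.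
apply: ge0_le_integral => //.
- by move=> u _; rewrite lee_fin normc_ge0.
- apply/measurable_EFinP; apply: measurable_normc.
  exact: (cmeasurable_comp mK (pair2_measurable p)).
- by apply/measurable_EFinP; apply: measurable_funM => //; exact: measurable_gauss.
move=> u _; rewrite lee_fin normc_K ler_wpM2l//.
have -> : 2^-1 * (p.1 - (s * u + complex.Re z)) ^+ 2 = s ^+ 2 / 2 * (u - m) ^+ 2.
  by rewrite /m; field.
by rewrite ler_piMr ?expR_ge0// expR_le1 oppr_le0 mulr_ge0 ?sqr_ge0.
Qed.

Let H (q : rT * (rT * rT)) : C := g q.1 * F q.2 * K q.1 q.2.

Let intH : cintegrable (leb \x area_measure R)%E H.
Proof.
exact: (schur_test (n := area_measure R) g2 (square_integrable_F2 F2f) mK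
  (addr_ge0 c1_ge0 c2_ge0) intK1 intK2).1.
Qed.

(** The integrand is factored in two ways: [HE1] isolates the reproducing integral at [z + s u] for
    the integration over the plane, and [HE2] isolates [fock_gauss] for the integration over [u]. *)
Let HE1 u p : H (u, p) = (g u * gauss0 u) *
  (f (plane p) * cexp ((z + (s * u)%:C) * (plane p)^*) * (fock_weight (plane p))%:C).
Proof.
rewrite /H /F /K /= -half_weight_sqr.
move: (gauss0 u) (cexp _) (half_weight _) => a b c.
by rewrite rmorphXn; ring.
Qed.

Let HE2 u p : H (u, p) =
  (f (plane p) * cexp (z * (plane p)^*) * (fock_weight (plane p))%:C) * fock_gauss (plane p) u.
Proof.
have h : gauss0 u * cexp ((z + (s * u)%:C) * (plane p)^*) =
    cexp (z * (plane p)^*) * cexp (- (s ^+ 2 / 2 * u ^+ 2)%:C - (s * u)%:C * (z - (plane p)^*)).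
  by rewrite /gauss0 -!cexpD; congr cexp; ring.
rewrite HE1 /fock_gauss.
transitivity (g u * f (plane p) * (fock_weight (plane p))%:C *
  (gauss0 u * cexp ((z + (s * u)%:C) * (plane p)^*))).
  by move: (gauss0 u) (cexp _) => a b; ring.
by rewrite h; move: (cexp _) (cexp _) => a b; ring.
Qed.

Lemma fock_kernel_swap :
  lambda_integrable (fun w => f w * cexp (z * w^*) * cintegral leb (fock_gauss w)) /\
  cintegral leb (fun u : rT => g u * gauss0 u * f (z + (s * u)%:C)) =
  lambda_integral (fun w => f w * cexp (z * w^*) * cintegral leb (fock_gauss w)).
Proof.
have E p : cintegral leb (fun u : rT => H (u, p)) =
    f (plane p) * cexp (z * (plane p)^*) * cintegral leb (fock_gauss (plane p)) *
    (fock_weight (plane p))%:C.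
  rewrite mulrAC -cintegralZl; last exact: cintegrable_fock_gauss.
  by apply: eq_cintegral => u; rewrite HE2.
have iu p : cintegrable leb (fun u : rT => H (u, p)).
  apply: eq_cintegrable (cintegrableZl (f (plane p) * cexp (z * (plane p)^*) *
    (fock_weight (plane p))%:C) (cintegrable_fock_gauss (plane p))) => u.
  by rewrite HE2.
split; first exact: eq_cintegrable E (cintegrable_fubini2 intH iu).
transitivity (cintegral leb (fun u : rT => cintegral area (fun p => H (u, p)))).
  apply: eq_cintegral => u; have [ir <-] := fock_reproducing (z + (s * u)%:C) F2f.
  by rewrite -(cintegralZl _ ir); apply: eq_cintegral => p; exact: esym (HE1 u p).
transitivity (cintegral area (fun p => cintegral leb (fun u : rT => H (u, p)))).
  exact: (cintegral_swap intH).
by apply: eq_cintegral => p; exact: E.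
Qed.

End FockKernel.

Theorem lemma10 (R : realType) (s : R) (g : R -> R[i])
    (s_neq0 : s != 0) (gL2 : L2 g)
    (W_bounded : bounded_linear_L2 (wavelet s g)) :
  forall f : R[i] -> R[i], F2 f ->
    F2 (fock_operator s g f) /\
    forall z : R[i],
      let gauss (w : R[i]) (t : R) : R[i] :=
        g t * cexp (- (s ^+ 2 / 2%:R * t ^+ 2)%:C
                    - (s * t)%:C * (z - w^*)) in
      let kernel (w : R[i]) : R[i] :=
        cintegral (@lebesgue_measure R) (gauss w) in
      [/\ forall w : R[i], cintegrable (@lebesgue_measure R) (gauss w),
          lambda_integrable (fun w => f w * cexp (z * w^*) * kernel w)
        & fock_operator s g f z =
          (Num.sqrt (`|s| / pi))%:C *
          lambda_integral (fun w => f w * cexp (z * w^*) * kernel w)].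
Proof.
move=> f F2f; have [WL2 _ _] := W_bounded.
have [phiL2 phif] := bargmann_invP F2f; have g2 := (L2P g).1 gL2.
split=> [|z gauss kernel]; first exact/F2_bargmann/WL2.
have [kint kE] := fock_kernel_swap z s_neq0 g2 F2f.
split=> //; first exact: cintegrable_fock_gauss.
rewrite /fock_operator (bargmann_wavelet z s_neq0 g2 ((L2P _).1 phiL2)) phif kE.
(* The Jacobian [|s|] and the normalization of the wavelet transform combine:
   [|s| / sqrt (|s| pi) = sqrt (|s| / pi)]. *)
congr (_%:C * _).
have p0 := @pi_gt0 R; have s0 : 0 < `|s| by rewrite normr_gt0.
have s0' := ltW s0; rewrite !(sqrtrM _ s0') (sqrtrV (ltW p0)).
have : 0 < Num.sqrt pi :> R by rewrite sqrtr_gt0.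
have : 0 < Num.sqrt `|s| by rewrite sqrtr_gt0.
have : `|s| = Num.sqrt `|s| ^+ 2 by rewrite sqr_sqrtr.
move: (Num.sqrt `|s|) (Num.sqrt pi) => q r -> q0 r0.
by field; rewrite !gt_eqF.
Qed.
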